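(* The problem of deciding derivability in $\boldsymbol{!}_\mathbf{b}\mathbf{L}^{\mathbf{1}}$, restricted to input sequents that obey the bracket non-negative condition, belongs to the complexity class NP.
   Context: The calculus $\boldsymbol{!}_\mathbf{b}\mathbf{L}^{\mathbf{1}}$: formulae are built from variables $p_1,p_2,\dots$ and the constant $\mathbf{1}$ using binary $\backslash$, $/$, $\cdot$ and unary $\langle\rangle$, $[]^{-1}$, $!$. Meta-formulae are finite (possibly empty, empty one denoted $\Lambda$) sequences whose elements are formulae or bracketed meta-formulae $[\Pi]$; comma is concatenation; $\Delta(\Gamma)$ denotes $\Delta$ with a designated occurrence of a meta-formula $\Gamma$ (consecutive elements at some bracket depth). Sequents are $\Pi\to A$ ($\Pi$ meta-formula, $A$ formula). Axioms: $A\to A$, $\Lambda\to\mathbf{1}$. Rules (premises $\Rightarrow$ conclusion): $(/\to)$: $\Gamma\to B$, $\Delta(C)\to D$ $\Rightarrow$ $\Delta(C/B,\Gamma)\to D$; $(\to/)$: $\Gamma,B\to C$ $\Rightarrow$ $\Gamma\to C/B$; $(\backslash\to)$: $\Gamma\to A$, $\Delta(C)\to D$ $\Rightarrow$ $\Delta(\Gamma,A\backslash C)\to D$; $(\to\backslash)$: $A,\Gamma\to C$ $\Rightarrow$ $\Gamma\to A\backslash C$; $(\cdot\to)$: $\Delta(A,B)\to D$ $\Rightarrow$ $\Delta(A\cdot B)\to D$; $(\to\cdot)$: $\Gamma_1\to A$, $\Gamma_2\to B$ $\Rightarrow$ $\Gamma_1,\Gamma_2\to A\cdot B$; $(\mathbf{1}\to)$: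 $\Delta(\Lambda)\to A$ $\Rightarrow$ $\Delta(\mathbf{1})\to A$; $(\langle\rangle\to)$: $\Delta([A])\to C$ $\Rightarrow$ $\Delta(\langle\rangle A)\to C$; $(\to\langle\rangle)$: $\Pi\to A$ $\Rightarrow$ $[\Pi]\to\langle\rangle A$; $([]^{-1}\to)$: $\Delta(A)\to C$ $\Rightarrow$ $\Delta([[]^{-1}A])\to C$; $(\to[]^{-1})$: $[\Pi]\to A$ $\Rightarrow$ $\Pi\to[]^{-1}A$; $(!\to)$: $\Gamma(A)\to B$ $\Rightarrow$ $\Gamma(!A)\to B$; $(\to!)$: $!A_1,\dots,!A_n\to A$ $\Rightarrow$ $!A_1,\dots,!A_n\to!A$; $(\mathrm{contr}_\mathbf{b})$: $\Delta(!A_1,\dots,!A_n,[!A_1,\dots,!A_n,\Gamma])\to B$ $\Rightarrow$ $\Delta(!A_1,\dots,!A_n,\Gamma)\to B$ ($n\ge1$); $(\mathrm{perm}_1)$: $\Delta(!A,\Gamma)\to B$ $\Rightarrow$ $\Delta(\Gamma,!A)\to B$; $(\mathrm{perm}_2)$: $\Delta(\Gamma,!A)\to B$ $\Rightarrow$ $\Delta(!A,\Gamma)\to B$; $(\mathrm{cut})$: $\Pi\to A$, $\Delta(A)\to C$ $\Rightarrow$ $\Delta(\Pi)\to C$. Polarity of subformula occurrences: every formula occurs positively in itself; if an occurrence is positive (resp. negative) in $B$, it is positive (resp. negative) in $A\backslash B$, $B/A$, $A\cdot B$, $B\cdot A$, $\langle\rangle B$, $[]^{-1}B$, $!B$; if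 an occurrence is positive (resp. negative) in $A$, it is negative (resp. positive) in $A\backslash B$ and $B/A$; in a sequent $\Gamma\to B$, occurrences inside $B$ keep their polarity and occurrences inside formulae of $\Gamma$ have their polarity inverted (brackets do not change polarity). A sequent $\Gamma\to B$ obeys the bracket non-negative condition if every negative occurrence of a subformula of the form $!A$ in $\Gamma\to B$ contains neither a positive occurrence of a subformula of the form $[]^{-1}C$ nor a negative occurrence of a subformula of the form $\langle\rangle C$. *)

(* Defs.v *)
From Corelib Require Import BinNums.
From HB Require Import structures.
From mathcomp Require Import all_boot all_order all_algebra.

Set Implicit Arguments.
Unset Strict Implicit.
Unset Printing Implicit Defensive.

(** [Ldiv A C] is A \ C and [Rdiv C B] is C / B; [Dia A] is <>A and
    [Box A] is []^{-1}A. *)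
Inductive formula : Type :=
  | Var of nat
  | One
  | Ldiv of formula & formula
  | Rdiv of formula & formula
  | Prod of formula & formula
  | Dia of formula
  | Box of formula
  | Bang of formula.

Inductive item : Type :=
  | Fm of formula
  | Br of seq item.

Definition meta := seq item.

(** A meta-formula with one designated position, at any bracket depth. *)
Inductive context : Type :=
  | Hole of meta & meta
  | InBr of meta & context & meta.

Fixpoint fill (D : context) (G : meta) : meta :=
  match D with
  | Hole l r => l ++ G ++ r
  | InBr l D' r => l ++ Br (fill D' G) :: r
  end.

Definition bangs (As : seq formula) : meta := [seq Fm (Bang A) | A <- As].

Inductive derivable : meta -> formula -> Prop :=
  | d_ax A : derivable [:: Fm A] A
  | d_oneR : derivable [::] One
  | d_rdivL G D B C E :
      derivable G B -> derivable (fill D [:: Fm C]) E ->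
      derivable (fill D (Fm (Rdiv C B) :: G)) E
  | d_rdivR G B C :
      derivable (G ++ [:: Fm B]) C -> derivable G (Rdiv C B)
  | d_ldivL G D A C E :
      derivable G A -> derivable (fill D [:: Fm C]) E ->
      derivable (fill D (G ++ [:: Fm (Ldiv A C)])) E
  | d_ldivR G A C :
      derivable (Fm A :: G) C -> derivable G (Ldiv A C)
  | d_prodL D A B E :
      derivable (fill D [:: Fm A; Fm B]) E ->
      derivable (fill D [:: Fm (Prod A B)]) E
  | d_prodR G1 G2 A B :
      derivable G1 A -> derivable G2 B -> derivable (G1 ++ G2) (Prod A B)
  | d_oneL D A :
      derivable (fill D [::]) A -> derivable (fill D [:: Fm One]) A
  | d_diaL D A C :
      derivable (fill D [:: Br [:: Fm A]]) C ->
      derivable (fill D [:: Fm (Dia A)]) C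
  | d_diaR P A :
      derivable P A -> derivable [:: Br P] (Dia A)
  | d_boxL D A C :
      derivable (fill D [:: Fm A]) C ->
      derivable (fill D [:: Br [:: Fm (Box A)]]) C
  | d_boxR P A :
      derivable [:: Br P] A -> derivable P (Box A)
  | d_bangL D A B :
      derivable (fill D [:: Fm A]) B ->
      derivable (fill D [:: Fm (Bang A)]) B
  | d_bangR As A :
      derivable (bangs As) A -> derivable (bangs As) (Bang A)
  | d_contr D As G B :
      1 <= size As ->
      derivable (fill D (bangs As ++ [:: Br (bangs As ++ G)])) B ->
      derivable (fill D (bangs As ++ G)) B
  | d_perm1 D A G B :
      derivable (fill D (Fm (Bang A) :: G)) B ->
      derivable (fill D (G ++ [:: Fm (Bang A)])) B
  | d_perm2 D A G B :
      derivable (fill D (G ++ [:: Fm (Bang A)])) B ->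
      derivable (fill D (Fm (Bang A) :: G)) B
  | d_cut P D A C :
      derivable P A -> derivable (fill D [:: Fm A]) C ->
      derivable (fill D P) C.

(** [occ b A F]: A has an occurrence in F of polarity b, [true] being
    positive. *)
Inductive occ : bool -> formula -> formula -> Prop :=
  | occ_refl A : occ true A A
  | occ_ldiv_num b X A B : occ b X B -> occ b X (Ldiv A B)
  | occ_ldiv_den b X A B : occ b X A -> occ (~~ b) X (Ldiv A B)
  | occ_rdiv_num b X A B : occ b X B -> occ b X (Rdiv B A)
  | occ_rdiv_den b X A B : occ b X A -> occ (~~ b) X (Rdiv B A)
  | occ_prod_l b X A B : occ b X A -> occ b X (Prod A B)
  | occ_prod_r b X A B : occ b X B -> occ b X (Prod A B)
  | occ_dia b X A : occ b X A -> occ b X (Dia A)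
  | occ_box b X A : occ b X A -> occ b X (Box A)
  | occ_bang b X A : occ b X A -> occ b X (Bang A).

Inductive occ_sequent : bool -> formula -> meta -> formula -> Prop :=
  | occ_succ b X G B : occ b X B -> occ_sequent b X G B
  | occ_ante b X D F B :
      occ b X F -> occ_sequent (~~ b) X (fill D [:: Fm F]) B.

(** The polarities of []^{-1}C and <>C are those inside the formula !A, not
    those in the whole sequent (which are the opposite ones): what must be
    excluded is that a contractible !A brings in connectives whose
    introduction rules erase brackets when read from conclusion to premise. *)
Definition bracket_nonneg (G : meta) (B : formula) : Prop :=
  forall A, occ_sequent false (Bang A) G B ->
    (forall C, ~ occ true (Box C) (Bang A)) /\
    (forall C, ~ occ false (Dia C) (Bang A)).

Inductive symbol : Type :=
  | SVar | SBit of bool | SEnd | SOne | SLdiv | SRdiv | SProd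
  | SDia | SBox | SBang | SOpen | SClose | SArrow.

Definition symbol_nat (s : symbol) : nat :=
  match s with
  | SVar => 0 | SBit false => 1 | SBit true => 2 | SEnd => 3 | SOne => 4
  | SLdiv => 5 | SRdiv => 6 | SProd => 7 | SDia => 8 | SBox => 9
  | SBang => 10 | SOpen => 11 | SClose => 12 | SArrow => 13
  end.

Lemma symbol_nat_lt s : symbol_nat s < 14.
Proof. by case: s => [|[]|||||||||||]. Qed.

Definition symbol_code (s : symbol) : 'I_14 := Ordinal (symbol_nat_lt s).

Definition symbol_decode (i : 'I_14) : symbol :=
  nth SVar [:: SVar; SBit false; SBit true; SEnd; SOne; SLdiv; SRdiv; SProd;
               SDia; SBox; SBang; SOpen; SClose; SArrow] i.

Lemma symbol_codeK : cancel symbol_code symbol_decode.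
Proof. by case=> [|[]|||||||||||]. Qed.

HB.instance Definition _ := Finite.copy symbol (can_type symbol_codeK).

(** Binary digits, least significant first; 0 has no digit. *)
Fixpoint pos_bits (p : positive) : seq bool :=
  match p with
  | xH => [:: true]
  | xO p' => false :: pos_bits p'
  | xI p' => true :: pos_bits p'
  end.

Definition nat_bits (n : nat) : seq bool :=
  if bin_of_nat n is Npos p then pos_bits p else [::].

(** Prefix notation; a variable is written as its index in binary. *)
Fixpoint enc_formula (A : formula) : seq symbol :=
  match A with
  | Var i => SVar :: [seq SBit b | b <- nat_bits i] ++ [:: SEnd]
  | One => [:: SOne]
  | Ldiv A B => SLdiv :: enc_formula A ++ enc_formula B
  | Rdiv A B => SRdiv :: enc_formula A ++ enc_formula B
  | Prod A B => SProd :: enc_formula A ++ enc_formula B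
  | Dia A => SDia :: enc_formula A
  | Box A => SBox :: enc_formula A
  | Bang A => SBang :: enc_formula A
  end.

Fixpoint enc_item (x : item) : seq symbol :=
  match x with
  | Fm A => enc_formula A
  | Br G => SOpen :: flatten [seq enc_item y | y <- G] ++ [:: SClose]
  end.

Definition enc_meta (G : meta) : seq symbol := flatten [seq enc_item x | x <- G].

Definition enc_sequent (G : meta) (B : formula) : seq symbol :=
  enc_meta G ++ SArrow :: enc_formula B.

Lemma nat_bits_inj : injective nat_bits.
Proof.
have pos_inj : injective pos_bits.
  have nz p : pos_bits p <> [::] by case: p.
  elim=> [p IH|p IH|] [q|q|] //= [].
  - by move/IH->.
  - by move/nz.
  - by move/IH->.
  - by move/esym/nz.
move=> m n; rewrite /nat_bits => e.
suff: bin_of_nat m = bin_of_nat n by apply: (can_inj bin_of_natK).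
move: e; case: (bin_of_nat m) (bin_of_nat n) => [|p] [|q] //=.
- by case: q.
- by case: p.
- by move/pos_inj->.
Qed.

Lemma enc_bits_prefix (u v : seq bool) s t :
  [seq SBit b | b <- u] ++ SEnd :: s = [seq SBit b | b <- v] ++ SEnd :: t ->
  u = v /\ s = t.
Proof. by elim: u v => [|a u IH] [|b v] //= [] => [->|-> /IH[-> ->]]. Qed.

Lemma enc_formula_prefix A B s t :
  enc_formula A ++ s = enc_formula B ++ t -> A = B /\ s = t.
Proof.
elim: A B s t => [i||A IA B IB|A IA B IB|A IA B IB|A IA|A IA|A IA]
  [j||A' B'|A' B'|A' B'|A'|A'|A'] s t //= [].
- by rewrite -!catA /= => /enc_bits_prefix[/nat_bits_inj-> ->].
- by move->.
- by rewrite -!catA => /IA[-> /IB[-> ->]].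
- by rewrite -!catA => /IA[-> /IB[-> ->]].
- by rewrite -!catA => /IA[-> /IB[-> ->]].
- by move/IA=> [-> ->].
- by move/IA=> [-> ->].
- by move/IA=> [-> ->].
Qed.

Lemma enc_meta_prefix G H s t (stop := fun w : seq symbol =>
    if w is c :: _ then (c == SClose) || (c == SArrow) else false) :
  stop s -> stop t -> enc_meta G ++ s = enc_meta H ++ t -> G = H /\ s = t.
Proof.
have start A w : stop (enc_formula A ++ w) = false by case: A.
have [n] := ubnP (size (enc_meta G)).
elim: n G H s t => // n IH [|x G] [|y H] s t ltn Ss St;
  rewrite /enc_meta /= -?catA //.
- move=> e; move: Ss; rewrite e.
  by case: y {e} => [B|H'] /=; rewrite ?start.
- move=> e; move: St; rewrite -e.
  by case: x {e ltn} => [B|H'] /=; rewrite ?start.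
have lt2 : size (enc_meta G) < n.
  rewrite -ltnS; apply: leq_trans ltn; rewrite /enc_meta /= size_cat.
  by case: (x) => [[]|] *; rewrite /= addSn !ltnS leq_addl.
case: x y ltn => [A|G'] [B|H'] ltn /=.
- move/enc_formula_prefix=> [-> e].
  by have [-> ->] := IH G H s t lt2 Ss St e.
- by case: (A).
- by case: (B).
case; rewrite -!catA /= => e.
have lt1 : size (enc_meta G') < n.
  rewrite -ltnS; apply: leq_trans ltn.
  by rewrite /enc_meta /= !size_cat /= -!addnA !ltnS leq_addr.
have [//|//|-> [e']] := IH G' H' _ _ lt1 _ _ e.
by have [-> ->] := IH G H s t lt2 Ss St e'.
Qed.

Lemma enc_sequent_inj G B H C :
  enc_sequent G B = enc_sequent H C -> G = H /\ B = C.
Proof.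
move/enc_meta_prefix=> [//|//|-> [e]].
by have [] := @enc_formula_prefix B C [::] [::]; rewrite ?cats0.
Qed.

(** Two-way infinite tape; the cells adjacent to the head come first in both
    lists, and [None] is the blank symbol. *)
Record tape (A : Type) := Tape {
  tape_left : seq (option A);
  tape_cur : option A;
  tape_right : seq (option A)
}.

Inductive move := MoveL | Stay | MoveR.

Definition write_move (A : Type) (am : option A * move) (t : tape A) : tape A :=
  let: (a, m) := am in
  match m with
  | MoveL => Tape (behead (tape_left t)) (head None (tape_left t))
                  (a :: tape_right t)
  | Stay => Tape (tape_left t) a (tape_right t)
  | MoveR => Tape (a :: tape_left t) (head None (tape_right t))
                  (behead (tape_right t))
  end.

Definition tape_of (A : Type) (w : seq A) : tape A :=
  let w' := [seq Some a | a <- w] in Tape [::] (head None w') (behead w').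

(** Deterministic multi-tape machines with two inputs: a word over S on tape 0
    and a certificate over the alphabet [tm_work] on tape 1.  A state halts
    with the answer b when its verdict is [Some b]. *)
Record tm (S : finType) := TM {
  tm_work : finType;
  tm_state : finType;
  tm_aux : nat;
  tm_start : tm_state;
  tm_verdict : tm_state -> option bool;
  tm_delta : tm_state -> {ffun 'I_tm_aux.+2 -> option (S + tm_work)} ->
             tm_state * {ffun 'I_tm_aux.+2 -> option (S + tm_work) * move}
}.

Definition config (S : finType) (M : tm S) : Type :=
  tm_state M * ('I_(tm_aux M).+2 -> tape (S + tm_work M)).

Definition tm_init (S : finType) (M : tm S) (x : seq S) (u : seq (tm_work M)) :
    config M :=
  (tm_start M,
   fun i => match val i with
            | 0 => tape_of [seq inl a | a <- x]
            | 1 => tape_of [seq inr a | a <- u]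
            | _ => tape_of [::]
            end).

Definition tm_step (S : finType) (M : tm S) (c : config M) : config M :=
  if tm_verdict c.1 is Some _ then c else
  let: (q, acts) := tm_delta c.1 [ffun i => tape_cur (c.2 i)] in
  (q, fun i => write_move (acts i) (c.2 i)).

Definition tm_result (S : finType) (M : tm S) (n : nat) (x : seq S)
    (u : seq (tm_work M)) : option bool :=
  tm_verdict (iter n (@tm_step S M) (tm_init x u)).1.

Definition in_NP (S : finType) (L : seq S -> Prop) : Prop :=
  exists (M : tm S) (p q : {poly nat}),
    (forall (x : seq S) (u : seq (tm_work M)),
        size u <= p.[size x]%R -> tm_result q.[size x]%R x u <> None) /\
    (forall x : seq S,
        L x <-> exists u : seq (tm_work M),
                  size u <= p.[size x]%R /\
                  tm_result q.[size x]%R x u = Some true).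

(* Main.v *)
From Corelib Require Import BinNums.
From HB Require Import structures.
Require Import Defs.
From mathcomp Require Import all_boot all_algebra zify.

(** With the axiom [Lambda -> !1] and cut, contracting the empty sequence of
    formulae is derivable, and once this degenerate contraction is allowed cut
    can be eliminated, by interpreting formulae as sets of meta-formulae closed
    under the cut-free left rules.

    Read from conclusion to premises, every contraction creates a bracket pair,
    and bracket pairs disappear only by (-> <>) and ([]^{-1} ->).  By the bracket
    non-negative condition the connectives introduced by these two rules never
    occur in a contractible formula, so they are not multiplied, and the number
    of contractions is at most their number in the goal.  Moreover a bracket level
    never contains more contractible material than the whole goal does, hence a
    cut-free derivation has polynomial size up to the number of permutations
    of formulae !A, and consecutive permutations can be replaced by
    quadratically many.

    The certificate is a sequence of elementary stack operations.  The machine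
    checks that they form a word of a fixed context-free grammar, keeping the
    pending nonterminals on a control stack, and executes them.  The grammar is
    such that the words that execute successfully are the cut-free derivations of
    the input, written as rewritings of a stack of sequents. *)

Set Implicit Arguments.
Unset Strict Implicit.
Unset Printing Implicit Defensive.

(** * Cut elimination *)

(** A cut can replace !A by any sequence of formulae !B, the empty one included, so eliminating cuts
    may turn an ordinary contraction into one of zero formulae; hence [cf_contr] puts no lower bound
    on [As]. Such a contraction still creates a bracket pair and is counted like the others. A bound
    on the number of contractions alone would allow exponential growth, since a later contraction
    may copy what an earlier one copied. Growth is additive because a contraction copies formulae of
    one bracket level only, and every level stays below a fixed bound. The count itself, erasing
    connectives minus brackets present, is never negative in a derivable sequent that obeys the
    condition; this is proved in the same induction as the size bound, [cf_solved]. The machine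
    makes no choice of its own: the certificate supplies all of them, and a wrong one fails because
    a popped symbol is not the expected one or a stack is not empty. Equality of two copies of a
    meta-formula follows from unique readability of the encoding. *)

Inductive cf : meta -> formula -> Prop :=
  | cf_ax A : cf [:: Fm A] A
  | cf_oneR : cf [::] One
  | cf_rdivL G D B C E :
      cf G B -> cf (fill D [:: Fm C]) E ->
      cf (fill D (Fm (Rdiv C B) :: G)) E
  | cf_rdivR G B C : cf (G ++ [:: Fm B]) C -> cf G (Rdiv C B)
  | cf_ldivL G D A C E :
      cf G A -> cf (fill D [:: Fm C]) E ->
      cf (fill D (G ++ [:: Fm (Ldiv A C)])) E
  | cf_ldivR G A C : cf (Fm A :: G) C -> cf G (Ldiv A C)
  | cf_prodL D A B E :
      cf (fill D [:: Fm A; Fm B]) E -> cf (fill D [:: Fm (Prod A B)]) E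
  | cf_prodR G1 G2 A B : cf G1 A -> cf G2 B -> cf (G1 ++ G2) (Prod A B)
  | cf_oneL D A : cf (fill D [::]) A -> cf (fill D [:: Fm One]) A
  | cf_diaL D A C :
      cf (fill D [:: Br [:: Fm A]]) C -> cf (fill D [:: Fm (Dia A)]) C
  | cf_diaR P A : cf P A -> cf [:: Br P] (Dia A)
  | cf_boxL D A C :
      cf (fill D [:: Fm A]) C -> cf (fill D [:: Br [:: Fm (Box A)]]) C
  | cf_boxR P A : cf [:: Br P] A -> cf P (Box A)
  | cf_bangL D A B :
      cf (fill D [:: Fm A]) B -> cf (fill D [:: Fm (Bang A)]) B
  | cf_bangR As A : cf (bangs As) A -> cf (bangs As) (Bang A)
  | cf_contr D As G B :
      cf (fill D (bangs As ++ [:: Br (bangs As ++ G)])) B ->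
      cf (fill D (bangs As ++ G)) B
  | cf_perm1 D A G B :
      cf (fill D (Fm (Bang A) :: G)) B ->
      cf (fill D (G ++ [:: Fm (Bang A)])) B
  | cf_perm2 D A G B :
      cf (fill D (G ++ [:: Fm (Bang A)])) B ->
      cf (fill D (Fm (Bang A) :: G)) B.

Fixpoint ctx_comp (D1 D2 : context) : context :=
  match D1 with
  | Hole l r =>
      match D2 with
      | Hole l' r' => Hole (l ++ l') (r' ++ r)
      | InBr l' D r' => InBr (l ++ l') D (r' ++ r)
      end
  | InBr l D r => InBr l (ctx_comp D D2) r
  end.

Lemma fill_comp D1 D2 G : fill (ctx_comp D1 D2) G = fill D1 (fill D2 G).
Proof.
elim: D1 => [l r|l D IH r] /=; last by rewrite IH.
by case: D2 => [l' r'|l' D r'] /=; rewrite -!catA.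
Qed.

Lemma fill_cat D l G r : fill D (l ++ G ++ r) = fill (ctx_comp D (Hole l r)) G.
Proof. by rewrite fill_comp. Qed.

(* Cutting the contraction of !1 with the derivable [Lambda -> !1] amounts to a
   contraction of the empty sequence of formulae. *)
Lemma derivable_unbracket D G B :
  derivable (fill D [:: Br G]) B -> derivable (fill D G) B.
Proof.
move=> dG; have one : derivable [::] (Bang One) by apply: (d_bangR (As := [::])); apply: d_oneR.
have -> : fill D G = fill (ctx_comp D (Hole [::] G)) [::] by rewrite fill_comp.
apply: d_cut one _; rewrite fill_comp /=.
apply: (d_contr (As := [:: One])) => //=.
(* The contraction leaves one !1 outside the new bracket and one inside; (! ->) followed by (1 ->)
   erases each of them. *)
rewrite (fill_cat D [::] [:: Fm (Bang One)] [:: Br (Fm (Bang One) :: G)]).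
apply/d_bangL/d_oneL; rewrite fill_comp /=.
have -> : fill D [:: Br (Fm (Bang One) :: G)] =
    fill (ctx_comp D (InBr [::] (Hole [::] G) [::])) [:: Fm (Bang One)].
  by rewrite fill_comp.
by apply/d_bangL/d_oneL; rewrite fill_comp.
Qed.

Lemma cf_derivable G B : cf G B -> derivable G B.
Proof.
elim=> *; try by [apply: d_ax | apply: d_oneR | apply: d_rdivL | apply: d_rdivR
  | apply: d_ldivL | apply: d_ldivR | apply: d_prodL | apply: d_prodR
  | apply: d_oneL | apply: d_diaL | apply: d_diaR | apply: d_boxL
  | apply: d_boxR | apply: d_bangL | apply: d_bangR | apply: d_perm1
  | apply: d_perm2].
match goal with h : derivable (fill _ (bangs ?Bs ++ _)) _, h' : cf _ _ |- _ =>
  case: Bs h {h'} => [|A' As'] h; [exact: derivable_unbracket h | exact: d_contr h] end.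
Qed.


(** Double orthogonal of [X], as in phase semantics: a test is a context with a succedent, and it is
    passed when the filled sequent is cut-free derivable. *)
Definition cl (X : meta -> Prop) (G : meta) : Prop :=
  forall D C, (forall H, X H -> cf (fill D H) C) -> cf (fill D G) C.

Definition closed (X : meta -> Prop) : Prop := forall G, cl X G -> X G.

Lemma cl_incl (X : meta -> Prop) G : X G -> cl X G.
Proof. by move=> XG D C; apply. Qed.

Lemma closed_cl X : closed (cl X).
Proof. by move=> G clG D C h; apply: clG => H; apply. Qed.

Lemma closed_cf B : closed (cf^~ B).
Proof.
move=> G /(_ (Hole [::] [::]) B) /=; rewrite cats0; apply=> H.
by rewrite cats0.
Qed.

(** A test for [Y] composed with [D] is a test for [X]. *)
Lemma closed_ctx (X Y : meta -> Prop) D G : closed Y ->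
  (forall H, X H -> Y (fill D H)) -> cl X G -> Y (fill D G).
Proof.
move=> cY XY clG; apply: cY => D0 C h; rewrite -fill_comp; apply: clG => H XH.
by rewrite fill_comp; apply/h/XY.
Qed.

Lemma closed_rule (Y : meta -> Prop) D G H : closed Y ->
  (forall D C, cf (fill D G) C -> cf (fill D H) C) -> Y (fill D G) -> Y (fill D H).
Proof.
move=> cY r YG; apply: (@closed_ctx (eq G)) => // [_ <- //|D0 C h].
exact/r/h.
Qed.

(** The generators in the clause for [Bang] are themselves sequences of formulae !B, so that (-> !),
    contraction and the permutations apply to them directly. The empty sequence is allowed. *)
Fixpoint sem (A : formula) : meta -> Prop :=
  match A with
  | Var i => cf^~ (Var i)
  | One => cl (eq [::])
  | Ldiv A C => fun G => forall H, sem A H -> sem C (H ++ G)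
  | Rdiv C B => fun G => forall H, sem B H -> sem C (G ++ H)
  | Prod A B => cl (fun G => exists G1 G2, [/\ G = G1 ++ G2, sem A G1 & sem B G2])
  | Dia A => cl (fun G => exists2 H, G = [:: Br H] & sem A H)
  | Box A => fun G => sem A [:: Br G]
  | Bang A => cl (fun G => exists2 As, G = bangs As & sem A G)
  end.

Lemma closed_sem A : closed (sem A).
Proof.
elim: A => [i||A _ C IC|C IC B _|A _ B _|A _|A IA|A _] /=;
  try exact: closed_cl; first exact: closed_cf.
- move=> G clG H AH; rewrite -[G]cats0; apply: (@closed_ctx _ _ (Hole H [::]) G IC _ clG).
  by move=> K /= CK; rewrite cats0; apply: CK.
- move=> G clG H BH; apply: (@closed_ctx _ _ (Hole [::] H) G IC _ clG).
  by move=> K /= CK; apply: CK.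
- move=> G clG; have := @closed_ctx _ _ (InBr [::] (Hole [::] [::]) [::]) G IA _ clG.
  by rewrite /= cats0; apply=> K; rewrite /= cats0.
Qed.

Lemma sem_rule A D G H : (forall D C, cf (fill D G) C -> cf (fill D H) C) ->
  sem A (fill D G) -> sem A (fill D H).
Proof. exact: closed_rule (@closed_sem A). Qed.

Lemma sem_rule0 A G H : (forall D C, cf (fill D G) C -> cf (fill D H) C) ->
  sem A G -> sem A H.
Proof.
by move=> r; have := @sem_rule A (Hole [::] [::]) G H r; rewrite /= !cats0.
Qed.

Lemma okada A : sem A [:: Fm A] /\ (forall G, sem A G -> cf G A).
Proof.
have cfcl (X : meta -> Prop) B G : (forall H, X H -> cf H B) -> cl X G -> cf G B.
  move=> XB clG; have := clG (Hole [::] [::]) B; rewrite /= cats0; apply=> H XH.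
  by rewrite cats0; apply: XB.
elim: A => [i||A [IA1 IA2] C [IC1 IC2]|C [IC1 IC2] B [IB1 IB2]
  |A [IA1 IA2] B [IB1 IB2]|A [IA1 IA2]|A [IA1 IA2]|A [IA1 IA2]] /=; split.
- exact: cf_ax.
- by [].
- by move=> D C h; apply/cf_oneL/h.
- by move=> G; apply: cfcl => H <-; apply: cf_oneR.
- move=> H /IA2 cfH; apply: sem_rule0 IC1 => D E; exact: cf_ldivL.
- by move=> G /(_ _ IA1) /IC2 ?; apply: cf_ldivR.
- move=> H /IB2 cfH; apply: sem_rule0 IC1 => D E; exact: cf_rdivL.
- by move=> G /(_ _ IB1) /IC2 ?; apply: cf_rdivR.
- by move=> D E h; apply/cf_prodL/h; exists [:: Fm A], [:: Fm B].
- by move=> G; apply: cfcl => H [G1 [G2 [-> /IA2 ? /IB2 ?]]]; apply: cf_prodR.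
- by move=> D E h; apply/cf_diaL/h; exists [:: Fm A].
- by move=> G; apply: cfcl => H [K -> /IA2 ?]; apply: cf_diaR.
- by apply: sem_rule0 IA1 => D E; apply: cf_boxL.
- by move=> G /IA2 ?; apply: cf_boxR.
- apply: cl_incl; exists [:: A] => //.
  by apply: sem_rule0 IA1 => D E; apply: cf_bangL.
- by move=> G; apply: cfcl => H [As -> /IA2 ?]; apply: cf_bangR.
Qed.

Inductive sem_meta : meta -> meta -> Prop :=
  | sem_nil : sem_meta [::] [::]
  | sem_fm A G H1 H2 : sem A H1 -> sem_meta G H2 -> sem_meta (Fm A :: G) (H1 ++ H2)
  | sem_br G' G H1 H2 :
      sem_meta G' H1 -> sem_meta G H2 -> sem_meta (Br G' :: G) (Br H1 :: H2).

Lemma sem_meta_cat G1 G2 H1 H2 :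
  sem_meta G1 H1 -> sem_meta G2 H2 -> sem_meta (G1 ++ G2) (H1 ++ H2).
Proof.
move=> s1 s2; elim: s1 => [//|A G K1 K2 h _ IH|G' G K1 K2 h _ _ IH] /=.
- by rewrite -catA; apply: sem_fm.
- exact: sem_br.
Qed.

Lemma sem_meta_catI G1 G2 H : sem_meta (G1 ++ G2) H ->
  exists H1 H2, [/\ H = H1 ++ H2, sem_meta G1 H1 & sem_meta G2 H2].
Proof.
elim: G1 H => [|x G1 IH] H; first by exists [::], H; split=> //; apply: sem_nil.
case: x => [A|G'] h.
- inversion h as [|A' G0 K K' sA sG|]; subst.
  case: (IH _ sG) => K1 [K2 [-> s1 s2]]; exists (K ++ K1), K2.
  by split; rewrite ?catA //; apply: sem_fm.
- inversion h as [| |G1' G0 K K' sA sG]; subst.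
  case: (IH _ sG) => K1 [K2 [-> s1 s2]]; exists (Br K :: K1), K2.
  by split=> //; apply: sem_br.
Qed.

Lemma sem_meta_fm A H : sem_meta [:: Fm A] H -> sem A H.
Proof.
by move=> h; inversion h as [|? ? ? ? ? h'|]; inversion h'; rewrite cats0.
Qed.

Lemma sem_fm1 A H : sem A H -> sem_meta [:: Fm A] H.
Proof. by move=> h; rewrite -[H]cats0; apply: sem_fm => //; apply: sem_nil. Qed.

Lemma sem_meta_br G H : sem_meta [:: Br G] H ->
  exists2 K, H = [:: Br K] & sem_meta G K.
Proof.
by move=> h; inversion h as [| |? ? K ? ? h']; inversion h'; exists K.
Qed.

Lemma sem_br1 G K : sem_meta G K -> sem_meta [:: Br G] [:: Br K].
Proof. by move=> ?; apply: sem_br => //; apply: sem_nil. Qed.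

Lemma sem_meta_fill D G H : sem_meta (fill D G) H ->
  exists D' G', [/\ H = fill D' G', sem_meta G G' &
    forall K K', sem_meta K K' -> sem_meta (fill D K) (fill D' K')].
Proof.
elim: D H => [l r|l D IH r] H /= /sem_meta_catI [H1 [H2 [-> s1]]].
- move=> /sem_meta_catI [H3 [H4 [-> s3 s4]]]; exists (Hole H1 H4), H3; split=> //.
  by move=> K K' s; do 2?apply: sem_meta_cat.
- move=> h; inversion h as [| |? ? K1 K2 h1 h2]; subst.
  case: (IH _ h1) => D' [G' [-> sG sD]]; exists (InBr H1 D' K2), G'; split=> // K K' s /=.
  by apply: sem_meta_cat => //; apply: sem_br => //; apply: sD.
Qed.

(** Interpretations are closed, so each member of the interpretation of some !A may be replaced by a
    generator. This restores the shape that contraction, (-> !) and the permutations demand. *)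
Lemma sem_bangs As E D r H : sem_meta (bangs As) H ->
  (forall Bs, sem_meta (bangs As) (bangs Bs) -> sem E (fill D (bangs Bs ++ r))) ->
  sem E (fill D (H ++ r)).
Proof.
elim: As D H => [|A As IH] D H h.
  by inversion h => h0; apply: (h0 [::]); apply: sem_nil.
inversion h as [|? ? H2 H4 H3 H5|]; subst; move=> hB.
rewrite -catA (_ : fill D _ = fill (ctx_comp D (Hole [::] (H4 ++ r))) H2);
  last by rewrite fill_comp.
apply: closed_ctx H3; first exact: closed_sem.
move=> _ [Bs -> sB]; rewrite fill_comp /=.
rewrite (_ : fill D _ = fill (ctx_comp D (Hole (bangs Bs) [::])) (H4 ++ r));
  last by rewrite fill_comp /= cats0.
apply: (IH _ _ H5) => Cs sC; rewrite fill_comp /= cats0 catA.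
rewrite /bangs -map_cat; apply: hB; rewrite /bangs map_cat; apply: sem_fm => //.
by apply: cl_incl; exists Bs.
Qed.

Lemma cf_bangs_perm1 D Bs G C :
  cf (fill D (bangs Bs ++ G)) C -> cf (fill D (G ++ bangs Bs)) C.
Proof.
elim: Bs D => [|B Bs IH] D; first by rewrite cats0.
move=> h; rewrite /= -cat1s catA (fill_cat D [::] (G ++ _)).
apply: cf_perm1; rewrite fill_comp /=.
have := IH (ctx_comp D (Hole [:: Fm (Bang B)] [::])).
by rewrite !fill_comp /= !cats0; apply.
Qed.

Lemma cf_bangs_perm2 D Bs G C :
  cf (fill D (G ++ bangs Bs)) C -> cf (fill D (bangs Bs ++ G)) C.
Proof.
elim: Bs D => [|B Bs IH] D; first by rewrite cats0.
move=> h; have {IH} := IH (ctx_comp D (Hole [:: Fm (Bang B)] [::])).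
rewrite !fill_comp /= !cats0; apply.
rewrite (_ : _ :: _ ++ _ = [::] ++ (Fm (Bang B) :: G) ++ bangs Bs) // fill_cat.
by apply: cf_perm2; rewrite fill_comp /= -catA.
Qed.

(* Okada's argument: every formula is interpreted by a set of meta-formulae
   closed under the cut-free left rules, and lies between itself and the set of
   its cut-free proofs, so that soundness for the interpretation yields cut-free
   derivability. *)
Lemma derivable_sem G B H : derivable G B -> sem_meta G H -> sem B H.
Proof.
move=> d; elim: d H => {G B}
  [A|| G D B C E _ IB _ IE|G B C _ IH|G D A C E _ IA _ IE|G A C _ IH
  |D A B E _ IH|G1 G2 A B _ IA _ IB|D A _ IH|D A C _ IH|P A _ IH|D A C _ IH
  |P A _ IH|D A B _ IH|As A _ IH|D As G B _ _ IH|D A G B _ IH|D A G B _ IH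
  |P D A C _ IA _ IC] H.
- exact: sem_meta_fm.
- by move=> h; inversion h; apply: cl_incl.
- move=> /sem_meta_fill [D' [X [-> h hD]]].
  inversion h as [|? ? H1 H2 s1 s2|]; subst.
  by apply/IE/hD/sem_fm1/s1/IB.
- by move=> h K sK; apply: IH; apply: sem_meta_cat => //; apply: sem_fm1.
- move=> /sem_meta_fill [D' [X [-> /sem_meta_catI [H1 [H2 [-> s1 /sem_meta_fm s2]]] hD]]].
  by apply/IE/hD/sem_fm1/s2/IA.
- by move=> h K sK; apply: IH; apply: sem_fm.
- move=> /sem_meta_fill [D' [X [-> /sem_meta_fm h hD]]].
  apply: closed_ctx h; first exact: closed_sem.
  move=> _ [G1 [G2 [-> s1 s2]]]; apply/IH/hD; apply: sem_fm => //; exact: sem_fm1.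
- move=> /sem_meta_catI [H1 [H2 [-> s1 s2]]]; apply: cl_incl; exists H1, H2.
  by split=> //; [apply: IA | apply: IB].
- move=> /sem_meta_fill [D' [X [-> /sem_meta_fm h hD]]].
  apply: closed_ctx h; first exact: closed_sem.
  by move=> _ <-; apply/IH/hD/sem_nil.
- move=> /sem_meta_fill [D' [X [-> /sem_meta_fm h hD]]].
  apply: closed_ctx h; first exact: closed_sem.
  by move=> _ [K -> sK]; apply/IH/hD/sem_br1/sem_fm1.
- move=> /sem_meta_br [K -> sK]; apply: cl_incl; exists K => //; exact: IH.
- move=> /sem_meta_fill [D' [X [-> /sem_meta_br [K -> /sem_meta_fm sK] hD]]].
  by apply/IH/hD/sem_fm1.
- by move=> h; apply/IH/sem_br1.
- move=> /sem_meta_fill [D' [X [-> /sem_meta_fm h hD]]].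
  apply: closed_ctx h; first exact: closed_sem.
  by move=> _ [As -> sA]; apply/IH/hD/sem_fm1.
- move=> h; have := @sem_bangs As (Bang A) (Hole [::] [::]) [::] H h.
  rewrite /= !cats0; apply=> Bs sB; rewrite !cats0; apply: cl_incl.
  by exists Bs => //; apply: IH.
- move=> /sem_meta_fill [D' [X [-> /sem_meta_catI [H1 [H2 [-> s1 s2]]] hD]]].
  (* [Bs] may be empty although [As] is not; in that case the degenerate contraction is the rule
     applied here. *)
  apply: sem_bangs s1 _ => Bs sB; apply: sem_rule (fun D C => @cf_contr D Bs H2 C) _.
  by apply/IH/hD; apply: sem_meta_cat => //; apply/sem_br1/sem_meta_cat.
- move=> /sem_meta_fill [D' [X [-> /sem_meta_catI [H1 [H2 [-> s1 s2]]] hD]]].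
  rewrite (_ : fill D' _ = fill (ctx_comp D' (Hole H1 [::])) (H2 ++ [::]));
    last by rewrite fill_comp /= !cats0.
  apply: (@sem_bangs [:: A]) => // Bs sB; rewrite fill_comp /= !cats0.
  apply: sem_rule (fun D C => @cf_bangs_perm1 D Bs H1 C) _.
  by apply/IH/hD; apply: (@sem_meta_cat [:: _]).
- move=> /sem_meta_fill [D' [X [-> h hD]]].
  inversion h as [|? ? H1 H4 s1 s2|]; subst.
  apply: (@sem_bangs [:: A]) => [|Bs sB]; first exact: sem_fm1.
  apply: sem_rule (fun D C => @cf_bangs_perm2 D Bs H4 C) _.
  exact/IH/hD/sem_meta_cat.
- move=> /sem_meta_fill [D' [X [-> h hD]]].
  exact/IC/hD/sem_fm1/IA.
Qed.

Theorem derivable_cf G B : derivable G B <-> cf G B.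
Proof.
split; last exact: cf_derivable.
move=> /derivable_sem d; apply: (okada B).2; apply: d.
(* By [okada] every formula belongs to its own interpretation, hence [G] is an instance of itself.
   The length of the encoding decreases both along the sequence and into brackets. *)
have [n] := ubnP (size (enc_meta G)); elim: n G => // n IH [|x G]; first by move=> _; apply: sem_nil.
rewrite /enc_meta /= size_cat => lt.
have lt0 : 0 < size (enc_item x) by case: x {lt} => [[]|].
have sG : sem_meta G G.
  by apply: IH; rewrite -ltnS; apply: leq_trans lt; rewrite ltnS -addn1 addnC leq_add2r.
case: x lt lt0 => [A|G'] lt _; first exact: (sem_fm (okada A).1).
apply: sem_br => //; apply: IH; rewrite -ltnS; apply: leq_trans lt.
by rewrite /= size_cat addn1 !addSn !ltnS ltnW // ltnS leq_addr.
Qed.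

(** * Stack machines *)

Definition poly_fun (f : nat -> nat) : Prop :=
  exists p : {poly nat}, forall n, (p.[n])%R = f n.

Lemma poly_fun_const c : poly_fun (fun=> c).
Proof. by exists (c%:P)%R => n; rewrite hornerC. Qed.

Lemma poly_fun_id : poly_fun id.
Proof. by exists 'X%R => n; rewrite hornerX. Qed.

Lemma poly_funD f g : poly_fun f -> poly_fun g -> poly_fun (fun n => f n + g n).
Proof. by move=> [p hp] [q hq]; exists (p + q)%R => n; rewrite hornerD hp hq. Qed.

Lemma poly_funM f g : poly_fun f -> poly_fun g -> poly_fun (fun n => f n * g n).
Proof. by move=> [p hp] [q hq]; exists (p * q)%R => n; rewrite hornerM hp hq. Qed.

Lemma poly_funX f k : poly_fun f -> poly_fun (fun n => f n ^ k).
Proof.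
move=> hf; elim: k => [|k IH]; first exact: poly_fun_const.
have [p hp] := poly_funM hf IH; exists p => n; by rewrite hp expnS.
Qed.

Section StackTape.

Variable A : eqType.
Implicit Types (t : tape A) (s : seq A).

(** The top of the stack is under the head and the stack grows to the left. The [j] final blanks are
    cells which the head has met below the bottom of the stack and which the lists therefore
    record. *)
Definition tape_stack t s : Prop :=
  all (pred1 None) (tape_left t) /\
  exists j, tape_cur t :: tape_right t = [seq Some a | a <- s] ++ nseq j None.

Lemma tape_stack_of s : tape_stack (tape_of s) s.
Proof.
split=> //; case: s => [|a s] /=; first by exists 1.
by exists 0; rewrite cats0.
Qed.

Lemma tape_stack_cur t s : tape_stack t s -> tape_cur t = ohead s.
Proof. by case=> _ [[|j]]; case: s => [|a s] //= []. Qed.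

Lemma tape_stack_stay t s : tape_stack t s ->
  tape_stack (write_move (tape_cur t, Stay) t) s.
Proof. by case: t. Qed.

Lemma tape_stack_pop t a s : tape_stack t (a :: s) ->
  tape_stack (write_move (None, MoveR) t) s.
Proof.
case: t => l c r [/= l0 [j [_ ->]]]; split=> //=.
case: s => [|b s] /=; last by exists j.
by case: j => [|j]; [exists 1 | exists j.+1].
Qed.

Lemma tape_stack_push t a s : tape_stack t s ->
  tape_stack (write_move (Some a, Stay) (write_move (tape_cur t, MoveL) t)) (a :: s).
Proof.
case: t => l c r [/= l0 [j e]]; split => /=; first by case: l l0 => //= ? ? /andP[].
by exists j; rewrite e.
Qed.

End StackTape.

Section StackMachine.

Variables (S W : finType) (aux m : nat).

Notation idx := 'I_aux.+2.
Notation sym := (S + W)%type.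

Definition sact : finType := (bool * idx * sym + idx)%type.
Definition SPop i x : sact := inl (true, i, x).
Definition SPush i x : sact := inl (false, i, x).
Definition SEmp i : sact := inr i.

Definition sact_idx (a : sact) : idx :=
  match a with inl (_, i, _) => i | inr i => i end.

Definition upd (f : idx -> seq sym) (i : idx) (s : seq sym) : idx -> seq sym :=
  fun j => if j == i then s else f j.

Definition run_sact (a : sact) (f : idx -> seq sym) : option (idx -> seq sym) :=
  match a with
  | inl (true, i, x) =>
      if f i is y :: s then if y == x then Some (upd f i s) else None else None
  | inl (false, i, x) => Some (upd f i (x :: f i))
  | inr i => if f i is [::] then Some f else None
  end.

Fixpoint run_sacts (l : seq sact) (f : idx -> seq sym) : option (idx -> seq sym) :=
  if l is a :: l' then obind (run_sacts l') (run_sact a f) else Some f.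

Variables (ctl : idx) (code : W -> option (seq sact)) (start : seq sact).

Fixpoint run_cert (u : seq W) (f : idx -> seq sym) : bool :=
  if u is w :: u' then
    if code w is Some l then oapp (run_cert u') false (run_sacts l f) else false
  else nilp (f ctl).

Definition init_stacks (x : seq S) : idx -> seq sym :=
  fun i => if val i is 0 then [seq inl a | a <- x] else [::].

Definition accepts (x : seq S) (u : seq W) : bool :=
  oapp (run_cert u) false (run_sacts start (init_stacks x)).

Definition cert : idx := Ordinal (isT : 1 < aux.+2).

(** The actions still to be performed for the current letter are kept in the finite control, which
    is why programs have a uniform length bound [m]. The right summand holds the two halting
    states. *)
Definition sm_state : finType := (bool * {bseq m of sact} + bool)%type.

(* The boolean in a working state tells whether the head has already moved left
   for the push that comes next: pushing takes two steps. *)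
Definition sm_work (b : bool) (l : seq sact) : sm_state := inl (b, insub_bseq m l).

Definition only_at (r : {ffun idx -> option sym}) (i : idx) (am : option sym * move)
    : {ffun idx -> option sym * move} :=
  [ffun j => if j == i then am else (r j, Stay)].

Definition sm_delta (q : sm_state) (r : {ffun idx -> option sym}) :
    sm_state * {ffun idx -> option sym * move} :=
  let idle := [ffun j => (r j, Stay)] in
  match q with
  | inr _ => (q, idle)
  | inl (mid, p) =>
    match bseqval p with
    | [::] =>
        match r cert with
        | None => (inr (r ctl == None), idle)
        | Some (inl _) => (inr false, idle)
        | Some (inr w) =>
            if code w is Some l then (sm_work false l, only_at r cert (None, MoveR))
            else (inr false, idle)
        end
    | inl (true, i, x) :: p' =>
        if r i == Some x then (sm_work false p', only_at r i (None, MoveR))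
        else (inr false, idle)
    | inl (false, i, x) :: p' =>
        if mid then (sm_work false p', only_at r i (Some x, Stay))
        else (inl (true, p), only_at r i (r i, MoveL))
    | inr i :: p' =>
        if r i == None then (sm_work false p', idle) else (inr false, idle)
    end
  end.

Definition stack_tm : tm S :=
  @TM S W sm_state aux (sm_work false start)
    (fun q => if q is inr b then Some b else None) sm_delta.

Definition off_cert (l : seq sact) : bool := all (fun a => sact_idx a != cert) l.

Hypothesis ctl_cert : ctl != cert.
Hypothesis code_size : forall w l, code w = Some l -> size l <= m.
Hypothesis code_cert : forall w l, code w = Some l -> off_cert l.
Hypothesis start_size : size start <= m.
Hypothesis start_cert : off_cert start.

Definition conf_ok (c : config stack_tm) (u : seq W) (f : idx -> seq sym) : Prop :=
  (forall i, i != cert -> tape_stack (c.2 i) (f i)) /\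
  tape_stack (c.2 cert) [seq inr w | w <- u].

Lemma halted (c : config stack_tm) b N :
  tm_verdict c.1 = Some b -> tm_verdict (iter N (@tm_step S stack_tm) c).1 = Some b.
Proof.
move=> h; suff -> : iter N (@tm_step S stack_tm) c = c by [].
by elim: N => //= N ->; rewrite /tm_step h.
Qed.

Lemma sm_workE b l : size l <= m -> sm_work b l = inl (b, insub_bseq m l) /\
  bseqval (insub_bseq m l) = l.
Proof.
by move=> h; split=> //; rewrite /insub_bseq /insubd insubT.
Qed.

Lemma iter_halt (c : config stack_tm) b N : 0 < N ->
  tm_verdict (tm_step c).1 = Some b ->
  tm_verdict (iter N (@tm_step S stack_tm) c).1 = Some b.
Proof. by case: N => // N _ h; rewrite iterSr; apply: halted. Qed.

(** A push takes two steps and the other actions one, so a pending program costs at most twice its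
    length. A letter costs one step to read and at most [2 * m] for its program; the last step
    enters a verdict. *)
Lemma stack_tm_run N p u f (c : config stack_tm) :
  c.1 = sm_work false p -> size p <= m -> off_cert p -> conf_ok c u f ->
  2 * size p + (2 * m).+1 * size u + 1 <= N ->
  tm_verdict (iter N (@tm_step S stack_tm) c).1 =
  Some (oapp (run_cert u) false (run_sacts p f)).
Proof.
elim/ltn_ind: N p u f c => N IH p u f [q ts] /= -> {q} szp offp [/= tsf tsc] leN.
have N0 : 0 < N by lia.
have stay (g : {ffun idx -> option sym}) : (forall i, g i = tape_cur (ts i)) ->
    forall i s, tape_stack (ts i) s -> tape_stack (write_move (g i, Stay) (ts i)) s.
  by move=> h i s; rewrite h; apply: tape_stack_stay.
case: p szp offp leN => [|a p] szp.
  move=> _ leN; case: u tsc leN => [|w u] tsc leN.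
    apply: iter_halt => //; rewrite /tm_step /= (sm_workE false szp).2 ffunE.
    rewrite (tape_stack_cur tsc) /= ffunE.
    by rewrite (tape_stack_cur (tsf _ ctl_cert)); case: (f ctl).
  have stp : tm_step ((sm_work false [::], ts) : config stack_tm) =
      if code w is Some l then
        (sm_work false l, fun i => write_move
           (only_at [ffun i => tape_cur (ts i)] cert (None, MoveR) i) (ts i))
      else (inr false, fun i => write_move
           ([ffun j => ([ffun i => tape_cur (ts i)] j, Stay)] i) (ts i)).
    rewrite /tm_step /= (sm_workE false szp).2 ffunE.
    by rewrite (tape_stack_cur tsc) /=; case: (code w).
  case cw: (code w) stp => [l|] stp; last by apply: iter_halt; rewrite ?stp //= cw.
  case: N N0 leN IH => // N _ leN IH; rewrite iterSr stp /= cw.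
  have szl := code_size cw.
  apply: IH => //; first exact: code_cert cw.
    split=> [i ine|] /=; rewrite ffunE ?eqxx; last exact: tape_stack_pop tsc.
    by rewrite (negPf ine); apply: stay => [j|]; rewrite ?ffunE //; apply: tsf.
  by move: leN szl; rewrite /= mulnS; move: (size l) (_ * size u) => a b; lia.
rewrite /off_cert /= => /andP[ia offp] leN.
have szp' : size p <= m by apply: leq_trans szp => /=.
case: a szp ia leN => [[[[] i] x]|i] szp /= ia leN.
- have stp : tm_step ((sm_work false (SPop i x :: p), ts) : config stack_tm) =
      if ohead (f i) == Some x then
        (sm_work false p, fun j => write_move
           (only_at [ffun i => tape_cur (ts i)] i (None, MoveR) j) (ts j))
      else (inr false, fun i => write_move
           ([ffun j => ([ffun i => tape_cur (ts i)] j, Stay)] i) (ts i)).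
    rewrite /tm_step /= (sm_workE false szp).2 /= ffunE (tape_stack_cur (tsf i ia)).
    by case: ifP.
  case fi: (f i) stp => [|y s] /= stp; first by apply: iter_halt; rewrite ?stp.
  case: (eqVneq y x) stp => [<-|ne] stp; last first.
    by apply: iter_halt; rewrite ?stp // (_ : (Some y == Some x) = (y == x)) // (negPf ne).
  case: N N0 leN IH => // N _ leN IH; rewrite iterSr stp eqxx /=.
  apply: IH => //; last by move: leN; rewrite /=; move: (size p) (_ * size u) => a b; lia.
  split=> [j jne|] /=; rewrite ffunE /upd.
    case: (eqVneq j i) => [->|ne]; first by apply: (@tape_stack_pop _ _ y); rewrite -fi; apply: tsf.
    by apply: stay => [k|]; rewrite ?ffunE //; apply: tsf.
  by rewrite eq_sym (negPf ia); apply: stay => // k; rewrite ffunE.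
- pose r0 : {ffun idx -> option sym} := [ffun k => tape_cur (ts k)].
  pose ts1 j := write_move (only_at r0 i (r0 i, MoveL) j) (ts j).
  have stp : tm_step (tm_step ((sm_work false (SPush i x :: p), ts) : config stack_tm)) =
      (sm_work false p, fun j =>
         write_move (only_at [ffun k => tape_cur (ts1 k)] i (Some x, Stay) j) (ts1 j)).
    by rewrite /tm_step /= (sm_workE false szp).2 /= (sm_workE false szp).2.
  case: N N0 leN IH => // [[|N]] _ leN IH; first by lia.
  rewrite 2!iterSr stp /=.
  apply: IH => //; last by move: leN; rewrite /=; move: (size p) (_ * size u) => a b; lia.
  split=> [j jne|] /=; rewrite !ffunE /upd /ts1 !ffunE.
    case: (eqVneq j i) => [->|ne]; last by case: (ts j) (tsf j jne).
    by apply: tape_stack_push; apply: tsf.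
  by rewrite eq_sym (negPf ia); case: (ts cert) tsc.
- have stp : tm_step ((sm_work false (SEmp i :: p), ts) : config stack_tm) =
      (if ohead (f i) == None then sm_work false p else inr false, fun i => write_move
           ([ffun j => ([ffun i => tape_cur (ts i)] j, Stay)] i) (ts i)).
    rewrite /tm_step /= (sm_workE false szp).2 /= ffunE (tape_stack_cur (tsf i ia)).
    by case: ifP.
  case fi: (f i) stp => [|y s] /= stp; last by apply: iter_halt; rewrite ?stp.
  case: N N0 leN IH => // N _ leN IH; rewrite iterSr stp.
  apply: IH => //; last by move: leN; rewrite /=; move: (size p) (_ * size u) => a b; lia.
  split=> [j jne|] /=; rewrite ffunE; apply: stay => [k|]; rewrite ?ffunE //; exact: tsf.
Qed.

(** Each letter of the certificate triggers boundedly many steps, so the running time depends on the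
    input only through the length bound on certificates. *)
Lemma in_NP_stack_machine (L : seq S -> Prop) (g : nat -> nat) : poly_fun g ->
  (forall x, L x <-> exists u, size u <= g (size x) /\ accepts x u) -> in_NP L.
Proof.
move=> pg hL; pose h n := 2 * m + (2 * m).+1 * g n + 1.
have [p hp] := pg; have [q hq] : poly_fun h.
  apply: poly_funD; last exact: poly_fun_const.
  apply: poly_funD; first exact: poly_fun_const.
  by apply: poly_funM => //; apply: poly_fun_const.
have res x u : size u <= g (size x) ->
    @tm_result S stack_tm (q.[size x])%R x u = Some (accepts x u).
  move=> leu; apply: (@stack_tm_run _ start u (init_stacks x)) => //.
  - split=> [i ine|] /=; last exact: tape_stack_of.
    rewrite /init_stacks; case: i ine => [[|[|i]] lti] //= ine; exact: tape_stack_of.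
  - rewrite hq /h !leq_add // leq_mul //.
exists stack_tm, p, q; split=> [x u|x]; rewrite hp.
  by move=> /res ->.
rewrite hL; split=> -[u [leu acc]]; exists u; split=> //; first by rewrite res // acc.
by move: acc; rewrite res // => -[].
Qed.

End StackMachine.

Lemma meta_ind (P : item -> Prop) (Q : meta -> Prop) :
  (forall A, P (Fm A)) -> (forall G, Q G -> P (Br G)) ->
  Q [::] -> (forall x G, P x -> Q G -> Q (x :: G)) ->
  forall G, Q G.
Proof.
move=> hF hB h0 hS; have hP : forall x, P x.
  fix IH 1; case=> [A|G]; first exact: hF.
  by apply: hB; elim: G => [|x G IG]; [exact: h0 | apply: hS; [exact: IH | exact: IG]].
by elim=> // x G; apply: hS.
Qed.

(** * Polarities *)

(* In a mode [Some (b, z)], b is the polarity of the formula in the sequent and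
   z tells whether it lies inside a negative !A; the mode [None] accepts
   everything. *)
Definition mode := option (bool * bool).
Definition mode_neg (m : mode) : mode := if m is Some (b, z) then Some (~~ b, z) else None.
Definition mode_bang (m : mode) : mode :=
  if m is Some (b, z) then Some (b, z || ~~ b) else None.
(** Erasing occurrences are the <> positive in the sequent and the []^{-1} negative in it. Inside a
    negative !A, polarities relative to !A are the opposite ones, which gives the two clauses of
    [bracket_nonneg]. *)
Definition dia_ok (m : mode) : bool := if m is Some (b, z) then ~~ (b && z) else true.
Definition box_ok (m : mode) : bool := if m is Some (b, z) then ~~ (~~ b && z) else true.

Fixpoint okm (m : mode) (A : formula) : bool :=
  match A with
  | Var _ | One => true
  | Ldiv A C => okm (mode_neg m) A && okm m C
  | Rdiv C B => okm m C && okm (mode_neg m) B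
  | Prod A B => okm m A && okm m B
  | Dia A => dia_ok m && okm m A
  | Box A => box_ok m && okm m A
  | Bang A => okm (mode_bang m) A
  end.

Lemma okm_None A : okm None A.
Proof. by elim: A => //= A -> B ->. Qed.

Fixpoint ok_item (x : item) : bool :=
  match x with
  | Fm A => okm (Some (false, false)) A
  | Br G => all ok_item G
  end.

Lemma all_ok_fill D G : all ok_item (fill D G) = all ok_item (fill D [::]) && all ok_item G.
Proof.
elim: D => [l r|l D IH r] /=; rewrite !all_cat /=; last rewrite IH.
  by rewrite -andbA; congr andb; rewrite andbC.
by case: (all _ l) => //=; case: (all _ G); rewrite ?andbT ?andbF.
Qed.

Lemma occE b X F : occ b X F <-> (b /\ X = F) \/
  match F with
  | Var _ | One => False
  | Ldiv A B | Rdiv B A => occ (~~ b) X A \/ occ b X B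
  | Prod A B => occ b X A \/ occ b X B
  | Dia A | Box A | Bang A => occ b X A
  end.
Proof.
split=> [o|].
  by inversion o; subst; rewrite ?negbK; auto.
case=> [[-> ->]|]; first exact: occ_refl.
case: F => [i||A B|B A|A B|A|A|A] //.
- by case=> [/occ_ldiv_den|/occ_ldiv_num]; rewrite ?negbK; apply.
- by case=> [/occ_rdiv_den|/occ_rdiv_num]; rewrite ?negbK; apply.
- by case=> [/occ_prod_l|/occ_prod_r]; apply.
- exact: occ_dia.
- exact: occ_box.
- exact: occ_bang.
Qed.

Lemma okm_insideP b A : okm (Some (b, true)) A <->
  (forall C, ~ occ (~~ b) (Box C) A) /\ (forall C, ~ occ b (Dia C) A).
Proof.
elim: A b => [i||A IA B IB|B IB A IA|A IA B IB|A IA|A IA|A IA] b /=.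
- by split=> // _; split=> C /occE[[_]|].
- by split=> // _; split=> C /occE[[_]|].
- split=> [/andP[/IA[hA1 hA2] /IB[hB1 hB2]]|[h1 h2]].
    by split=> C /occE[[_]|[]] //; [apply: hA1 | apply: hB1 | apply: hA2 | apply: hB2].
  apply/andP; split; [apply/IA | apply/IB]; split=> C o;
    [apply: (h1 C) | apply: (h2 C) | apply: (h1 C) | apply: (h2 C)]; apply/occE; auto.
- split=> [/andP[/IB[hB1 hB2] /IA[hA1 hA2]]|[h1 h2]].
    by split=> C /occE[[_]|[]] //; [apply: hA1 | apply: hB1 | apply: hA2 | apply: hB2].
  apply/andP; split; [apply/IB | apply/IA]; split=> C o;
    [apply: (h1 C) | apply: (h2 C) | apply: (h1 C) | apply: (h2 C)]; apply/occE; auto.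
- split=> [/andP[/IA[hA1 hA2] /IB[hB1 hB2]]|[h1 h2]].
    by split=> C /occE[[_]|[]] //; [apply: hA1 | apply: hB1 | apply: hA2 | apply: hB2].
  apply/andP; split; [apply/IA | apply/IB]; split=> C o;
    [apply: (h1 C) | apply: (h2 C) | apply: (h1 C) | apply: (h2 C)]; apply/occE; auto.
- rewrite andbT; split=> [/andP[nb /IA[h1 h2]]|[h1 h2]].
    by split=> C /occE[[hb]|] //; [apply: h1 | rewrite hb in nb | apply: h2].
  apply/andP; split; first by apply/negP => hb; apply: (h2 A); apply/occE; left.
  by apply/IA; split=> C o; [apply: (h1 C) | apply: (h2 C)]; apply/occE; right.
- rewrite andbT negbK; split=> [/andP[nb /IA[h1 h2]]|[h1 h2]].
    by split=> C /occE[[hb]|] //; [rewrite nb in hb | apply: h1 | apply: h2].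
  apply/andP; split; first by apply/negPn/negP => hb; apply: (h1 A); apply/occE; left.
  by apply/IA; split=> C o; [apply: (h1 C) | apply: (h2 C)]; apply/occE; right.
- rewrite IA; split=> -[h1 h2]; split=> C.
  + by move=> /occE[[_]|] //; apply: h1.
  + by move=> /occE[[_]|] //; apply: h2.
  + by move=> o; apply: (h1 C); apply/occE; right.
  + by move=> o; apply: (h2 C); apply/occE; right.
Qed.

(** Needed for (! ->), which takes a formula out of the scope of its negative bang. *)
Lemma okm_inside_sub b A : okm (Some (b, true)) A -> okm (Some (b, false)) A.
Proof.
elim: A b => [i||A IA B IB|B IB A IA|A IA B IB|A IA|A IA|A IA] b //=;
  try by case/andP=> /IA -> /IB ->.
- by case/andP=> /IB -> /IA ->.
- by case/andP=> _ /IA ->; rewrite andbF.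
- by case/andP=> _ /IA ->; rewrite andbF.
- by case: b => //= /IA.
Qed.

Lemma okmP b A : okm (Some (b, false)) A <->
  (forall X, occ (~~ b) (Bang X) A -> okm (Some (false, true)) X).
Proof.
elim: A b => [i||A IA B IB|B IB A IA|A IA B IB|A IA|A IA|A IA] b /=.
- by split=> // _ X /occE[[_]|].
- by split=> // _ X /occE[[_]|].
- split=> [/andP[/IA hA /IB hB] X /occE[[_]|[]] //|h]; [exact: hA | exact: hB |].
  by apply/andP; split; [apply/IA | apply/IB] => X o; apply: h; apply/occE; auto.
- split=> [/andP[/IB hB /IA hA] X /occE[[_]|[]] //|h]; [exact: hA | exact: hB |].
  by apply/andP; split; [apply/IB | apply/IA] => X o; apply: h; apply/occE; auto.
- split=> [/andP[/IA hA /IB hB] X /occE[[_]|[]] //|h]; [exact: hA | exact: hB |].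
  by apply/andP; split; [apply/IA | apply/IB] => X o; apply: h; apply/occE; auto.
- rewrite andbF /= IA; split=> h X; first by move=> /occE[[_]|] //; apply: h.
  by move=> o; apply: h; apply/occE; right.
- rewrite andbF /= IA; split=> h X; first by move=> /occE[[_]|] //; apply: h.
  by move=> o; apply: h; apply/occE; right.
- case: b => /=.
    rewrite IA; split=> h X; first by move=> /occE[[_]|] //; apply: h.
    by move=> o; apply: h; apply/occE; right.
  split=> [h X /occE[[_ [->]]|o]|h] //.
    (* Negative bangs nested in this one are covered because the mode inside a negative bang is
       stricter than the mode outside. *)
    by move/okm_inside_sub: h => /IA; apply.
  by apply: h; apply: occ_refl.
Qed.

Lemma all_okP G : all ok_item G <->
  (forall D F, G = fill D [:: Fm F] -> okm (Some (false, false)) F).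
Proof.
split=> [h D F e|]; first by move: h; rewrite e all_ok_fill /= andbT => /andP[].
move: G; apply: (@meta_ind (fun x => (forall D F, [:: x] = fill D [:: Fm F] ->
  okm (Some (false, false)) F) -> ok_item x)) => //=.
- by move=> A /(_ (Hole [::] [::]) A erefl).
- by move=> G IG h; apply: IG => D F e; apply: (h (InBr [::] D [::])); rewrite /= e.
- move=> x G Ix IG h; apply/andP; split.
    apply: Ix => -[l r|l D r] F e.
      by apply: (h (Hole l (r ++ G))); rewrite /= -cat1s e /= -catA.
    by apply: (h (InBr l D (r ++ G))); rewrite /= -cat1s e /= -catA.
  apply: IG => -[l r|l D r] F e.
    by apply: (h (Hole (x :: l) r)); rewrite /= e.
  by apply: (h (InBr (x :: l) D r)); rewrite /= e.
Qed.

Lemma bracket_nonnegP G B :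
  bracket_nonneg G B <-> all ok_item G && okm (Some (true, false)) B.
Proof.
have bangP A : okm (Some (false, true)) A <->
    (forall C, ~ occ true (Box C) (Bang A)) /\ (forall C, ~ occ false (Dia C) (Bang A)).
  by rewrite -(okm_insideP false (Bang A)).
split=> [h|/andP[/all_okP hG /okmP hB] A o].
  apply/andP; split.
    apply/all_okP => D F e; apply/okmP => X o; apply/bangP/h.
    by rewrite e; apply: (occ_ante D (b := true)).
  by apply/okmP => X o; apply/bangP/h/occ_succ.
apply/bangP; inversion o as [? ? ? ? oB|b X D F ? oF]; subst; first exact: hB.
by case: b oF H => // oF _; move/okmP: (hG D F erefl); apply.
Qed.

Lemma nat_bits_last n : last true (nat_bits n).
Proof.
rewrite /nat_bits; case: bin_of_nat => //= p.
suff h b : last b (pos_bits p) by apply: h.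
by elim: p b => //=.
Qed.

(** With [nat_bits_last], this identifies the numerals with the words that do not end in 0, a
    condition that a finite-state flag can check. *)
Lemma nat_bits_surj l : last true l -> exists n, nat_bits n = l.
Proof.
have pos (b : bool) l' : last b (b :: l') -> exists p, pos_bits p = b :: l'.
  elim: l' b => [|c l' IH] b /=; first by case: b => // _; exists xH.
  move=> h; have [p e] := IH c h.
  by exists (if b then xI p else xO p); case: b => /=; rewrite e.
case: l => [|b l] h; first by exists 0.
have [p e] := pos b l h; exists (nat_of_bin (Npos p)).
by rewrite /nat_bits nat_of_binK.
Qed.

(** * A proof checker *)

(* The goals are stacked on [KR].  A rule takes the top goal apart, building the
   antecedent and the succedent of its last premise on [KL] and [KU], and those
   of its first premise, if there are two, on [KT] and [KV]. *)
Inductive stk := KR | KL | KU | KT | KV.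

Definition stk_code (k : stk) : 'I_5 :=
  match k with
  | KR => @Ordinal 5 0 isT | KL => @Ordinal 5 1 isT | KU => @Ordinal 5 2 isT
  | KT => @Ordinal 5 3 isT | KV => @Ordinal 5 4 isT
  end.
Definition stk_decode (i : 'I_5) : stk := nth KR [:: KR; KL; KU; KT; KV] i.
Lemma stk_codeK : cancel stk_code stk_decode.
Proof. by case. Qed.
HB.instance Definition _ := Finite.copy stk (can_type stk_codeK).

Definition act : finType := (bool * stk * symbol + stk)%type.
Definition Pop k a : act := inl (true, k, a).
Definition Push k a : act := inl (false, k, a).
Definition Emp k : act := inr k.

(* [PF m t d] moves a formula of mode m from [KR] to t, with a second copy on
   [KT] if d; [PB t d z] moves the digits of a variable, z telling whether the
   last digit was 0, after which the numeral must not end; [PI c t] moves a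
   meta-formula, checking polarities if c; [PG d] moves a sequence of formulae
   !A to [KL]; [PK t] moves a word from t back to [KR]; [PE] compares [KL] with
   [KU]; [PM b] is the local part of a left rule, with two premises if b, and
   [PC b] such a rule in an arbitrary context. *)
Inductive proc :=
  | PF of mode & stk & bool
  | PB of stk & bool & bool
  | PI of bool & stk
  | PG of bool
  | PK of stk
  | PE
  | PM of bool
  | PC of bool
  | PRule
  | PLoop
  | PStart.

Definition proc_type : finType :=
  ((option (bool * bool) * stk * bool) + (stk * bool * bool) + (bool * stk)
   + bool + stk + bool + bool + option (option (option unit)))%type.
Definition proc_code (X : proc) : proc_type :=
  match X with
  | PF m t d => inl (inl (inl (inl (inl (inl (inl (m, t, d)))))))
  | PB t d z => inl (inl (inl (inl (inl (inl (inr (t, d, z)))))))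
  | PI c t => inl (inl (inl (inl (inl (inr (c, t))))))
  | PG d => inl (inl (inl (inl (inr d))))
  | PK t => inl (inl (inl (inr t)))
  | PM b => inl (inl (inr b))
  | PC b => inl (inr b)
  | PE => inr None
  | PRule => inr (Some None)
  | PLoop => inr (Some (Some None))
  | PStart => inr (Some (Some (Some tt)))
  end.
Definition proc_decode (x : proc_type) : proc :=
  match x with
  | inl (inl (inl (inl (inl (inl (inl (m, t, d))))))) => PF m t d
  | inl (inl (inl (inl (inl (inl (inr (t, d, z))))))) => PB t d z
  | inl (inl (inl (inl (inl (inr (c, t)))))) => PI c t
  | inl (inl (inl (inl (inr d)))) => PG d
  | inl (inl (inl (inr t))) => PK t
  | inl (inl (inr b)) => PM b
  | inl (inr b) => PC b
  | inr None => PE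
  | inr (Some None) => PRule
  | inr (Some (Some None)) => PLoop
  | inr (Some (Some (Some tt))) => PStart
  end.
Lemma proc_codeK : cancel proc_code proc_decode.
Proof. by case. Qed.
HB.instance Definition _ := Finite.copy proc (can_type proc_codeK).

Definition cmd : finType := (act + proc)%type.
Definition Do (a : act) : cmd := inl a.
Definition Call (X : proc) : cmd := inr X.

Definition cp (t : stk) (d : bool) (a : symbol) : seq act :=
  [:: Pop KR a, Push t a & if d then [:: Push KT a] else [::]].
Definition cpw (t : stk) (d : bool) (v : seq symbol) : seq act :=
  flatten [seq cp t d a | a <- v].
Definition bkw (t : stk) (v : seq symbol) : seq act :=
  flatten [seq [:: Pop t a; Push KR a] | a <- v].
Definition eqw (v : seq symbol) : seq act :=
  flatten [seq [:: Pop KL a; Pop KU a] | a <- v].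

Definition cps t d a : seq cmd := map Do (cp t d a).
Definition symbols : seq symbol :=
  [:: SVar; SBit false; SBit true; SEnd; SOne; SLdiv; SRdiv; SProd; SDia; SBox;
      SBang; SOpen; SClose; SArrow].

Definition fmla t := Call (PF None t false).
Definition items t := Call (PI false t).
Definition back t : seq cmd := [:: Call (PK t); Do (Emp t)].
Definition popR a := Do (Pop KR a).

(** The stacks hold reversed words and [KR] is rebuilt from its bottom upwards, so a sequent is put
    back starting with its succedent. [KT] goes below [KL] because (-> \) adds its formula in front
    of the antecedent. *)
Definition asm1 : seq cmd :=
  back KU ++ Do (Push KR SArrow) :: back KT ++ back KL.
Definition asm2 : seq cmd :=
  back KU ++ Do (Push KR SArrow) :: back KL ++
  back KV ++ Do (Push KR SArrow) :: back KT.

(** Contraction and the permutation that moves !A to the left must process a word again after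
    storing it reversed on [KT]. The word is put back on [KR] above an [SArrow], which serves as an
    end marker; as no item contains this symbol, reading a meta-formula up to the marker returns the
    same one. Polarities are checked only when [PStart] reads the input. *)
Definition body (X : proc) : seq (seq cmd) :=
  match X with
  | PF m t d =>
      [:: cps t d SVar ++ [:: Call (PB t d false)];
          cps t d SOne;
          cps t d SLdiv ++ [:: Call (PF (mode_neg m) t d); Call (PF m t d)];
          cps t d SRdiv ++ [:: Call (PF m t d); Call (PF (mode_neg m) t d)];
          cps t d SProd ++ [:: Call (PF m t d); Call (PF m t d)];
          cps t d SBang ++ [:: Call (PF (mode_bang m) t d)]]
      ++ (if dia_ok m then [:: cps t d SDia ++ [:: Call (PF m t d)]] else [::])
      ++ (if box_ok m then [:: cps t d SBox ++ [:: Call (PF m t d)]] else [::])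
  | PB t d z =>
      [:: cps t d (SBit true) ++ [:: Call (PB t d false)];
          cps t d (SBit false) ++ [:: Call (PB t d true)]]
      ++ (if z then [::] else [:: cps t d SEnd])
  | PI c t =>
      [:: [::];
          [:: Call (PF (if c then Some (false, false) else None) t false); Call (PI c t)];
          cps t false SOpen ++ Call (PI c t) :: cps t false SClose ++ [:: Call (PI c t)]]
  | PG d => [:: [::]; cps KL d SBang ++ [:: Call (PF None KL d); Call (PG d)]]
  | PK t => [::] :: [seq [:: Do (Pop t a); Do (Push KR a); Call (PK t)] | a <- symbols]
  | PE => [::] :: [seq [:: Do (Pop KL a); Do (Pop KU a); Call PE] | a <- symbols]
  | PM false =>
      [:: [:: popR SProd; fmla KL; fmla KL];
          [:: popR SOne];
          [:: popR SDia; Do (Push KL SOpen); fmla KL; Do (Push KL SClose)];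
          [:: popR SOpen; popR SBox; fmla KL; popR SClose];
          [:: popR SBang; fmla KL];
          [:: Call (PG true), Do (Push KR SArrow)
            & back KT ++ [:: Do (Push KL SOpen); items KL; popR SArrow; items KL;
                             Do (Push KL SClose)]];
          cps KT false SBang ++ [:: fmla KT, items KL & back KT ++ cps KL false SBang ++ [:: fmla KL]];
          items KT :: cps KL false SBang ++ [:: fmla KL, Do (Push KR SArrow) &
             back KT ++ [:: items KL; popR SArrow]]]
  | PM true =>
      [:: [:: popR SRdiv; fmla KL; fmla KV; items KT];
          [:: items KT; popR SLdiv; fmla KV; fmla KL]]
  | PC b =>
      [:: [:: items KL; Call (PM b); items KL];
          items KL :: cps KL false SOpen ++ Call (PC b) :: cps KL false SClose ++ [:: items KL]]
  | PRule =>
      [:: [:: Call (PC false), popR SArrow, fmla KU & asm1];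
          [:: Call (PC true), popR SArrow, fmla KU & asm2];
          [:: fmla KL; popR SArrow; fmla KU; Call PE; Do (Emp KL); Do (Emp KU)];
          [:: popR SArrow; popR SOne];
          [:: items KL, popR SArrow, popR SRdiv, fmla KU, fmla KL & asm1];
          [:: items KT, popR SArrow, popR SLdiv, fmla KL, fmla KU & asm1];
          [:: items KT, items KL, popR SArrow, popR SProd, fmla KV, fmla KU & asm2];
          [:: popR SOpen, items KL, popR SClose, popR SArrow, popR SDia, fmla KU & asm1];
          [:: Do (Push KL SOpen), items KL, Do (Push KL SClose), popR SArrow, popR SBox,
              fmla KU & asm1];
          [:: Call (PG false), popR SArrow, popR SBang, fmla KU & asm1]]
  | PLoop => [:: [::]; [:: Call PRule; Call PLoop]]
  | PStart =>
      [:: Call (PI true KL) :: cps KL false SArrow ++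
          [:: Call (PF (Some (true, false)) KL false), Do (Emp KR) &
              back KL ++ [:: Call PLoop; Do (Emp KR)]]]
  end.

(** Leftmost derivations of the grammar. The number counts expansions as well as operations and is
    the length of the certificate. *)
Inductive gen : seq cmd -> seq act -> nat -> Prop :=
  | gen_nil : gen [::] [::] 0
  | gen_do a k w n : gen k w n -> gen (Do a :: k) (a :: w) n.+1
  | gen_call X rhs k w n :
      rhs \in body X -> gen (rhs ++ k) w n -> gen (Call X :: k) w n.+1.

(* These weights show that the number of expanded nonterminals is linear in the
   number of operations: see [wt_body] and [gen_weight]. *)
Definition wt_e (c : cmd) : nat :=
  match c with
  | inl _ => 0
  | inr (PI _ _ | PG _ | PK _ | PE | PLoop) => 1
  | inr (PC _) => 3
  | inr _ => 0
  end.

Definition wt_d (c : cmd) : nat :=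
  match c with
  | inl _ => 10
  | inr (PF _ _ _) => 3
  | inr PRule => 5
  | inr _ => 0
  end.

Lemma wt_body X rhs : rhs \in body X ->
  (sumn (map wt_e rhs) + wt_d (Call X)).+1 <= wt_e (Call X) + sumn (map wt_d rhs).
Proof.
move: rhs; apply/allP.
by case: X => [[[[] []]|] [] []|[] [] []|[] []|[]|[]||[]|[]|||].
Qed.

(** An expansion is paid for by the strict inequality in [wt_body]. An operation accounts for its
    own letter and for its weight 10, whence the factor 11. *)
Lemma gen_weight k w n : gen k w n ->
  n + sumn (map wt_d k) <= sumn (map wt_e k) + 11 * size w.
Proof.
elim=> {k w n} [|a k w n _ IH|X rhs k w n /wt_body hX _ IH] //.
  by move: IH; rewrite /= mulnS; move: (sumn _) (sumn _) (11 * _) => a' b c; lia.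
by move: IH hX; rewrite !map_cat !sumn_cat /=; move: (sumn _) (sumn _) (sumn _) (sumn _) => *; lia.
Qed.

(** * From words of the grammar to certificates of the machine *)

Record store := St { sR : seq symbol; sL : seq symbol; sU : seq symbol;
                     sT : seq symbol; sV : seq symbol }.

Definition get (s : store) (k : stk) : seq symbol :=
  match k with KR => sR s | KL => sL s | KU => sU s | KT => sT s | KV => sV s end.

Definition put (s : store) (k : stk) (v : seq symbol) : store :=
  match k with
  | KR => St v (sL s) (sU s) (sT s) (sV s)
  | KL => St (sR s) v (sU s) (sT s) (sV s)
  | KU => St (sR s) (sL s) v (sT s) (sV s)
  | KT => St (sR s) (sL s) (sU s) v (sV s)
  | KV => St (sR s) (sL s) (sU s) (sT s) v
  end.

Definition run_act (a : act) (s : store) : option store :=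
  match a with
  | inl (true, k, x) =>
      if get s k is y :: v then if y == x then Some (put s k v) else None else None
  | inl (false, k, x) => Some (put s k (x :: get s k))
  | inr k => if get s k is [::] then Some s else None
  end.

Fixpoint run (w : seq act) (s : store) : option store :=
  if w is a :: w' then obind (run w') (run_act a s) else Some s.

(** The left summand is the alphabet of the control stack. A certificate letter, on the right, names
    the command expected on top of that stack and the alternative to expand; 20 bounds the number of
    alternatives, see [body_size]. *)
Definition work : finType := (cmd + cmd * 'I_20)%type.
Local Notation tsym := (symbol + work)%type.

(** Tape 0 initially holds the input, hence [KR]; tape 1 is left to the certificate and the last
    tape to the control stack. *)
Definition tape_idx (k : stk) : 'I_7 :=
  match k with
  | KR => @Ordinal 7 0 isT | KL => @Ordinal 7 2 isT | KU => @Ordinal 7 3 isT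
  | KT => @Ordinal 7 4 isT | KV => @Ordinal 7 5 isT
  end.
Definition control : 'I_7 := ord_max.

Definition sact_of (a : act) : @sact symbol work 5 :=
  match a with
  | inl (b, k, x) => inl (b, tape_idx k, inl x)
  | inr k => inr (tape_idx k)
  end.

Definition code (x : work) : option (seq (@sact symbol work 5)) :=
  match x with
  | inl _ => None
  | inr (inl a, _) => Some [:: SPop control (inr (inl (Do a))); sact_of a]
  | inr (inr X, j) =>
      if j < size (body X) then
        Some (SPop control (inr (inl (Call X)))
              :: [seq SPush control (inr (inl c)) | c <- rev (nth [::] (body X) j)])
      else None
  end.

Definition start : seq (@sact symbol work 5) :=
  [:: SPush control (inr (inl (Call PStart)))].

Lemma body_size X : (size (body X) <= 20) && all (fun rhs => size rhs <= 20) (body X).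
Proof. by case: X => [[[[] []]|] [] []|[] [] []|[] []|[]|[]||[]|[]|||]. Qed.

Lemma tape_idx_cert k : (tape_idx k != cert 5) && (tape_idx k != control).
Proof.
by case: k.
Qed.

Lemma tape_idx_inj : injective tape_idx.
Proof.
by case; case.
Qed.

Definition same (f : 'I_7 -> seq tsym) (k : seq cmd) (s : store) : Prop :=
  f control = [seq inr (inl c) | c <- k] /\
  forall i, f (tape_idx i) = [seq inl a | a <- get s i].

Lemma get_put s i j v : get (put s i v) j = if j == i then v else get s j.
Proof. by case: i; case: j. Qed.

Lemma same_upd f k s i v : same f k s ->
  same (upd f (tape_idx i) [seq inl a | a <- v]) k (put s i v).
Proof.
move=> [h1 h2]; split=> [|j]; rewrite /upd.
  by have /andP[_] := tape_idx_cert i; rewrite eq_sym => /negPf ->.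
by rewrite get_put (inj_eq tape_idx_inj); case: ifP => // _; apply: h2.
Qed.

Lemma same_ctl f k s l : same f k s ->
  same (upd f control [seq inr (inl c) | c <- l]) l s.
Proof.
move=> [h1 h2]; split=> [|j]; rewrite /upd ?eqxx //.
by have /andP[_ /negPf ->] := tape_idx_cert j.
Qed.

Lemma same_act f k s a : same f k s ->
  match run_act a s, run_sact (sact_of a) f with
  | Some s', Some f' => same f' k s'
  | None, None => True
  | _, _ => False
  end.
Proof.
move=> sm; have [_ h2] := sm; case: a => [[[[] i] x]|i] /=; rewrite h2.
- case: (get s i) => [//|y v] /=; rewrite (_ : (inl y == inl x) = (y == x)) //.
  by case: eqP => // _; apply: same_upd.
- exact: (@same_upd f k s i (x :: get s i)).
- by case: (get s i).
Qed.

Lemma run_pushes f k s l : same f k s ->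
  exists2 f', run_sacts [seq SPush control (inr (inl c)) | c <- rev l] f = Some f' &
    same f' (l ++ k) s.
Proof.
elim/last_ind: l f k => [|l c IH] f k sm; first by exists f.
rewrite rev_rcons /= -cats1 -catA /=; apply: IH.
by have := same_ctl (c :: k) sm; rewrite /= sm.1.
Qed.

Lemma run_cert_gen k s f u : same f k s -> run_cert control code u f ->
  exists w s', gen k w (size u) /\ run w s = Some s'.
Proof.
elim: u k s f => [|x u IH] k s f sm /=.
  by rewrite sm.1; case: k sm => // sm _; exists [::], s; split=> //; apply: gen_nil.
have pop c (g : seq _) : oapp (run_cert control code u) false
    (run_sacts (SPop control (inr (inl c)) :: g) f) -> exists k', [/\ k = c :: k',
    same (upd f control [seq inr (inl c) | c <- k']) k' s &
    oapp (run_cert control code u) false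
      (run_sacts g (upd f control [seq inr (inl c) | c <- k']))].
  rewrite /= sm.1; case: k sm => //= c' k' sm.
  rewrite (_ : (inr (inl c') == inr (inl c)) = (c' == c)) //.
  by case: eqP => //= -> h; exists k'; split=> //; apply: same_ctl sm.
case: x => [//|[[a|X] j]]; rewrite [code _]/=.
  move/pop=> [k' [-> sm' /=]]; have := same_act a sm'.
  case e: (run_act a s) => [s'|]; case: (run_sact _ _) => //= f' sm2 acc.
  have [w [s2 [g r]]] := IH _ _ _ sm2 acc.
  by exists (a :: w), s2; split; [apply: gen_do | rewrite /= e].
case: ifP => // ltj /pop [k' [-> sm']].
have [f' -> sm2] := run_pushes (nth [::] (body X) j) sm' => acc.
have [w [s2 [g r]]] := IH _ _ _ sm2 acc.
by exists w, s2; split=> //; apply: gen_call g; apply: mem_nth.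
Qed.

Lemma gen_run_cert k w n s s' f : same f k s -> gen k w n -> run w s = Some s' ->
  exists u, size u = n /\ run_cert control code u f.
Proof.
move=> sm g; elim: g s f sm => {k w n} [|a k w n _ IH|X rhs k w n rX _ IH] s f sm.
- by move=> _; exists [::]; rewrite /= sm.1.
- rewrite /=; case e: (run_act a s) => [s1|] //= r.
  have := same_act a (same_ctl k sm); rewrite e.
  case e': (run_sact _ _) => [f'|] // sm'; have [u [su acc]] := IH _ _ sm' r.
  exists (inr (Do a, ord0) :: u); split; rewrite /= ?su // sm.1 /= eqxx /=.
  by rewrite e'.
- move=> r; have := index_mem rhs (body X); rewrite rX => ltj.
  have lt20 : index rhs (body X) < 20.
    by apply: leq_trans ltj _; case/andP: (body_size X).
  have [f' e sm'] := run_pushes rhs (same_ctl k sm).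
  have [u [su acc]] := IH _ _ sm' r.
  exists (inr (Call X, Ordinal lt20) :: u); split; rewrite /= ?su // ltj.
  by rewrite nth_index // /= sm.1 /= eqxx /= e.
Qed.

Definition init (x : seq symbol) : store := St x [::] [::] [::] [::].

Theorem in_NP_gen (Lg : seq symbol -> Prop) (g : nat -> nat) : poly_fun g ->
  (forall x w n s', gen [:: Call PStart] w n -> run w (init x) = Some s' -> Lg x) ->
  (forall x, Lg x -> exists w n s', [/\ gen [:: Call PStart] w n,
     run w (init x) = Some s' & size w <= g (size x)]) ->
  in_NP Lg.
Proof.
move=> pg sound complete.
apply: (@in_NP_stack_machine symbol work 5 30 control code start) (fun n => 11 * g n) _ _.
- by [].
- move=> [//|[[a|X] j]] l /=; first by move=> [<-].
  case: ifP => // ltj [<-]; rewrite /= size_map size_rev ltnS.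
  have /andP[_ /allP h] := body_size X; have := h _ (mem_nth [::] ltj).
  by move/leq_trans; apply.
- move=> [//|[[a|X] j]] l /=.
    move=> [<-] /=; rewrite andbT.
    by case: a => [[[b k] x]|k] /=; case/andP: (tape_idx_cert k).
  by case: ifP => // ltj [<-]; rewrite /off_cert /= all_map; apply/allP.
- by [].
- by [].
- by apply: poly_funM => //; apply: poly_fun_const.
- move=> x; pose f0 := upd (@init_stacks symbol work 5 x) control [:: inr (inl (Call PStart))].
  have sm : same f0 [:: Call PStart] (init x).
    by split=> [|[]]; rewrite /f0 /upd //= eqxx.
  have acc u : accepts control code start x u = run_cert control code u f0 by [].
  split=> [/complete [w [n [s' [gw r sz]]]]|[u [_]]]; last first.
    by rewrite acc => /(run_cert_gen sm) [w [s' [gw r]]]; apply: sound gw r.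
  have [u [su ac]] := gen_run_cert sm gw r; exists u; split; last by rewrite acc.
  have := gen_weight gw; rewrite /= !addn0 su => /leq_trans; apply.
  by rewrite add0n leq_mul2l sz orbT.
Qed.

(** * Soundness of the checker *)

Lemma cpw_cat t d v w : cpw t d (v ++ w) = cpw t d v ++ cpw t d w.
Proof. by rewrite /cpw map_cat flatten_cat. Qed.

Lemma cpw_cons t d a w : cpw t d (a :: w) = cp t d a ++ cpw t d w.
Proof. by []. Qed.

Lemma run_cat w1 w2 s : run (w1 ++ w2) s = obind (run w2) (run w1 s).
Proof. by elim: w1 s => //= a w1 IH s; case: (run_act a s) => //=. Qed.

(** Two copies sent to [KT] would be interleaved symbol by symbol, and a move from [KR] to itself
    would go nowhere. *)
Definition cp_ok (t : stk) (d : bool) : bool :=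
  match t with KR => false | KT => ~~ d | _ => true end.

Definition copied t (d : bool) v (s : store) R : store :=
  let s1 := put (put s KR R) t (rev v ++ get s t) in
  if d then put s1 KT (rev v ++ get s1 KT) else s1.

Lemma run_cpw t d v s R w : cp_ok t d -> sR s = v ++ R ->
  run (cpw t d v ++ w) s = run w (copied t d v s R).
Proof.
move=> tR; elim: v s => [|a v IH] s eR.
  by rewrite /copied; case: s eR t d tR => ? ? ? ? ? /= -> [] [].
rewrite cpw_cons -catA /=; case: s eR => R0 L U T V /= ->; rewrite eqxx /=.
by case: t d tR IH => [] [] // _ IH; rewrite /= (IH (St _ _ _ _ _)) //= /copied /= rev_cons -cats1 -?catA.
Qed.

Lemma run_cpw_inv t d v s s' w : run (cpw t d v ++ w) s = Some s' -> cp_ok t d ->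
  exists R, sR s = v ++ R /\ run w (copied t d v s R) = Some s'.
Proof.
move=> r tR; suff [R e] : exists R, sR s = v ++ R by exists R; rewrite -(run_cpw w tR e).
elim: v s r => [|a v IH] s; first by exists (sR s).
rewrite cpw_cons /= /cp -!catA /=; case: s => [[|b R0] L U T V] //=.
case: eqP => //= ->; case: t d tR IH => [] [] // _ IH /= /IH [R /= ->];
  by exists R.
Qed.

Lemma run_bkw t s w : t != KR ->
  run (bkw t (get s t) ++ Emp t :: w) s = run w (put (put s t [::]) KR (rev (get s t) ++ sR s)).
Proof.
move=> tR; move e: (get s t) => v; elim: v s e => [|a v IH] s e /=.
  by rewrite e; case: s t tR e => ? ? ? ? ? [] //= _ ->.
rewrite e /= eqxx /= IH; last by case: s t tR e {IH} => ? ? ? ? ? [].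
by case: s t tR e {IH} => ? ? ? ? ? [] //= _ _; rewrite rev_cons -cats1 -catA.
Qed.

(** The closing [Emp t] forces the guessed word [v] to be the whole stack. *)
Lemma run_bkw_inv t v s s' w : run (bkw t v ++ Emp t :: w) s = Some s' -> t != KR ->
  run w (put (put s t [::]) KR (rev (get s t) ++ sR s)) = Some s'.
Proof.
move=> r tR; suff e : get s t = v by rewrite -(run_bkw s w tR) e.
elim: v s r => [|a v IH] s /=; first by case: (get s t).
case e: (get s t) => [//|b u] /=; case: eqP => //= -> r; congr cons.
by move: (IH _ r); case: s t tR e {IH r} => ? ? ? ? ? [].
Qed.

Lemma run_pop_inv a s s' w : run (Pop KR a :: w) s = Some s' ->
  exists R, sR s = a :: R /\ run w (put s KR R) = Some s'.
Proof. by case: s => [[|b R] L U T V] //=; case: eqP => //= -> r; exists R. Qed.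

Lemma run_eqw_inv v s s' : run (eqw v ++ [:: Emp KL; Emp KU]) s = Some s' ->
  sL s = sU s /\ s' = St (sR s) [::] [::] (sT s) (sV s).
Proof.
elim: v s => [|a v IH] [R L U T V] /=; first by case: L => //=; case: U => //= -[].
case: L => //= b L; case: eqP => //= ->; case: U => //= c U; case: eqP => //= ->.
by move=> /IH /= [-> ->].
Qed.

Lemma run_eqw v R T V : run (eqw v ++ [:: Emp KL; Emp KU]) (St R v v T V) =
  Some (St R [::] [::] T V).
Proof. by elim: v => //= a v IH; rewrite !eqxx /= eqxx /=. Qed.

Fixpoint enc_left (D : context) : seq symbol :=
  match D with
  | Hole l r => enc_meta l
  | InBr l D r => enc_meta l ++ SOpen :: enc_left D
  end.
Fixpoint enc_right (D : context) : seq symbol :=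
  match D with
  | Hole l r => enc_meta r
  | InBr l D r => enc_right D ++ SClose :: enc_meta r
  end.

Lemma enc_meta_cat G H : enc_meta (G ++ H) = enc_meta G ++ enc_meta H.
Proof. by rewrite /enc_meta map_cat flatten_cat. Qed.

Lemma enc_meta_br G H : enc_meta (Br G :: H) = SOpen :: enc_meta G ++ SClose :: enc_meta H.
Proof. by rewrite /enc_meta /= -catA. Qed.

Lemma enc_meta_fm A H : enc_meta (Fm A :: H) = enc_formula A ++ enc_meta H.
Proof. by []. Qed.

Lemma enc_fm A : enc_meta [:: Fm A] = enc_formula A.
Proof. by rewrite enc_meta_fm cats0. Qed.

Lemma enc_fill D G : enc_meta (fill D G) = enc_left D ++ enc_meta G ++ enc_right D.
Proof.
elim: D => [l r|l D IH r] /=; rewrite ?enc_meta_cat //.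
by rewrite enc_meta_br IH -!catA /= -?catA.
Qed.

Definition enc_goals (l : seq (meta * formula)) : seq symbol :=
  flatten [seq enc_sequent p.1 p.2 | p <- l].

Definition good (R : seq symbol) : Prop :=
  exists l, R = enc_goals l /\ forall p, List.In p l -> cf p.1 p.2.

Lemma enc_goals1 G B R : enc_goals [:: (G, B)] ++ R = enc_sequent G B ++ R.
Proof. by rewrite /enc_goals /= cats0. Qed.

Lemma enc_goals2 G B H C R :
  enc_goals [:: (G, B); (H, C)] ++ R = enc_sequent G B ++ enc_sequent H C ++ R.
Proof. by rewrite /enc_goals /= cats0 -catA. Qed.

Lemma good_cons G B R : good (enc_sequent G B ++ R) <-> cf G B /\ good R.
Proof.
split=> [[[|[H C] l] []]|[h [l [-> hl]]]].
- by move/(congr1 size); rewrite /enc_sequent !size_cat /= addnS addSn.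
- rewrite /enc_goals /= /enc_sequent -!catA /= => /enc_meta_prefix [] // -> [].
  move=> /enc_formula_prefix [-> ->] h; split; first by apply: (h (H, C)); left.
  by exists l; split=> // p pl; apply: h; right.
- exists ((G, B) :: l); split=> // p [<- //|]; exact: hl.
Qed.

Definition specM (b : bool) (w : seq act) : Prop :=
  forall R L U s', run w (St R L U [::] [::]) = Some s' ->
  exists X X' R', R = enc_meta X ++ R' /\
  if b then exists G B, s' = St R' (rev (enc_meta X') ++ L) U (rev (enc_meta G)) (rev (enc_formula B))
    /\ forall D E, cf G B -> cf (fill D X') E -> cf (fill D X) E
  else s' = St R' (rev (enc_meta X') ++ L) U [::] [::]
    /\ forall D E, cf (fill D X') E -> cf (fill D X) E.

Definition specR (w : seq act) : Prop :=
  forall R s', run w (init R) = Some s' ->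
  exists R', s' = init R' /\ (good R' -> good R).

(** Moving and comparing nonterminals are specified by the words that they generate, whatever the
    stacks contain. From [PM] upwards the specification concerns successful runs: the goals left on
    [KR] imply those that were there. *)
Definition spec (X : proc) (w : seq act) : Prop :=
  match X with
  | PF m t d => exists A, okm m A /\ w = cpw t d (enc_formula A)
  | PB t d z => exists l, last (~~ z) l /\ w = cpw t d ([seq SBit b | b <- l] ++ [:: SEnd])
  | PI c t => exists G, (c ==> all ok_item G) /\ w = cpw t false (enc_meta G)
  | PG d => exists As, w = cpw KL d (enc_meta (bangs As))
  | PK t => exists v, w = bkw t v
  | PE => exists v, w = eqw v
  | PM b => specM b w
  | PC b => exists D w', specM b w' /\
      w = cpw KL false (enc_left D) ++ w' ++ cpw KL false (enc_right D)
  | PRule | PLoop => specR w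
  | PStart => forall x s', run w (init x) = Some s' ->
      exists G B, [/\ x = enc_sequent G B, bracket_nonneg G B & cf G B]
  end.

Fixpoint specs (k : seq cmd) (w : seq act) : Prop :=
  match k with
  | [::] => w = [::]
  | inl a :: k => exists w', w = a :: w' /\ specs k w'
  | inr X :: k => exists w1 w2, [/\ w = w1 ++ w2, spec X w1 & specs k w2]
  end.

Lemma specs_cat k1 k2 w : specs (k1 ++ k2) w ->
  exists w1 w2, [/\ w = w1 ++ w2, specs k1 w1 & specs k2 w2].
Proof.
elim: k1 w => [|[a|X] k1 IH] w /=; first by exists [::], w.
- by move=> [w' [-> /IH [w1 [w2 [-> s1 s2]]]]]; exists (a :: w1), w2; split=> //; exists w1.
- move=> [u [u' [-> sX /IH [w1 [w2 [-> s1 s2]]]]]]; exists (u ++ w1), w2.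
  by rewrite catA; split=> //; exists u, w1.
Qed.

Lemma specs_call X k w : specs (Call X :: k) w ->
  exists w1 w2, [/\ w = w1 ++ w2, spec X w1 & specs k w2].
Proof. by []. Qed.

Lemma specs_do a k w : specs (Do a :: k) w -> exists w', w = a :: w' /\ specs k w'.
Proof. by []. Qed.

Lemma specs_nil w : specs [::] w -> w = [::].
Proof. by []. Qed.

Lemma specs_cps t d a k w : specs (cps t d a ++ k) w ->
  exists w', w = cpw t d [:: a] ++ w' /\ specs k w'.
Proof.
rewrite /cps /cpw /cp /=; case: d => /=.
  by case=> [_ [-> [_ [-> [w3 [-> h]]]]]]; exists w3.
by case=> [_ [-> [w3 [-> h]]]]; exists w3.
Qed.

Lemma specs_pf t k w : specs (fmla t :: k) w ->
  exists A w', w = cpw t false (enc_formula A) ++ w' /\ specs k w'.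
Proof. by move=> [w1 [w2 [-> [A [_ ->]] h]]]; exists A, w2. Qed.

Lemma specs_pi t k w : specs (items t :: k) w ->
  exists G w', w = cpw t false (enc_meta G) ++ w' /\ specs k w'.
Proof. by move=> [w1 [w2 [-> [A [_ ->]] h]]]; exists A, w2. Qed.

Lemma specs_back t k w : specs (back t ++ k) w ->
  exists v w', w = bkw t v ++ Emp t :: w' /\ specs k w'.
Proof. by move=> [w1 [w2 [-> [v ->] [w' [-> h]]]]]; exists v, w'. Qed.

Lemma spec_PF m t d rhs w : rhs \in body (PF m t d) -> specs rhs w -> spec (PF m t d) w.
Proof.
rewrite /body !inE => /or4P[/eqP->|/eqP->|/eqP->|/or4P[/eqP->|/eqP->|/eqP->|]].
- move=> /specs_cps [w' [-> [w1 [w2 [-> [l [hl ->]] ->]]]]].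
  have [i e] := nat_bits_surj hl; exists (Var i); split=> //.
  by rewrite -e cats0 -cpw_cat.
- by rewrite -[cps _ _ _]cats0 => /specs_cps [w' [-> ->]]; exists One; rewrite cats0.
- move=> /specs_cps [w' [-> [w1 [w2 [-> [A [okA ->]] [w3 [w4 [-> [B [okB ->]] ->]]]]]]]].
  by exists (Ldiv A B); split; [rewrite /= okA okB | rewrite cats0 -!cpw_cat].
- move=> /specs_cps [w' [-> [w1 [w2 [-> [A [okA ->]] [w3 [w4 [-> [B [okB ->]] ->]]]]]]]].
  by exists (Rdiv A B); split; [rewrite /= okA okB | rewrite cats0 -!cpw_cat].
- move=> /specs_cps [w' [-> [w1 [w2 [-> [A [okA ->]] [w3 [w4 [-> [B [okB ->]] ->]]]]]]]].
  by exists (Prod A B); split; [rewrite /= okA okB | rewrite cats0 -!cpw_cat].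
- move=> /specs_cps [w' [-> [w1 [w2 [-> [A [okA ->]] ->]]]]].
  by exists (Bang A); split; [rewrite /= okA | rewrite cats0 -!cpw_cat].
rewrite mem_cat => /orP[]; case: ifP => // ok; rewrite inE => /eqP->.
  move=> /specs_cps [w' [-> [w1 [w2 [-> [A [okA ->]] ->]]]]].
  by exists (Dia A); split; [rewrite /= ok okA | rewrite cats0 -!cpw_cat].
move=> /specs_cps [w' [-> [w1 [w2 [-> [A [okA ->]] ->]]]]].
by exists (Box A); split; [rewrite /= ok okA | rewrite cats0 -!cpw_cat].
Qed.

Lemma spec_PB t d z rhs w : rhs \in body (PB t d z) -> specs rhs w -> spec (PB t d z) w.
Proof.
rewrite /body !inE => /or3P[/eqP->|/eqP->|].
- move=> /specs_cps [w' [-> [w1 [w2 [-> [l [hl ->]] ->]]]]].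
  by exists (true :: l); split=> //; rewrite cats0 -cpw_cat.
- move=> /specs_cps [w' [-> [w1 [w2 [-> [l [hl ->]] ->]]]]].
  by exists (false :: l); split=> //; rewrite cats0 -cpw_cat.
- case: z => //; rewrite inE -[cps _ _ _]cats0 => /eqP-> /specs_cps [w' [-> ->]].
  by exists [::]; rewrite cats0.
Qed.

Lemma spec_PI c t rhs w : rhs \in body (PI c t) -> specs rhs w -> spec (PI c t) w.
Proof.
rewrite /body !inE => /or3P[/eqP->|/eqP->|/eqP->].
- by move->; exists [::]; rewrite implybT.
- move=> [w1 [w2 [-> [A [okA ->]] [w3 [w4 [-> [G [okG ->]] ->]]]]]].
  exists (Fm A :: G); rewrite cats0 -cpw_cat; split=> //=.
  by case: c okA okG => //= -> ->.
- move=> /specs_cps [w' [-> /specs_call [w1 [w2 [-> [G [okG ->]] /specs_cps [w3 [->]]]]]]].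
  move=> [w4 [w5 [-> [H [okH ->]] ->]]]; exists (Br G :: H).
  rewrite cats0 enc_meta_br -!cpw_cat; split=> //=.
  by case: c okG okH => //= -> ->.
Qed.

Lemma spec_PG d rhs w : rhs \in body (PG d) -> specs rhs w -> spec (PG d) w.
Proof.
rewrite /body !inE => /orP[/eqP->|/eqP->]; first by move->; exists [::].
move=> /specs_cps [w' [-> [w1 [w2 [-> [A [okA ->]] [w3 [w4 [-> [As ->] ->]]]]]]]].
by exists (A :: As); rewrite cats0 -!cpw_cat.
Qed.

Lemma spec_PK t rhs w : rhs \in body (PK t) -> specs rhs w -> spec (PK t) w.
Proof.
rewrite /body inE => /orP[/eqP-> ->|/mapP[a _ ->]]; first by exists [::].
by move=> [w' [-> [w1 [-> [w2 [w3 [-> [v ->] ->]]]]]]]; exists (a :: v); rewrite cats0.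
Qed.

Lemma spec_PE rhs w : rhs \in body PE -> specs rhs w -> spec PE w.
Proof.
rewrite /body inE => /orP[/eqP-> ->|/mapP[a _ ->]]; first by exists [::].
by move=> [w' [-> [w1 [-> [w2 [w3 [-> [v ->] ->]]]]]]]; exists (a :: v); rewrite cats0.
Qed.

Lemma spec_PC b rhs w : rhs \in body (PC b) -> specs rhs w -> spec (PC b) w.
Proof.
rewrite /body !inE => /orP[/eqP->|/eqP->].
- move=> /specs_pi [l [w1 [-> /specs_call [w2 [w3 [-> hM /specs_pi [r [w4 [-> ->]]]]]]]]].
  by exists (Hole l r), w2; rewrite cats0.
- move=> /specs_pi [l [w1 [-> /specs_cps [w2 [-> /specs_call [w3 [w4 [->]]]]]]]].
  move=> [D [w' [hM ->]]] /specs_cps [w5 [-> /specs_pi [r [w6 [-> ->]]]]].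
  exists (InBr l D r), w'; split=> //; rewrite [enc_left _]/= [enc_right _]/= cats0.
  by rewrite -[SOpen :: _]cat1s -[SClose :: _]cat1s !cpw_cat -!catA.
Qed.

Lemma run_push k a w s : run (Push k a :: w) s = run w (put s k (a :: get s k)).
Proof. by []. Qed.

Lemma run_emp_inv k w s s' : run (Emp k :: w) s = Some s' ->
  get s k = [::] /\ run w s = Some s'.
Proof. by rewrite /=; case: (get s k). Qed.

Lemma run_nil s : run [::] s = Some s.
Proof. by []. Qed.

Arguments run : simpl never.

Ltac srun := repeat match goal with
  | H : run (cpw _ _ _ ++ _) _ = Some _ |- _ =>
      let R := fresh "R" in let e := fresh "e" in let H' := fresh "r" in
      have [R [/= e H']] := run_cpw_inv H isT; clear H; rewrite ?e /copied /= in H'; try subst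
  | H : run (cpw ?t ?d ?v) _ = Some _ |- _ => rewrite -(cats0 (cpw t d v)) in H
  | H : run (Pop KR _ :: _) _ = Some _ |- _ =>
      let R := fresh "R" in let e := fresh "e" in let H' := fresh "r" in
      have [R [/= e H']] := run_pop_inv H; clear H; rewrite /= in H'; try subst
  | H : run (bkw _ _ ++ Emp _ :: _) _ = Some _ |- _ =>
      let H' := fresh "r" in
      have H' := run_bkw_inv H isT; clear H; rewrite /= ?revK ?cats0 in H'
  | H : run (Push _ _ :: _) _ = Some _ |- _ => rewrite run_push /= in H
  | H : run [::] _ = Some _ |- _ => rewrite run_nil in H
  | H : Some _ = Some _ |- _ => case: H => ?; subst; rewrite ?cats0
  end.

Lemma spec_PM b rhs w : rhs \in body (PM b) -> specs rhs w -> spec (PM b) w.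
Proof.
have arrow_inj G H (r1 r2 : seq symbol) :
    enc_meta G ++ SArrow :: r1 = enc_meta H ++ SArrow :: r2 -> G = H /\ r1 = r2.
  by move=> /enc_meta_prefix [] // -> [->].
case: b; rewrite /body !inE.
- case/orP=> /eqP->.
    move=> /specs_do [? [-> /specs_pf [C [? [-> /specs_pf [B [? [-> /specs_pi [G [? [->]]]]]]]]]]].
    move=> /specs_nil -> R L U s' r; srun.
    exists (Fm (Rdiv C B) :: G), [:: Fm C]; eexists; split.
      by rewrite enc_meta_fm /= -!catA.
    by exists G, B; rewrite enc_fm ?cats0; split=> // D E; apply: cf_rdivL.
  move=> /specs_pi [G [? [-> /specs_do [? [-> /specs_pf [A [? [-> /specs_pf [C [? [->]]]]]]]]]]].
  move=> /specs_nil -> R L U s' r; srun.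
  exists (G ++ [:: Fm (Ldiv A C)]), [:: Fm C]; eexists; split.
    by rewrite enc_meta_cat enc_fm -!catA /= -!catA.
  by exists G, A; rewrite enc_fm ?cats0; split=> // D E; apply: cf_ldivL.
case/or4P=> [/eqP->|/eqP->|/eqP->|/or4P[/eqP->|/eqP->|/eqP->|/orP[/eqP->|/eqP->]]].
- move=> /specs_do [? [-> /specs_pf [A [? [-> /specs_pf [B [? [-> /specs_nil ->]]]]]]]].
  move=> R L U s' r; srun.
  exists [:: Fm (Prod A B)], [:: Fm A; Fm B]; eexists; split.
    by rewrite enc_fm /= -!catA.
  by rewrite enc_meta_fm enc_fm rev_cat -catA; split=> // D E; apply: cf_prodL.
- move=> /specs_do [? [-> /specs_nil ->]] R L U s' r; srun.
  by exists [:: Fm One], [::]; eexists; split=> //; split=> // D E; apply: cf_oneL.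
- move=> /specs_do [? [-> /specs_do [? [-> /specs_pf [A [? [-> /specs_do [? [->]]]]]]]]].
  move=> /specs_nil -> R L U s' r; srun.
  exists [:: Fm (Dia A)], [:: Br [:: Fm A]]; eexists; split; first by rewrite enc_fm.
  rewrite enc_meta_br enc_fm /= rev_cons rev_cat -cats1 -!catA /=; split=> // D E.
  exact: cf_diaL.
- move=> /specs_do [? [-> /specs_do [? [-> /specs_pf [A [? [-> /specs_do [? [->]]]]]]]]].
  move=> /specs_nil -> R L U s' r; srun.
  exists [:: Br [:: Fm (Box A)]], [:: Fm A]; eexists; split.
    by rewrite enc_meta_br enc_fm /= -catA.
  by rewrite enc_fm; split=> // D E; apply: cf_boxL.
- move=> /specs_do [? [-> /specs_pf [A [? [-> /specs_nil ->]]]]] R L U s' r; srun.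
  exists [:: Fm (Bang A)], [:: Fm A]; eexists; split; first by rewrite enc_fm.
  by rewrite enc_fm; split=> // D E; apply: cf_bangL.
- move=> /specs_call [? [_ [-> [As ->] /specs_do [? [-> /specs_back [v [? [->]]]]]]]].
  move=> /specs_do [? [-> /specs_pi [G [? [-> /specs_do [? [-> /specs_pi [H [? [->]]]]]]]]]].
  move=> /specs_do [? [-> /specs_nil ->]] R L U s' r; srun.
  (* What was read again up to the marker is the sequence read first, by unique readability. *)
  move: e; rewrite revK => /arrow_inj [<- ->].
  exists (bangs As ++ H), (bangs As ++ [:: Br (bangs As ++ H)]), R; split.
    by rewrite enc_meta_cat -catA.
  split=> [|D E]; last exact: cf_contr.
  rewrite enc_meta_cat enc_meta_br enc_meta_cat rev_cat rev_cons rev_cat rev_cons rev_cat.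
  by rewrite -!cats1 /= -!catA.
- move=> /specs_cps [? [-> /specs_pf [A [? [-> /specs_pi [G [? [-> /specs_back [v [? [->]]]]]]]]]]].
  move=> /specs_cps [? [-> /specs_pf [B [? [-> /specs_nil ->]]]]] R L U s' r; srun.
  move: e; rewrite rev_cat revK /= => -[/enc_formula_prefix [<- <-]].
  exists (Fm (Bang A) :: G), (G ++ [:: Fm (Bang A)]); eexists; split.
    by rewrite enc_meta_fm /= -catA.
  split=> [|D E]; last exact: cf_perm2.
  by rewrite enc_meta_cat enc_fm rev_cat /= rev_cons -cats1 -!catA.
- move=> /specs_pi [G [? [-> /specs_cps [? [-> /specs_pf [A [? [-> /specs_do [? [->]]]]]]]]]].
  move=> /specs_back [v [? [-> /specs_pi [H [? [-> /specs_do [? [-> /specs_nil ->]]]]]]]].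
  move=> R L U s' r; srun.
  move: e; rewrite revK => /arrow_inj [<- <-].
  exists (G ++ [:: Fm (Bang A)]), (Fm (Bang A) :: G); eexists; split.
    by rewrite enc_meta_cat enc_fm -!catA.
  split=> [|D E]; last exact: cf_perm1.
  by rewrite enc_meta_fm rev_cat /= rev_cons -cats1 -!catA.
Qed.

Lemma enc_sequentE G B R : enc_sequent G B ++ R = enc_meta G ++ SArrow :: enc_formula B ++ R.
Proof. by rewrite /enc_sequent -catA. Qed.

Lemma specs_asm1 w R s' L U T V : specs asm1 w ->
  run w (St R L U T V) = Some s' ->
  s' = St (rev L ++ rev T ++ SArrow :: rev U ++ R) [::] [::] [::] V.
Proof.
move=> /specs_back [v [? [-> /specs_do [? [-> /specs_back [v' [? [->]]]]]]]].
by rewrite -[back KL]cats0 => /specs_back [v2 [? [-> /specs_nil ->]]] r; srun.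
Qed.

Lemma specs_asm2 w R s' L U T V : specs asm2 w ->
  run w (St R L U T V) = Some s' ->
  s' = init (rev T ++ SArrow :: rev V ++ rev L ++ SArrow :: rev U ++ R).
Proof.
move=> /specs_back [v [? [-> /specs_do [? [-> /specs_back [v' [? [->]]]]]]]].
move=> /specs_back [v2 [? [-> /specs_do [? [->]]]]].
by rewrite -[back KT]cats0 => /specs_back [v3 [? [-> /specs_nil ->]]] r; srun.
Qed.

Lemma good_rule G B R0 R' l s' : s' = init R' -> R' = enc_goals l ++ R0 ->
  ((forall p, List.In p l -> cf p.1 p.2) -> cf G B) ->
  exists R'', s' = init R'' /\ (good R'' -> good (enc_sequent G B ++ R0)).
Proof.
move=> -> -> hcf; exists (enc_goals l ++ R0); split=> // g.
suff [hl gR] : (forall p, List.In p l -> cf p.1 p.2) /\ good R0.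
  by apply/good_cons; split=> //; apply: hcf.
elim: l g {hcf} => [|[H C] l IH] //=; rewrite /enc_goals /= -catA => /good_cons [h /IH [hl g]].
by split=> // p [<-|/hl].
Qed.

Ltac premises r es G B l :=
  match type of r with run _ (St ?R _ _ _ _) = Some ?s =>
    have := @good_rule G B R _ l s es end.

Lemma spec_PRule rhs w : rhs \in body PRule -> specs rhs w -> spec PRule w.
Proof.
rewrite /body !inE.
case/or4P=> [/eqP->|/eqP->|/eqP->|/or4P[/eqP->|/eqP->|/eqP->|/or4P[/eqP->|/eqP->|/eqP->|/eqP->]]].
- move=> /specs_call [? [? [-> [D [w' [hM ->]]] /specs_do [? [-> /specs_pf [E [? [->]]]]]]]].
  move=> h R s' r; rewrite -!catA in r; srun.
  rewrite run_cat /= in r0; case e: (run w' _) r0 => [s1|] //= r0.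
  have [X [X' [R' [e0 [es hcf]]]]] := hM _ _ _ _ e; subst; srun.
  premises r (specs_asm1 h r) (fill D X) E [:: (fill D X', E)].
  rewrite !rev_cat !revK ?enc_goals1 ?enc_goals2 !enc_sequentE !enc_fill -!catA; apply=> //.
  by move=> c; apply: hcf; apply: (c (_, _)); left.
- move=> /specs_call [? [? [-> [D [w' [hM ->]]] /specs_do [? [-> /specs_pf [E [? [->]]]]]]]].
  move=> h R s' r; rewrite -!catA in r; srun.
  rewrite run_cat /= in r0; case e: (run w' _) r0 => [s1|] //= r0.
  have [X [X' [R' [e0 [G [B [es hcf]]]]]]] := hM _ _ _ _ e; subst; srun.
  premises r (specs_asm2 h r) (fill D X) E [:: (G, B); (fill D X', E)].
  rewrite !rev_cat !revK ?enc_goals1 ?enc_goals2 !enc_sequentE !enc_fill -!catA; apply=> //.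
  by move=> c; apply: hcf; [apply: (c (_, _)); left | apply: (c (_, _)); right; left].
- move=> /specs_pf [A [? [-> /specs_do [? [-> /specs_pf [B [? [-> /specs_call [? [? [->]]]]]]]]]]].
  move=> [v ->] /specs_do [? [-> /specs_do [? [-> /specs_nil ->]]]] R s' r; srun.
  have [/= e es] := run_eqw_inv r0.
  have {e} : enc_formula A = enc_formula B.
    by move: e; rewrite !cats0 => /(congr1 rev); rewrite !revK.
  rewrite -[LHS]cats0 -[RHS]cats0 => /enc_formula_prefix [<- _].
  premises r0 es [:: Fm A] A (@nil (meta * formula)); rewrite enc_sequentE enc_fm; apply=> // _.
  exact: cf_ax.
- move=> /specs_do [? [-> /specs_do [? [-> /specs_nil ->]]]] R s' r; srun.
  have := @good_rule [::] One _ _ [::] _ erefl; apply=> // _.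
  exact: cf_oneR.
- move=> /specs_pi [G [? [-> /specs_do [? [-> /specs_do [? [->]]]]]]].
  move=> /specs_pf [C [? [-> /specs_pf [B [? [-> h]]]]]] R s' r; srun.
  premises r0 (specs_asm1 h r0) G (Rdiv C B) [:: (G ++ [:: Fm B], C)].
  rewrite !rev_cat !revK ?enc_goals1 ?enc_goals2 !enc_sequentE enc_meta_cat enc_fm -!catA.
  by rewrite /= -!catA; apply=> // c; apply: cf_rdivR; apply: (c (_, _)); left.
- move=> /specs_pi [G [? [-> /specs_do [? [-> /specs_do [? [->]]]]]]].
  move=> /specs_pf [A [? [-> /specs_pf [C [? [-> h]]]]]] R s' r; srun.
  premises r0 (specs_asm1 h r0) G (Ldiv A C) [:: (Fm A :: G, C)].
  rewrite !rev_cat !revK ?enc_goals1 ?enc_goals2 !enc_sequentE enc_meta_fm -!catA.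
  by rewrite /= -!catA; apply=> // c; apply: cf_ldivR; apply: (c (_, _)); left.
- move=> /specs_pi [G [? [-> /specs_pi [H [? [-> /specs_do [? [-> /specs_do [? [->]]]]]]]]]].
  move=> /specs_pf [A [? [-> /specs_pf [B [? [-> h]]]]]] R s' r; srun.
  premises r (specs_asm2 h r) (G ++ H) (Prod A B) [:: (G, A); (H, B)].
  rewrite !rev_cat !revK ?enc_goals1 ?enc_goals2 !enc_sequentE enc_meta_cat -!catA.
  rewrite /= -!catA; apply=> // c.
  by apply: cf_prodR; [apply: (c (_, _)); left | apply: (c (_, _)); right; left].
- move=> /specs_do [? [-> /specs_pi [G [? [-> /specs_do [? [->]]]]]]].
  move=> /specs_do [? [-> /specs_do [? [-> /specs_pf [A [? [-> h]]]]]]] R s' r; srun.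
  premises r (specs_asm1 h r) [:: Br G] (Dia A) [:: (G, A)].
  rewrite !rev_cat !revK ?enc_goals1 ?enc_goals2 !enc_sequentE enc_meta_br.
  by rewrite /= -?catA; apply=> // c; apply: cf_diaR; apply: (c (_, _)); left.
- move=> /specs_do [? [-> /specs_pi [G [? [-> /specs_do [? [->]]]]]]].
  move=> /specs_do [? [-> /specs_do [? [-> /specs_pf [A [? [-> h]]]]]]] R s' r; srun.
  premises r (specs_asm1 h r) G (Box A) [:: ([:: Br G], A)].
  rewrite rev_cons !rev_cat !revK ?enc_goals1 ?enc_goals2 !enc_sequentE enc_meta_br.
  by rewrite /= -cats1 -!catA; apply=> // c; apply: cf_boxR; apply: (c (_, _)); left.
- move=> /specs_call [? [? [-> [As ->] /specs_do [? [-> /specs_do [? [->]]]]]]].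
  move=> /specs_pf [A [? [-> h]]] R s' r; srun.
  premises r (specs_asm1 h r) (bangs As) (Bang A) [:: (bangs As, A)].
  rewrite !rev_cat !revK ?enc_goals1 ?enc_goals2 !enc_sequentE.
  by rewrite /= -?catA; apply=> // c; apply: cf_bangR; apply: (c (_, _)); left.
Qed.

Lemma spec_PLoop rhs w : rhs \in body PLoop -> specs rhs w -> spec PLoop w.
Proof.
rewrite /body !inE => /orP[/eqP-> ->|/eqP->].
  by move=> R s' [<-]; exists R.
move=> /specs_call [w1 [w2 [-> h1 /specs_call [w3 [w4 [-> h2 ->]]]]]] R s'.
rewrite cats0 run_cat; case e: (run w1 _) => [s1|] //= r.
have [R1 [e1 g1]] := h1 _ _ e; subst; have [R2 [e2 g2]] := h2 _ _ r.
by exists R2; split=> // /g2.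
Qed.

Lemma spec_PStart rhs w : rhs \in body PStart -> specs rhs w -> spec PStart w.
Proof.
rewrite /body !inE => /eqP->.
move=> /specs_call [? [? [-> [G [okG ->]] /specs_cps [? [-> /specs_call [? [? [->]]]]]]]].
move=> [B [okB ->]] /specs_do [? [-> /specs_back [v [? [->]]]]].
move=> /specs_call [w1 [? [-> h /specs_do [? [-> /specs_nil ->]]]]] x s' r; srun.
(* This first test of [KR] says that the sequent read is the whole input; the one after the loop
   says that no goal is left. *)
case: (run_emp_inv r0) => /= eR {}r0; subst R; srun.
rewrite run_cat in r; case e: (run w1 _) r => [s1|] //= /run_emp_inv [eR _].
have [R' [es hg]] := h _ _ e; exists G, B; split.
- by rewrite cats0.
- by apply/bracket_nonnegP; rewrite okB andbT.
- move: hg; rewrite rev_cat rev_cons !revK -cats1 -!catA /= => hg.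
  have : good (enc_sequent G B ++ [::]).
    by rewrite cats0; apply: hg; move: eR; rewrite es /= => ->; exists [::].
  by move/good_cons => [].
Qed.

Lemma gen_specs k w n : gen k w n -> specs k w.
Proof.
elim=> {k w n} [|a k w n _ IH|X rhs k w n rX _ /specs_cat [w1 [w2 [-> s1 s2]]]] //.
  by exists w.
exists w1, w2; split=> //; case: X rX => *; last exact: (spec_PStart _ s1).
- exact: (spec_PF _ s1).
- exact: (spec_PB _ s1).
- exact: (spec_PI _ s1).
- exact: (spec_PG _ s1).
- exact: (spec_PK _ s1).
- exact: (spec_PE _ s1).
- exact: (spec_PM _ s1).
- exact: (spec_PC _ s1).
- exact: (spec_PRule _ s1).
- exact: (spec_PLoop _ s1).
Qed.

Theorem gen_sound x w n s' : gen [:: Call PStart] w n -> run w (init x) = Some s' ->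
  exists G B, [/\ x = enc_sequent G B, bracket_nonneg G B & derivable G B].
Proof.
move=> /gen_specs /specs_call [w1 [w2 [-> h /specs_nil ->]]]; rewrite cats0.
by move=> /h [G [B [-> ok c]]]; exists G, B; split=> //; apply/derivable_cf.
Qed.

(** * Completeness of the checker *)

Definition gens (k : seq cmd) (w : seq act) : Prop := exists n, gen k w n.

Lemma gens_nil : gens [::] [::].
Proof. by exists 0; apply: gen_nil. Qed.

Lemma gens_do a k w : gens k w -> gens (Do a :: k) (a :: w).
Proof. by move=> [n g]; exists n.+1; apply: gen_do. Qed.

Lemma gens_cat k1 k2 w1 w2 : gens k1 w1 -> gens k2 w2 -> gens (k1 ++ k2) (w1 ++ w2).
Proof.
move=> [n1 g1] g2; elim: g1 => {k1 w1 n1} [|a k w n _ IH|X rhs k w n rX _ [m g]] //.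
  exact: gens_do.
by exists m.+1; apply: (gen_call rX); rewrite catA.
Qed.

Lemma gens_call X k w1 w2 : gens [:: Call X] w1 -> gens k w2 -> gens (Call X :: k) (w1 ++ w2).
Proof. exact: gens_cat. Qed.

Lemma gens_body X rhs w : rhs \in body X -> gens rhs w -> gens [:: Call X] w.
Proof. by move=> rX [n g]; exists n.+1; apply: (gen_call rX); rewrite cats0. Qed.

Lemma gens_alt X i w : i < size (body X) -> gens (nth [::] (body X) i) w ->
  gens [:: Call X] w.
Proof. by move=> lti; apply: gens_body; apply: mem_nth. Qed.

Lemma gens_cps t d a k w : gens k w -> gens (cps t d a ++ k) (cpw t d [:: a] ++ w).
Proof.
move=> g; apply: gens_cat => //; rewrite /cps /cpw /= cats0.
by case: d; do !apply: gens_do; apply: gens_nil.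
Qed.

Lemma cpw1 t d a v : cpw t d (a :: v) = cpw t d [:: a] ++ cpw t d v.
Proof. exact: (cpw_cat t d [:: a]). Qed.

Lemma gens_PB t d z l : last (~~ z) l ->
  gens [:: Call (PB t d z)] (cpw t d ([seq SBit b | b <- l] ++ [:: SEnd])).
Proof.
elim: l z => [|b l IH] z.
  case: z => // _; apply: (@gens_body _ (cps t d SEnd)); first by rewrite !inE eqxx ?orbT.
  by rewrite -[cps _ _ _]cats0 -[cpw _ _ _]cats0; apply/gens_cps/gens_nil.
move=> h; apply: (@gens_body _ (cps t d (SBit b) ++ [:: Call (PB t d (~~ b))])).
  by case: b {h}; rewrite !inE eqxx ?orbT.
rewrite [map _ _]/= cat_cons cpw1; apply: gens_cps; apply: IH.
by rewrite negbK.
Qed.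

Lemma gens_PF m t d A : okm m A ->
  gens [:: Call (PF m t d)] (cpw t d (enc_formula A)).
Proof.
elim: A m => [i||A IA B IB|A IA B IB|A IA B IB|A IA|A IA|A IA] m;
  rewrite [okm _ _]/= [enc_formula _]/=.
- move=> _; apply: (@gens_body _ (cps t d SVar ++ [:: Call (PB t d false)])).
    by rewrite !inE eqxx.
  by rewrite cpw1; apply/gens_cps/gens_PB/nat_bits_last.
- move=> _; apply: (@gens_body _ (cps t d SOne)); first by rewrite !inE eqxx ?orbT.
  by rewrite -[cps _ _ _]cats0 -[cpw _ _ _]cats0; apply/gens_cps/gens_nil.
- move=> /andP[/IA gA /IB gB].
  apply: (@gens_body _ (cps t d SLdiv ++ [:: Call (PF (mode_neg m) t d); Call (PF m t d)])).
    by rewrite !inE eqxx ?orbT.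
  by rewrite cpw1 ?cpw_cat; apply: gens_cps; apply: gens_call.
- move=> /andP[/IA gA /IB gB].
  apply: (@gens_body _ (cps t d SRdiv ++ [:: Call (PF m t d); Call (PF (mode_neg m) t d)])).
    by rewrite !inE eqxx ?orbT.
  by rewrite cpw1 ?cpw_cat; apply: gens_cps; apply: gens_call.
- move=> /andP[/IA gA /IB gB].
  apply: (@gens_body _ (cps t d SProd ++ [:: Call (PF m t d); Call (PF m t d)])).
    by rewrite !inE eqxx ?orbT.
  by rewrite cpw1 ?cpw_cat; apply: gens_cps; apply: gens_call.
- move=> /andP[ok /IA gA]; apply: (@gens_body _ (cps t d SDia ++ [:: Call (PF m t d)])).
    by rewrite /body ok !(inE, mem_cat) eqxx ?orbT.
  by rewrite cpw1 ?cpw_cat; apply: gens_cps.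
- move=> /andP[ok /IA gA]; apply: (@gens_body _ (cps t d SBox ++ [:: Call (PF m t d)])).
    by rewrite /body ok !(inE, mem_cat) eqxx ?orbT.
  by rewrite cpw1 ?cpw_cat; apply: gens_cps.
- move=> /IA gA; apply: (@gens_body _ (cps t d SBang ++ [:: Call (PF (mode_bang m) t d)])).
    by rewrite !inE eqxx ?orbT.
  by rewrite cpw1 ?cpw_cat; apply: gens_cps.
Qed.

Lemma gens_PI c t G : c ==> all ok_item G ->
  gens [:: Call (PI c t)] (cpw t false (enc_meta G)).
Proof.
move: G; apply: (@meta_ind (fun x => forall H, c ==> ok_item x ->
  gens [:: Call (PI c t)] (cpw t false (enc_meta H)) ->
  gens [:: Call (PI c t)] (cpw t false (enc_meta (x :: H))))).
- move=> A H ok gH; rewrite enc_meta_fm cpw_cat.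
  apply: (gens_body (rhs :=
    [:: Call (PF (if c then Some (false, false) else None) t false); Call (PI c t)])).
    by rewrite !inE eqxx ?orbT.
  by apply: gens_call => //; apply: gens_PF; case: c ok gH => //= *; apply: okm_None.
- move=> G IG H ok gH; rewrite enc_meta_br.
  apply: (@gens_body _ (cps t false SOpen ++ Call (PI c t) :: cps t false SClose ++ [:: Call (PI c t)])).
    by rewrite !inE eqxx ?orbT.
  rewrite cpw1 cpw_cat [cpw _ _ (SClose :: _)]cpw1; apply/gens_cps/gens_call; first exact: IG.
  exact: gens_cps.
- move=> _; apply: (@gens_body _ [::]); last exact: gens_nil.
  by rewrite !inE eqxx.
- by case: c => x G Px IG /= => [/andP[ok1 ok2]|_]; apply: Px => //; apply: IG.
Qed.

Lemma gens_PG d As : gens [:: Call (PG d)] (cpw KL d (enc_meta (bangs As))).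
Proof.
elim: As => [|A As IH].
  by apply: (@gens_body _ [::]); rewrite ?inE //; apply: gens_nil.
apply: (@gens_body _ (cps KL d SBang ++ [:: Call (PF None KL d); Call (PG d)])).
  by rewrite !inE eqxx ?orbT.
rewrite [bangs _]/= enc_meta_fm [enc_formula _]/= cat_cons cpw1 cpw_cat.
by apply/gens_cps/gens_call => //; apply/gens_PF/okm_None.
Qed.

Lemma in_symbols a : a \in symbols.
Proof. by case: a => [|[]|||||||||||]. Qed.

Lemma gens_PK t v : gens [:: Call (PK t)] (bkw t v).
Proof.
elim: v => [|a v IH]; first by apply: (@gens_body _ [::]); rewrite ?inE //; apply: gens_nil.
apply: (@gens_body _ [:: Do (Pop t a); Do (Push KR a); Call (PK t)]).
  by rewrite /body inE; apply/orP; right; apply/mapP; exists a => //; apply: in_symbols.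
by do 2!apply: gens_do.
Qed.

Lemma gens_PE v : gens [:: Call PE] (eqw v).
Proof.
elim: v => [|a v IH]; first by apply: (@gens_body _ [::]); rewrite ?inE //; apply: gens_nil.
apply: (@gens_body _ [:: Do (Pop KL a); Do (Pop KU a); Call PE]).
  by rewrite /body inE; apply/orP; right; apply/mapP; exists a => //; apply: in_symbols.
by do 2!apply: gens_do.
Qed.

Lemma gens_fmla t A k w : gens k w -> gens (fmla t :: k) (cpw t false (enc_formula A) ++ w).
Proof. by apply: gens_call; apply/gens_PF/okm_None. Qed.

Lemma gens_items t G k w : gens k w -> gens (items t :: k) (cpw t false (enc_meta G) ++ w).
Proof. by apply: gens_call; apply: gens_PI. Qed.

Lemma gens_back t v k w : gens k w -> gens (back t ++ k) (bkw t v ++ Emp t :: w).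
Proof. by move=> g; apply: gens_call; [apply: gens_PK | apply: gens_do]. Qed.

Definition asm1w U T L : seq act :=
  bkw KU U ++ Emp KU :: Push KR SArrow :: bkw KT T ++ Emp KT :: bkw KL L ++ [:: Emp KL].
Definition asm2w U L V T : seq act :=
  bkw KU U ++ Emp KU :: Push KR SArrow :: bkw KL L ++ Emp KL ::
  bkw KV V ++ Emp KV :: Push KR SArrow :: bkw KT T ++ [:: Emp KT].

Lemma gens_asm1 U T L : gens asm1 (asm1w U T L).
Proof.
apply/gens_back/gens_do/gens_back; rewrite -[back _]cats0.
exact/gens_back/gens_nil.
Qed.

Lemma gens_asm2 U L V T : gens asm2 (asm2w U L V T).
Proof.
apply/gens_back/gens_do/gens_back/gens_back/gens_do; rewrite -[back _]cats0.
exact/gens_back/gens_nil.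
Qed.

Lemma run_bkU R L U T V w :
  run (bkw KU U ++ Emp KU :: w) (St R L U T V) = run w (St (rev U ++ R) L [::] T V).
Proof. exact: (@run_bkw KU (St R L U T V)). Qed.
Lemma run_bkL R L U T V w :
  run (bkw KL L ++ Emp KL :: w) (St R L U T V) = run w (St (rev L ++ R) [::] U T V).
Proof. exact: (@run_bkw KL (St R L U T V)). Qed.
Lemma run_bkT R L U T V w :
  run (bkw KT T ++ Emp KT :: w) (St R L U T V) = run w (St (rev T ++ R) L U [::] V).
Proof. exact: (@run_bkw KT (St R L U T V)). Qed.
Lemma run_bkV R L U T V w :
  run (bkw KV V ++ Emp KV :: w) (St R L U T V) = run w (St (rev V ++ R) L U T [::]).
Proof. exact: (@run_bkw KV (St R L U T V)). Qed.

Lemma run_asm1 R L U T V : run (asm1w U T L) (St R L U T V) =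
  Some (St (rev L ++ rev T ++ SArrow :: rev U ++ R) [::] [::] [::] V).
Proof. by rewrite /asm1w run_bkU run_push /= run_bkT run_bkL. Qed.

Lemma run_asm2 R L U T V : run (asm2w U L V T) (St R L U T V) =
  Some (init (rev T ++ SArrow :: rev V ++ rev L ++ SArrow :: rev U ++ R)).
Proof. by rewrite /asm2w run_bkU run_push /= run_bkL run_bkV run_push /= run_bkT. Qed.

Lemma run_cpS t d v R L U T V w : cp_ok t d ->
  run (cpw t d v ++ w) (St (v ++ R) L U T V) = run w (copied t d v (St (v ++ R) L U T V) R).
Proof. by move=> ok; apply: run_cpw. Qed.

Lemma run_pop a R L U T V w :
  run (Pop KR a :: w) (St (a :: R) L U T V) = run w (St R L U T V).
Proof. by rewrite /run /= eqxx. Qed.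

Lemma size_cpw t d v : size (cpw t d v) = (if d then 3 else 2) * size v.
Proof.
by elim: v => [|a v IH]; rewrite ?muln0 // cpw_cons size_cat IH /cp; case: d {IH}; rewrite /= mulnS.
Qed.

Lemma size_bkw t v : size (bkw t v) = 2 * size v.
Proof. by elim: v => [|a v IH] //=; rewrite IH mulnS. Qed.

Lemma size_eqw v : size (eqw v) = 2 * size v.
Proof. by elim: v => [|a v IH] //=; rewrite IH mulnS. Qed.

Lemma size_asm1w U T L : size (asm1w U T L) = 2 * (size U + size T + size L) + 4.
Proof. by rewrite /asm1w; do ?rewrite /= size_cat size_bkw; rewrite /=; lia. Qed.

Lemma size_asm2w U L V T : size (asm2w U L V T) = 2 * (size U + size L + size V + size T) + 6.
Proof. by rewrite /asm2w; do ?rewrite /= size_cat size_bkw; rewrite /=; lia. Qed.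

(** The bound on [X'] is dictated by contraction, which repeats the formulae !A and adds two
    brackets. The constants 20 are generous. *)
Definition mstep1 (X X' : meta) : Prop := exists w, [/\ gens [:: Call (PM false)] w,
  forall R L U, run w (St (enc_meta X ++ R) L U [::] [::]) =
    Some (St R (rev (enc_meta X') ++ L) U [::] [::]),
  size w <= 20 * size (enc_meta X) + 20 &
  size (enc_meta X') <= 2 * size (enc_meta X) + 2].

Definition mstep2 (X X' G : meta) (B : formula) : Prop :=
  exists w, [/\ gens [:: Call (PM true)] w,
  forall R L U, run w (St (enc_meta X ++ R) L U [::] [::]) =
    Some (St R (rev (enc_meta X') ++ L) U (rev (enc_meta G)) (rev (enc_formula B))),
  size w <= 20 * size (enc_meta X) + 20 &
  size (enc_meta X') + size (enc_meta G) + size (enc_formula B) <= size (enc_meta X)].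

Ltac gtac := repeat first
  [ apply: gens_nil | apply: gens_asm1 | apply: gens_asm2 | apply: gens_fmla | apply: gens_items
  | apply: gens_cps | apply: gens_back | apply: gens_do ].
Ltac by_alt i := apply: (@gens_alt _ i); [by [] | cbv [body nth]; gtac].
Ltac frun := repeat first
  [ rewrite run_cpS //= /copied /= | rewrite run_pop | rewrite run_push /=
  | rewrite run_bkT | rewrite run_asm1 | rewrite run_asm2 | rewrite run_nil ].
Ltac size_tac :=
  repeat rewrite ?(size_cat, size_cpw, size_bkw, size_eqw, size_rev, size_asm1w, size_asm2w) /=;
  lia.

Lemma mstep_prod A B : mstep1 [:: Fm (Prod A B)] [:: Fm A; Fm B].
Proof.
exists (Pop KR SProd :: cpw KL false (enc_formula A) ++ cpw KL false (enc_formula B) ++ [::]).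
rewrite enc_fm enc_meta_fm enc_fm [enc_formula (Prod _ _)]/=; split.
- by_alt 0.
- by move=> R L U; rewrite /= -!catA; frun; rewrite rev_cat -!catA.
- size_tac.
- size_tac.
Qed.

Lemma mstep_one : mstep1 [:: Fm One] [::].
Proof.
exists [:: Pop KR SOne]; split; [by_alt 1 | by move=> R L U; rewrite /=; frun | by [] | by []].
Qed.

Lemma mstep_dia A : mstep1 [:: Fm (Dia A)] [:: Br [:: Fm A]].
Proof.
exists (Pop KR SDia :: Push KL SOpen :: cpw KL false (enc_formula A) ++ [:: Push KL SClose]).
rewrite enc_meta_br !enc_fm [enc_formula (Dia _)]/=; split.
- by_alt 2.
- by move=> R L U; rewrite /=; frun; rewrite /= rev_cons rev_cat -cats1 -!catA.
- size_tac.
- size_tac.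
Qed.

Lemma mstep_box A : mstep1 [:: Br [:: Fm (Box A)]] [:: Fm A].
Proof.
exists (Pop KR SOpen :: Pop KR SBox :: cpw KL false (enc_formula A) ++ [:: Pop KR SClose]).
rewrite enc_meta_br !enc_fm [enc_formula (Box _)]/=; split.
- by_alt 3.
- by move=> R L U; rewrite /= -catA; frun.
- size_tac.
- size_tac.
Qed.

Lemma mstep_bang A : mstep1 [:: Fm (Bang A)] [:: Fm A].
Proof.
exists (Pop KR SBang :: cpw KL false (enc_formula A) ++ [::]).
rewrite !enc_fm [enc_formula (Bang _)]/=; split.
- by_alt 4.
- by move=> R L U; rewrite /=; frun.
- size_tac.
- size_tac.
Qed.

Lemma mstep_contr As G : mstep1 (bangs As ++ G) (bangs As ++ [:: Br (bangs As ++ G)]).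
Proof.
set a := enc_meta (bangs As).
exists (cpw KL true a ++ Push KR SArrow :: bkw KT (rev a) ++ Emp KT :: Push KL SOpen ::
  cpw KL false a ++ Pop KR SArrow :: cpw KL false (enc_meta G) ++ [:: Push KL SClose]).
rewrite !enc_meta_cat enc_meta_br enc_meta_cat -/a; split.
- apply: (@gens_alt _ 5); first by []; cbv [body nth].
  by apply: gens_call; [apply: gens_PG | gtac].
- move=> R L U; rewrite -!catA; frun; rewrite cats0; frun; rewrite revK; frun.
  by rewrite !rev_cat !rev_cons !rev_cat -!cats1 -!catA.
- size_tac.
- size_tac.
Qed.

Lemma mstep_perm2 A G : mstep1 (Fm (Bang A) :: G) (G ++ [:: Fm (Bang A)]).
Proof.
set a := enc_formula A.
exists (cpw KT false [:: SBang] ++ cpw KT false a ++ cpw KL false (enc_meta G) ++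
  bkw KT (rev a ++ [:: SBang]) ++ Emp KT :: cpw KL false [:: SBang] ++ cpw KL false a ++ [::]).
rewrite enc_meta_cat enc_meta_fm enc_fm [enc_formula (Bang _)]/= -/a; split.
- by_alt 6.
- move=> R L U; rewrite /= -!catA -cat1s; frun.
  rewrite rev_cat revK -catA; frun.
  by rewrite rev_cat rev_cons -cats1 -!catA.
- size_tac.
- size_tac.
Qed.

Lemma mstep_perm1 A G : mstep1 (G ++ [:: Fm (Bang A)]) (Fm (Bang A) :: G).
Proof.
set a := enc_formula A.
exists (cpw KT false (enc_meta G) ++ cpw KL false [:: SBang] ++ cpw KL false a ++
  Push KR SArrow :: bkw KT (rev (enc_meta G)) ++ Emp KT ::
  cpw KL false (enc_meta G) ++ [:: Pop KR SArrow]).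
rewrite enc_meta_cat enc_fm enc_meta_fm [enc_formula (Bang _)]/= -/a; split.
- by_alt 7.
- move=> R L U; rewrite -!catA /= -?catA; frun; rewrite cats0; frun; rewrite revK; frun.
  by rewrite rev_cons rev_cat -cats1 -!catA.
- size_tac.
- size_tac.
Qed.

Lemma mstep_rdiv C B G : mstep2 (Fm (Rdiv C B) :: G) [:: Fm C] G B.
Proof.
exists (Pop KR SRdiv :: cpw KL false (enc_formula C) ++ cpw KV false (enc_formula B) ++
  cpw KT false (enc_meta G) ++ [::]).
rewrite enc_meta_fm enc_fm [enc_formula (Rdiv _ _)]/=; split.
- by_alt 0.
- by move=> R L U; rewrite /= -!catA; frun; rewrite !cats0.
- size_tac.
- size_tac.
Qed.

Lemma mstep_ldiv A C G : mstep2 (G ++ [:: Fm (Ldiv A C)]) [:: Fm C] G A.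
Proof.
exists (cpw KT false (enc_meta G) ++ Pop KR SLdiv :: cpw KV false (enc_formula A) ++
  cpw KL false (enc_formula C) ++ [::]).
rewrite enc_meta_cat !enc_fm [enc_formula (Ldiv _ _)]/=; split.
- by_alt 1.
- by move=> R L U; rewrite -!catA /= -!catA; frun; rewrite !cats0.
- size_tac.
- size_tac.
Qed.

Definition rule_cost (G : meta) (B : formula) : nat := 60 * size (enc_sequent G B) + 60.

Definition can (R R' : seq symbol) (N : nat) : Prop := exists w,
  [/\ gens [:: Call PRule] w, run w (init R) = Some (init R') & size w <= N].

Ltac unlet := repeat match goal with x := _ |- _ => unfold x; clear x end.

Ltac rule_tac i := split;
  [ by_alt i
  | rewrite ?enc_sequentE /init ?enc_meta_cat ?enc_meta_br ?enc_fm -?catA /= -?catA;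
    frun; rewrite ?cats0; frun;
    rewrite /init ?rev_cons ?rev_cat ?revK -?cats1 ?enc_sequentE;
    rewrite ?enc_meta_cat ?enc_meta_br ?enc_fm -?catA /= -?catA //
  | unlet; rewrite /rule_cost /enc_sequent ?enc_meta_cat ?enc_meta_br ?enc_fm; size_tac ].

Lemma can_ax A r : can (enc_sequent [:: Fm A] A ++ r) r (rule_cost [:: Fm A] A).
Proof.
set a := enc_formula A.
exists (cpw KL false a ++ Pop KR SArrow :: cpw KU false a ++ eqw (rev a) ++ [:: Emp KL; Emp KU]).
split.
- apply: (@gens_alt _ 2); first by []; cbv [body nth]; gtac.
  by apply: gens_call; [apply: gens_PE | gtac].
- by rewrite enc_sequentE enc_fm /init; frun; rewrite !cats0 run_eqw.
- by unlet; rewrite /rule_cost /enc_sequent enc_fm; size_tac.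
Qed.

Lemma can_oneR r : can (enc_sequent [::] One ++ r) r (rule_cost [::] One).
Proof. by exists [:: Pop KR SArrow; Pop KR SOne]; split; [by_alt 3 | frun |]. Qed.

Lemma can_rdivR G C B r : can (enc_sequent G (Rdiv C B) ++ r)
  (enc_sequent (G ++ [:: Fm B]) C ++ r) (rule_cost G (Rdiv C B)).
Proof.
set c := enc_formula C; set b := enc_formula B; set g := enc_meta G.
exists (cpw KL false g ++ Pop KR SArrow :: Pop KR SRdiv :: cpw KU false c ++
  cpw KL false b ++ asm1w (rev c) [::] (rev b ++ rev g)).
by rule_tac 4.
Qed.

Lemma can_ldivR G A C r : can (enc_sequent G (Ldiv A C) ++ r)
  (enc_sequent (Fm A :: G) C ++ r) (rule_cost G (Ldiv A C)).
Proof.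
set c := enc_formula C; set a := enc_formula A; set g := enc_meta G.
exists (cpw KT false g ++ Pop KR SArrow :: Pop KR SLdiv :: cpw KL false a ++
  cpw KU false c ++ asm1w (rev c) (rev g) (rev a)).
by rule_tac 5.
Qed.

Lemma can_prodR G H A B r : can (enc_sequent (G ++ H) (Prod A B) ++ r)
  (enc_sequent G A ++ enc_sequent H B ++ r) (rule_cost (G ++ H) (Prod A B)).
Proof.
set b := enc_formula B; set a := enc_formula A; set g := enc_meta G; set h := enc_meta H.
exists (cpw KT false g ++ cpw KL false h ++ Pop KR SArrow :: Pop KR SProd ::
  cpw KV false a ++ cpw KU false b ++ asm2w (rev b) (rev h) (rev a) (rev g)).
by rule_tac 6.
Qed.

Lemma can_diaR G A r : can (enc_sequent [:: Br G] (Dia A) ++ r)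
  (enc_sequent G A ++ r) (rule_cost [:: Br G] (Dia A)).
Proof.
set a := enc_formula A; set g := enc_meta G.
exists (Pop KR SOpen :: cpw KL false g ++ Pop KR SClose :: Pop KR SArrow :: Pop KR SDia ::
  cpw KU false a ++ asm1w (rev a) [::] (rev g)).
by rule_tac 7.
Qed.

Lemma can_boxR G A r : can (enc_sequent G (Box A) ++ r)
  (enc_sequent [:: Br G] A ++ r) (rule_cost G (Box A)).
Proof.
set a := enc_formula A; set g := enc_meta G.
exists (Push KL SOpen :: cpw KL false g ++ Push KL SClose :: Pop KR SArrow :: Pop KR SBox ::
  cpw KU false a ++ asm1w (rev a) [::] (SClose :: rev g ++ [:: SOpen])).
by rule_tac 8.
Qed.

Lemma can_bangR As A r : can (enc_sequent (bangs As) (Bang A) ++ r)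
  (enc_sequent (bangs As) A ++ r) (rule_cost (bangs As) (Bang A)).
Proof.
set a := enc_formula A; set g := enc_meta (bangs As).
exists (cpw KL false g ++ Pop KR SArrow :: Pop KR SBang ::
  cpw KU false a ++ asm1w (rev a) [::] (rev g)).
split.
- apply: (@gens_alt _ 9); first by []; cbv [body nth].
  by apply: gens_call; [apply: gens_PG | gtac].
- by rewrite !enc_sequentE /init; frun; rewrite ?cats0; frun; rewrite !revK.
- by unlet; rewrite /rule_cost /enc_sequent; size_tac.
Qed.

Lemma gens_PC b D w : gens [:: Call (PM b)] w -> gens [:: Call (PC b)]
  (cpw KL false (enc_left D) ++ w ++ cpw KL false (enc_right D)).
Proof.
move=> g; elim: D => [l r|l D IH r].
  rewrite -[cpw _ _ (enc_right _)]cats0; apply: (@gens_alt _ 0) => //; cbv [body nth].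
  by apply/gens_items/gens_call => //; apply/gens_items/gens_nil.
rewrite [enc_left _]/= [enc_right _]/= cpw_cat [cpw _ _ (SOpen :: _)]cpw1 cpw_cat
  [cpw _ _ (SClose :: _)]cpw1 -[cpw _ _ (enc_meta r)]cats0 -!catA.
apply: (@gens_alt _ 1) => //; cbv [body nth].
have := gens_call IH (gens_cps KL false SClose (gens_items KL r gens_nil)).
by rewrite -!catA => h; apply/gens_items/gens_cps/h.
Qed.

Lemma can_left1 D X X' E r : mstep1 X X' ->
  can (enc_sequent (fill D X) E ++ r) (enc_sequent (fill D X') E ++ r)
      (rule_cost (fill D X) E).
Proof.
move=> [w [g rw szw szX]]; set e := enc_formula E.
exists ((cpw KL false (enc_left D) ++ w ++ cpw KL false (enc_right D)) ++ Pop KR SArrow ::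
  cpw KU false e ++
  asm1w (rev e) [::] (rev (enc_right D) ++ rev (enc_meta X') ++ rev (enc_left D))).
split.
- apply: (@gens_alt _ 0); first by []; cbv [body nth].
  by apply: gens_call; [apply: gens_PC | gtac].
- rewrite !enc_sequentE /init !enc_fill -!catA; frun.
  by rewrite run_cat rw /= cats0; frun; rewrite cats0; frun; rewrite !rev_cat !revK -!catA.
- by unlet; rewrite /rule_cost /enc_sequent enc_fill; move: szw szX; size_tac.
Qed.

Lemma can_left2 D X X' G B E r : mstep2 X X' G B ->
  can (enc_sequent (fill D X) E ++ r) (enc_sequent G B ++ enc_sequent (fill D X') E ++ r)
      (rule_cost (fill D X) E).
Proof.
move=> [w [g rw szw szX]]; set e := enc_formula E.
exists ((cpw KL false (enc_left D) ++ w ++ cpw KL false (enc_right D)) ++ Pop KR SArrow ::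
  cpw KU false e ++
  asm2w (rev e) (rev (enc_right D) ++ rev (enc_meta X') ++ rev (enc_left D))
    (rev (enc_formula B)) (rev (enc_meta G))).
split.
- apply: (@gens_alt _ 1); first by []; cbv [body nth].
  by apply: gens_call; [apply: gens_PC | gtac].
- rewrite !enc_sequentE /init !enc_fill -!catA; frun.
  by rewrite run_cat rw /= cats0; frun; rewrite cats0; frun; rewrite !rev_cat !revK -!catA.
- by unlet; rewrite /rule_cost /enc_sequent enc_fill; move: szw szX; size_tac.
Qed.

Inductive steps : seq symbol -> seq symbol -> nat -> Prop :=
  | steps_refl R : steps R R 0
  | steps_can R R1 R2 N N' : can R R1 N -> steps R1 R2 N' -> steps R R2 (N + N').

Lemma steps_trans R R1 R2 N N' : steps R R1 N -> steps R1 R2 N' -> steps R R2 (N + N').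
Proof.
move=> s1 s2; elim: s1 s2 => {R R1 N} [//|R R1 R3 N N1 c _ IH] /IH s.
by rewrite -addnA; apply: steps_can c s.
Qed.

Lemma steps_loop R R' N : steps R R' N -> exists w,
  [/\ gens [:: Call PLoop] w, run w (init R) = Some (init R') & size w <= N].
Proof.
elim=> {R R' N} [R|R R1 R2 N N' [w [g r sz]] _ [w' [g' r' sz']]].
  by exists [::]; split=> //; apply: (@gens_alt _ 0) => //; apply: gens_nil.
exists (w ++ w'); split; last by rewrite size_cat leq_add.
  by apply: (@gens_alt _ 1) => //; cbv [body nth]; apply: gens_call.
by rewrite run_cat r.
Qed.

(** * Additive measures of meta-formulae *)

Section Sums.

Variables (f : formula -> nat) (c : nat).

Fixpoint isum (x : item) : nat :=
  match x with
  | Fm A => f A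
  | Br G => c + sumn [seq isum y | y <- G]
  end.

Definition msum (G : meta) : nat := sumn [seq isum x | x <- G].

Lemma msum_cons x G : msum (x :: G) = isum x + msum G.
Proof. by []. Qed.

Lemma msum_br G H : msum (Br G :: H) = c + msum G + msum H.
Proof. by []. Qed.

Lemma msum_fm A H : msum (Fm A :: H) = f A + msum H.
Proof. by []. Qed.

Lemma msum_nil : msum [::] = 0.
Proof. by []. Qed.

Lemma msum_cat G H : msum (G ++ H) = msum G + msum H.
Proof. by rewrite /msum map_cat sumn_cat. Qed.

Lemma msum_fill D X : msum (fill D X) = msum (fill D [::]) + msum X.
Proof.
elim: D => [l r|l D IH r] /=; rewrite !msum_cat ?msum_nil; first by lia.
by rewrite !msum_br IH; lia.
Qed.

End Sums.

Definition flen (A : formula) : nat := size (enc_formula A).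
Definition isz : meta -> nat := msum (fun=> 1) 1.

Lemma flen_gt0 A : 0 < flen A.
Proof. by case: A. Qed.

Lemma size_enc_meta G : size (enc_meta G) = msum flen 2 G.
Proof.
move: G; apply: (@meta_ind (fun x => size (enc_item x) = isum flen 2 x)) => //=.
  by move=> G IH; rewrite size_cat -/(enc_meta G) IH addn1.
by move=> x G Px IG; rewrite msum_cons -IG -Px /enc_meta /= size_cat.
Qed.

Lemma isz_enc G : isz G <= size (enc_meta G).
Proof.
rewrite size_enc_meta; move: G.
apply: (@meta_ind (fun x => isum (fun=> 1) 1 x <= isum flen 2 x)) => //=.
- by move=> A; apply: flen_gt0.
- by move=> G; rewrite /isz /msum; lia.
- by move=> x G; rewrite /isz !msum_cons; lia.
Qed.

(** * Permutations of banged formulae *)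

Definition is_bang (x : item) : bool := if x is Fm (Bang _) then true else false.

Definition bang_key (x : item) : nat :=
  if x is Fm (Bang A) then pickle (enc_formula A) else 0.

Lemma bang_key_inj x y : is_bang x -> is_bang y -> bang_key x = bang_key y -> x = y.
Proof.
case: x => [[]|] //= A _; case: y => [[]|] //= B _ /(pcan_inj pickleK) e.
by have := @enc_formula_prefix A B [::] [::]; rewrite !cats0 => /(_ e) [->].
Qed.

(** Insertion with this test puts the formulae !A first, sorted by key, and keeps the other items in
    their order. Applied at every depth, it yields a normal form for the permutation rules. *)
Definition before (x y : item) : bool :=
  ~~ is_bang y || (is_bang x && (bang_key x <= bang_key y)).

Fixpoint ins (x : item) (c : meta) : meta :=
  if c is y :: c' then if before x y then x :: c else y :: ins x c' else [:: x].

Fixpoint canon_item (x : item) : item :=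
  match x with
  | Fm A => Fm A
  | Br G => Br (foldr ins [::] [seq canon_item y | y <- G])
  end.

Definition canon (G : meta) : meta := foldr ins [::] [seq canon_item y | y <- G].

Lemma before_trichotomy x y z : is_bang x ->
  [/\ before x y || before y x, before x y -> before y x -> x = y,
      before y z -> ~~ before x z -> before y x && ~~ before x y &
      before x z -> ~~ before y z -> before x y && ~~ before y x].
Proof.
move=> bx; have inj := @bang_key_inj x y bx; move: inj; rewrite /before bx /=.
case: (is_bang y); case: (is_bang z) => /= inj; split; rewrite ?orbT ?andbT //; try by lia.
- by move=> h1 h2; apply: inj => //; lia.
- by move=> h1 h2; apply: inj => //; lia.
Qed.

(** Only [x] has to be a formula !A: this is what lets it pass any neighbour without affecting
    [canon]. *)
Lemma ins_comm x y c : is_bang x -> ins x (ins y c) = ins y (ins x c).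
Proof.
move=> bx; elim: c => [|z c IH] /=.
  have [tot asym _ _] := before_trichotomy y y bx.
  case bxy: (before x y) tot asym => /=; case byx: (before y x) => //= _ asym.
  by rewrite (asym _ _).
have [tot asym h1 h2] := before_trichotomy y z bx.
case byz: (before y z) h1 h2; case bxz: (before x z) => /= h1 h2; rewrite ?byz ?bxz.
- case bxy: (before x y) tot asym => /=; case byx: (before y x) => //= _ asym;
    rewrite ?byz ?bxz //; by rewrite (asym _ _).
- by have /andP[_ /negPf ->] := h1 isT isT.
- by have /andP[_ /negPf ->] := h2 isT isT.
- by rewrite IH.
Qed.

Lemma foldr_ins_comm x c s : is_bang x -> foldr ins (ins x c) s = ins x (foldr ins c s).
Proof. by move=> bx; elim: s => //= y s ->; rewrite [RHS]ins_comm. Qed.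

Lemma canon_fill D X Y : (forall c, foldr ins c (map canon_item X) = foldr ins c (map canon_item Y)) ->
  canon (fill D X) = canon (fill D Y).
Proof.
move=> h; elim: D => [l r|l D IH r]; rewrite /canon /= !map_cat !foldr_cat.
  by rewrite h.
by rewrite /= -/(canon _) IH.
Qed.

Lemma canon_perm D A G :
  canon (fill D (Fm (Bang A) :: G)) = canon (fill D (G ++ [:: Fm (Bang A)])).
Proof.
by apply: canon_fill => c; rewrite map_cat foldr_cat /= foldr_ins_comm.
Qed.

Definition pstep (G G' : meta) : Prop := exists D A H,
  (G = fill D (Fm (Bang A) :: H) /\ G' = fill D (H ++ [:: Fm (Bang A)])) \/
  (G' = fill D (Fm (Bang A) :: H) /\ G = fill D (H ++ [:: Fm (Bang A)])).

Lemma pstep_sym G G' : pstep G G' -> pstep G' G.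
Proof. by move=> [D [A [H [h|h]]]]; exists D, A, H; [right | left]. Qed.

Lemma pstep_fill D G G' : pstep G G' -> pstep (fill D G) (fill D G').
Proof.
by move=> [D' [A [H [[-> ->]|[-> ->]]]]]; exists (ctx_comp D D'), A, H;
  rewrite !fill_comp; [left | right].
Qed.

Lemma pstep_msum f c G G' : pstep G G' -> msum f c G = msum f c G'.
Proof.
move=> [D [A [H [[-> ->]|[-> ->]]]]]; rewrite msum_fill [RHS]msum_fill msum_cat !msum_fm msum_nil; lia.
Qed.

Inductive preach : nat -> meta -> meta -> Prop :=
  | preach_refl k G : preach k G G
  | preach_step k G G1 G2 : pstep G G1 -> preach k G1 G2 -> preach k.+1 G G2.

Lemma preach_mono k k' G G' : k <= k' -> preach k G G' -> preach k' G G'.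
Proof.
move=> le p; elim: p k' le => {k G G'} [k G|k G G1 G2 p _ IH] [|k'] // le.
- exact: preach_refl.
- exact: preach_refl.
- exact: preach_step p (IH _ le).
Qed.

Lemma preach_trans k k' G G1 G2 : preach k G G1 -> preach k' G1 G2 -> preach (k + k') G G2.
Proof.
move=> p; elim: p => {k G G1} [k G|k G G1 G3 p _ IH] h; last exact: preach_step p (IH h).
by apply: preach_mono h; apply: leq_addl.
Qed.

Lemma preach_sym k G G' : preach k G G' -> preach k G' G.
Proof.
elim=> {k G G'} [k G|k G G1 G2 p _ IH]; first exact: preach_refl.
rewrite -addn1; apply: preach_trans IH _.
by apply: preach_step (pstep_sym p) (preach_refl _ _).
Qed.

Lemma preach_fill k D G G' : preach k G G' -> preach k (fill D G) (fill D G').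
Proof.
elim=> {k G G'} [k G|k G G1 G2 p _ IH]; first exact: preach_refl.
exact: preach_step (pstep_fill D p) IH.
Qed.

Lemma preach_ins x c : preach (size c) (x :: c) (ins x c).
Proof.
elim: c => [|y c IH] /=; first exact: preach_refl.
case: ifP => [_|nb]; first exact: preach_refl.
(* [before x y] fails only if [y] is a formula !A, so exchanging the two neighbours is a single
   permutation. *)
apply: (@preach_step _ _ [:: y, x & c]).
  move: nb; rewrite /before; case by_: (is_bang y) => //=.
  case bx: (is_bang x) => /= _.
    case: x bx {IH} => [[]|] //= A _.
    by exists (Hole [::] c), A, [:: y]; left.
  case: y by_ {IH} => [[]|] //= A _.
  by exists (Hole [::] c), A, [:: x]; right.
by have := preach_fill (Hole [:: y] [::]) IH; rewrite /= !cats0.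
Qed.

Lemma size_canon G : size (canon G) = size G.
Proof.
have si x c : size (ins x c) = (size c).+1 by elim: c => //= y c IH; case: ifP => //= _; rewrite IH.
by elim: G => //= x G IH; rewrite [LHS]si -IH.
Qed.

(** Sorting the head costs a square [a ^ 2], sorting the tail [b ^ 2], and inserting the head at
    most [b], which the cross term of the square of [a + b] absorbs since [a] is positive. *)
Lemma preach_canon G : preach (isz G ^ 2) G (canon G).
Proof.
move: G; apply: (@meta_ind (fun x => preach (isum (fun=> 1) 1 x ^ 2) [:: x] [:: canon_item x])) => /=.
- by move=> A; apply: preach_refl.
- move=> G /(preach_fill (InBr [::] (Hole [::] [::]) [::])) /=; rewrite !cats0.
  by apply: preach_mono; rewrite leq_sqr leq_addl.
- exact: preach_refl.
- move=> x G Px IG; set a := isum _ _ _ in Px; set b := isz G in IG.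
  have szG : size G <= b.
    rewrite /b /isz; elim: G {IG b} => //= y G IH; rewrite msum_cons -add1n leq_add //.
    by case: y.
  have a0 : 0 < a by rewrite /a; case: (x).
  have p1 := preach_fill (Hole [::] G) Px.
  have p2 := preach_fill (Hole [:: canon_item x] [::]) IG.
  have p3 := preach_ins (canon_item x) (canon G).
  rewrite /= !cats0 in p1 p2.
  have := preach_trans (preach_trans p1 p2) p3; apply: preach_mono.
  rewrite size_canon (_ : isz (x :: G) = a + b) // sqrnD.
  by move: a0 szG; nia.
Qed.

Lemma preach_eq G G' : canon G = canon G' -> preach (isz G ^ 2 + isz G' ^ 2) G G'.
Proof.
by move=> e; apply: preach_trans (preach_canon G) _; rewrite e; apply/preach_sym/preach_canon.
Qed.

Lemma preach_steps k G G' B r N : preach k G G' -> rule_cost G B <= N ->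
  exists2 M, M <= k * N & steps (enc_sequent G B ++ r) (enc_sequent G' B ++ r) M.
Proof.
elim=> {k G G'} [k G|k G G1 G2 p _ IH] le; first by exists 0 => //; apply: steps_refl.
have le1 : rule_cost G1 B <= N.
  move: le; rewrite /rule_cost /enc_sequent !size_cat !size_enc_meta.
  by rewrite (pstep_msum _ _ p).
have [M leM st] := IH le1; exists (rule_cost G B + M).
  by rewrite mulSn leq_add.
apply: steps_can st; move: p => [D [A [H [[-> ->]|[-> ->]]]]]; apply: can_left1.
- exact: mstep_perm2.
- exact: mstep_perm1.
Qed.

(** * Size of cut-free derivations *)

(* Counts the bracket-erasing connectives: <> in succedent position and []^{-1}
   in antecedent position, b being the polarity of A in the sequent. *)
Fixpoint er (b : bool) (A : formula) : nat :=
  match A with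
  | Var _ | One => 0
  | Ldiv A C => er (~~ b) A + er b C
  | Rdiv C B => er b C + er (~~ b) B
  | Prod A B => er b A + er b B
  | Dia A => b + er b A
  | Box A => ~~ b + er b A
  | Bang A => er b A
  end.

Lemma er_inside b A : okm (Some (b, true)) A -> er b A = 0.
Proof.
elim: A b => [i||A IA B IB|B IB A IA|A IA B IB|A IA|A IA|A IA] b //=.
- by case/andP=> /IA -> /IB ->.
- by case/andP=> /IB -> /IA ->.
- by case/andP=> /IA -> /IB ->.
- by case: b => //= /IA ->.
- by case: b => //= /IA ->.
- exact: IA.
Qed.

Lemma er_flen b A : er b A <= flen A.
Proof.
rewrite /flen; elim: A b => [i||A IA B IB|B IB A IA|A IA B IB|A IA|A IA|A IA] b //=;
  rewrite ?size_cat.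
- by have := IA (~~ b); have := IB b; lia.
- by have := IA (~~ b); have := IB b; lia.
- by have := IA b; have := IB b; lia.
- by have := IA b; case: b; lia.
- by have := IA b; case: b; lia.
- by have := IA b; lia.
Qed.

Definition mlen : meta -> nat := msum flen 0.
Definition nbr : meta -> nat := msum (fun=> 0) 1.
Definition mer : meta -> nat := msum (er false) 0.

Lemma size_enc_mlen G : size (enc_meta G) = mlen G + 2 * nbr G.
Proof.
rewrite size_enc_meta; move: G; apply: (@meta_ind (fun x =>
  isum flen 2 x = isum flen 0 x + 2 * isum (fun=> 0) 1 x)) => //=.
- by move=> A; rewrite muln0 addn0.
- by move=> G; rewrite /mlen /nbr /msum; lia.
- by move=> x G; rewrite /mlen /nbr !msum_cons; lia.
Qed.

Lemma mer_mlen G : mer G <= mlen G.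
Proof.
move: G; apply: (@meta_ind (fun x => isum (er false) 0 x <= isum flen 0 x)) => //=.
- by move=> A; apply: er_flen.
- by move=> x G; rewrite /mer /mlen !msum_cons; lia.
Qed.

(* Formulae without bracket-erasing connectives may be copies made by
   contractions; the other ones are never copied.  A level of brackets together
   with all formulae of the second kind never grows. *)
Definition erfree (b : bool) (A : formula) : nat := if er b A == 0 then flen A else 0.
Definition lin (b : bool) (A : formula) : nat := if er b A == 0 then 0 else flen A.

Lemma erfree_lin b A : erfree b A + lin b A = flen A.
Proof. by rewrite /erfree /lin; case: ifP; rewrite ?addn0. Qed.

Definition mlin : meta -> nat := msum (lin false) 0.

Definition top_item (x : item) : nat := if x is Fm A then erfree false A else 0.
Definition top (G : meta) : nat := sumn [seq top_item x | x <- G].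

Fixpoint lv (k : nat) (x : item) : bool :=
  if x is Br G then (sumn [seq top_item y | y <- G] <= k) && all (lv k) G else true.

Lemma top_cat G H : top (G ++ H) = top G + top H.
Proof. by rewrite /top map_cat sumn_cat. Qed.

Lemma top_fm A G : top (Fm A :: G) = erfree false A + top G.
Proof. by []. Qed.

Lemma top_br G H : top (Br G :: H) = top H.
Proof. by []. Qed.

Lemma lv_br k G : lv k (Br G) = (top G <= k) && all (lv k) G.
Proof. by []. Qed.

Lemma all_lv_br k G H : all (lv k) (Br G :: H) = [&& top G <= k, all (lv k) G & all (lv k) H].
Proof. by rewrite /= -andbA. Qed.

Lemma lv_mono k k' G : k <= k' -> all (lv k) G -> all (lv k') G.
Proof.
move=> le; move: G; apply: (@meta_ind (fun x => lv k x -> lv k' x)) => //.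
- by move=> G IG; rewrite !lv_br => /andP[h /IG ->]; rewrite andbT; apply: leq_trans le.
- by move=> x G Px IG /= /andP[/Px -> /IG].
Qed.

Lemma lv_fill k d D X X' : all (lv k) (fill D X) -> top X' <= top X + d ->
  all (lv (k + d)) X' ->
  all (lv (k + d)) (fill D X') /\ top (fill D X') <= top (fill D X) + d.
Proof.
move=> h leX lvX'; have mono G := @lv_mono k (k + d) G (leq_addr _ _).
elim: D h => [l r|l D IH r] /=; rewrite !all_cat !top_cat.
  by move=> /and3P[/mono-> _ /mono->]; rewrite lvX'; split=> //; lia.
rewrite !all_lv_br !top_br => /and4P[/mono-> le h /mono->]; have [-> le'] := IH h.
by split; [rewrite !andbT; lia | lia].
Qed.

Lemma lv_sub k D X : all (lv k) (fill D X) -> all (lv k) X.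
Proof.
elim: D => [l r|l D IH r] /=; rewrite !all_cat; first by case/and3P.
by rewrite all_lv_br => /and4P[_ _ /IH].
Qed.

Lemma top_sub k D X : all (lv k) (fill D X) -> top (fill D X) <= k -> top X <= k.
Proof.
elim: D => [l r|l D IH r] /=; rewrite !all_cat !top_cat; first by lia.
by rewrite all_lv_br => /and4P[_ le h _] _; apply: IH.
Qed.

Lemma lv_total k G : msum (erfree false) 0 G <= k -> all (lv k) G && (top G <= msum (erfree false) 0 G).
Proof.
move: G k; apply: (@meta_ind (fun x => forall k, isum (erfree false) 0 x <= k ->
  lv k x && (top_item x <= isum (erfree false) 0 x))) => //=.
- by move=> G IG k le; have /andP[-> le'] := IG k le; rewrite !andbT; apply: leq_trans le.
- move=> x G Px IG k; rewrite msum_cons => le.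
  have /andP[-> le1] : lv k x && (top_item x <= isum (erfree false) 0 x) by apply: Px; lia.
  have /andP[-> le2] := IG k (leq_trans (leq_addl _ _) le).
  by rewrite /= leq_add.
Qed.

Definition slen G B := mlen G + flen B.
Definition ser G B := mer G + er true B.
(** From conclusion to premises no rule raises [ser - nbr], and a contraction lowers it by one while
    lengthening the sequent by at most [n]; the factor [n.+1] makes this a strict decrease. Every
    other rule, permutations aside, decreases the total length. *)
Definition phi n G B := slen G B + (ser G B - nbr G) * n.+1.

(** [k] bounds all levels at once, the outermost one together with the succedent, whose parts right
    rules move into it. All linear formulae are added to [k] because subformulae of any of them may
    later enter the fullest level, free of erasing connectives. *)
Definition seq_ok n G B : Prop :=
  [/\ all ok_item G, okm (Some (true, false)) B &
      exists k, [/\ all (lv k) G, top G + erfree true B <= k &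
                    k + (mlin G + lin true B) <= n]].

(** An encoded sequent has length [slen + 2 * nbr + 1], and both [slen] and [nbr] are at most [phi],
    whence [3 * N + 1]. A round is one logical rule preceded by permutations through the normal
    form, one square for each direction. *)
Definition step_cost N := 60 * (3 * N + 1) + 60.
Definition round_cost N := (2 * (3 * N + 1) ^ 2).+1 * step_cost N.

(** Quantifying over all antecedents with the same normal form makes permutation rules free in the
    induction. The cost of a round is taken at a common bound [N], so that it is uniform along the
    derivation. *)
Definition solved n G B : Prop := nbr G <= ser G B /\
  forall G' r N, canon G' = canon G -> phi n G B <= N ->
    exists2 M, M <= phi n G B * round_cost N & steps (enc_sequent G' B ++ r) r M.

(** One round permutes [G'] into [G] and applies the rule; the strict decrease of the sum of [phi]
    pays for it. *)
Lemma solve n G B (ps : seq (meta * formula)) : nbr G <= ser G B ->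
  (forall r, can (enc_sequent G B ++ r) (enc_goals ps ++ r) (rule_cost G B)) ->
  (forall p, List.In p ps -> solved n p.1 p.2) ->
  sumn [seq phi n p.1 p.2 | p <- ps] < phi n G B -> solved n G B.
Proof.
move=> bE rule sol lt; split=> // G' r N eG leN.
have pre := preach_eq eG.
have eqs f c : msum f c G' = msum f c G.
  by elim: pre => {eG} [//|k G0 G1 G2 p _]; rewrite (pstep_msum _ _ p).
have szG : size (enc_sequent G B) <= 3 * N + 1.
  rewrite /enc_sequent size_cat /= size_enc_mlen -/(flen B).
  have := mer_mlen G; have := er_flen true B; move: bE leN; rewrite /phi /slen /ser.
  by move: (_ * _.+1) => x; lia.
have cost0 : rule_cost G B <= step_cost N by rewrite /rule_cost /step_cost; lia.
have cost' : rule_cost G' B <= step_cost N.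
  by move: cost0; rewrite /rule_cost /enc_sequent !size_cat !size_enc_meta eqs.
have szi : isz G <= 3 * N + 1.
  apply: leq_trans (isz_enc G) _; apply: leq_trans szG.
  by rewrite /enc_sequent size_cat leq_addr.
have [M1 leM1 st1] := preach_steps r pre cost'.
have [M2 leM2 st2] : exists2 M2, M2 <= sumn [seq phi n p.1 p.2 | p <- ps] * round_cost N &
    steps (enc_goals ps ++ r) r M2.
  have leps : sumn [seq phi n p.1 p.2 | p <- ps] <= N by apply: leq_trans leN; apply: ltnW.
  elim: ps sol leps {rule lt} => [|[H C] ps IH] sol /= leps; first by exists 0 => //; apply: steps_refl.
  have [M3 le3 st3] : exists2 M3, M3 <= sumn [seq phi n p.1 p.2 | p <- ps] * round_cost N &
      steps (enc_goals ps ++ r) r M3.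
    by apply: IH => [p hp|]; [apply: sol; right | lia].
  have [_ h] := sol (H, C) (or_introl erefl).
  have [|M4 le4 st4] := h H (enc_goals ps ++ r) N erefl; first by rewrite /=; lia.
  exists (M4 + M3); first by rewrite mulnDl leq_add.
  rewrite /enc_goals /= -catA; exact: steps_trans st4 st3.
exists (M1 + (rule_cost G B + M2)); last by apply: steps_trans st1 (steps_can (rule r) st2).
have le1 : M1 + rule_cost G B <= round_cost N.
  apply: leq_trans (leq_add leM1 cost0) _; rewrite -mulSnr leq_mul2r; apply/orP; right.
  rewrite ltnS mul2n -addnn (_ : isz G' = isz G) ?leq_add ?leq_sqr //; exact: eqs.
rewrite addnA; apply: leq_trans (leq_add le1 leM2) _.
by rewrite -mulSn leq_mul2r lt orbT.
Qed.

(** The second alternative is meant for contraction, where the sequent grows but one unit of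
    [ser - nbr] is spent. *)
Lemma solve1 n G B G1 B1 : solved n G1 B1 ->
  nbr G + ser G1 B1 <= ser G B + nbr G1 ->
  slen G1 B1 < slen G B \/
    slen G1 B1 <= slen G B + n /\ nbr G + ser G1 B1 < ser G B + nbr G1 ->
  (forall r, can (enc_sequent G B ++ r) (enc_sequent G1 B1 ++ r) (rule_cost G B)) ->
  solved n G B.
Proof.
move=> s1 le1 le2 rule; have b1 := s1.1; apply: (@solve n G B [:: (G1, B1)]) => [|r|p [<-|]|] //.
- by lia.
- by rewrite enc_goals1.
- rewrite /= addn0 /phi; case: le2 => [lt|[le lt]].
    rewrite -addSn leq_add // leq_mul2r; lia.
  have : (ser G1 B1 - nbr G1).+1 <= ser G B - nbr G by lia.
  by rewrite -(leq_pmul2r (ltn0Sn n)) mulSn; lia.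
Qed.

Lemma solve2 n G B G1 B1 G2 B2 : solved n G1 B1 -> solved n G2 B2 ->
  nbr G + ser G1 B1 + ser G2 B2 <= ser G B + nbr G1 + nbr G2 ->
  slen G1 B1 + slen G2 B2 < slen G B ->
  (forall r, can (enc_sequent G B ++ r) (enc_sequent G1 B1 ++ enc_sequent G2 B2 ++ r)
     (rule_cost G B)) ->
  solved n G B.
Proof.
move=> s1 s2 le1 lt rule; have b1 := s1.1; have b2 := s2.1.
apply: (@solve n G B [:: (G1, B1); (G2, B2)]) => [|r|p [<-|[<-|]]|] //.
- by lia.
- by rewrite enc_goals2.
- rewrite /= addn0 /phi addnACA -mulnDl -addSn leq_add // leq_mul2r; lia.
Qed.

Lemma solved_perm n G G1 B : canon G = canon G1 -> solved n G1 B -> solved n G B.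
Proof.
move=> e; have eqs f c : msum f c G = msum f c G1.
  by elim: (preach_eq e) => {e} [//|k G0 G2 G3 p _]; rewrite (pstep_msum _ _ p).
have ep : phi n G B = phi n G1 B by rewrite /phi /slen /ser /mlen /mer /nbr !eqs.
move=> [b1 h]; split; first by move: b1; rewrite /ser /mer /nbr !eqs.
by move=> G' r N eG; rewrite ep; apply: h; rewrite eG.
Qed.

Arguments lin : simpl never.
Arguments erfree : simpl never.
Arguments flen : simpl never.
Arguments msum : simpl never.
Arguments top : simpl never.
Arguments mlin : simpl never.

Lemma top_nil : top [::] = 0.
Proof. by []. Qed.

Lemma slen_fill D X E : slen (fill D X) E = slen (fill D [::]) E + mlen X.
Proof. by rewrite /slen /mlen msum_fill; lia. Qed.

Lemma ser_fill D X E : ser (fill D X) E = ser (fill D [::]) E + mer X.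
Proof. by rewrite /ser /mer msum_fill; lia. Qed.

Lemma nbr_fill D X : nbr (fill D X) = nbr (fill D [::]) + nbr X.
Proof. exact: msum_fill. Qed.

(** Facts gathered for [lia]. An erasing connective of a part is one of the whole, so the linear
    lengths of the parts never exceed that of the whole. *)
Lemma flen2 b1 A b2 B b X : er b X = er b1 A + er b2 B ->
  flen X = (flen A + flen B).+1 ->
  [/\ flen X = (flen A + flen B).+1, lin b1 A + lin b2 B <= lin b X,
      erfree b1 A + lin b1 A = flen A, erfree b2 B + lin b2 B = flen B &
      erfree b X + lin b X = flen X].
Proof.
move=> e1 e2; rewrite !erfree_lin; split=> //; rewrite /lin.
by rewrite e1 addn_eq0; case: (er b1 A == 0); case: (er b2 B == 0) => /=; lia.
Qed.

Lemma flen1 b1 A b X : er b1 A <= er b X -> flen X = (flen A).+1 ->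
  [/\ flen X = (flen A).+1, lin b1 A <= lin b X,
      erfree b1 A + lin b1 A = flen A & erfree b X + lin b X = flen X].
Proof.
move=> e1 e2; rewrite !erfree_lin; split=> //; rewrite /lin.
by case: (er b1 A) e1 => [|x] //=; case: (er b X) => [|y] //= _; lia.
Qed.

Lemma flen_ldiv b A C : [/\ flen (Ldiv A C) = (flen A + flen C).+1,
  lin (~~ b) A + lin b C <= lin b (Ldiv A C), erfree (~~ b) A + lin (~~ b) A = flen A,
  erfree b C + lin b C = flen C & erfree b (Ldiv A C) + lin b (Ldiv A C) = flen (Ldiv A C)].
Proof. by apply: flen2; rewrite // /flen /= size_cat. Qed.

Lemma flen_rdiv b C B : [/\ flen (Rdiv C B) = (flen C + flen B).+1,
  lin b C + lin (~~ b) B <= lin b (Rdiv C B), erfree b C + lin b C = flen C,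
  erfree (~~ b) B + lin (~~ b) B = flen B &
  erfree b (Rdiv C B) + lin b (Rdiv C B) = flen (Rdiv C B)].
Proof. by apply: flen2; rewrite // /flen /= size_cat. Qed.

Lemma flen_prod b A B : [/\ flen (Prod A B) = (flen A + flen B).+1,
  lin b A + lin b B <= lin b (Prod A B), erfree b A + lin b A = flen A,
  erfree b B + lin b B = flen B & erfree b (Prod A B) + lin b (Prod A B) = flen (Prod A B)].
Proof. by apply: flen2; rewrite // /flen /= size_cat. Qed.

Lemma flen_dia b A : [/\ flen (Dia A) = (flen A).+1, lin b A <= lin b (Dia A),
  erfree b A + lin b A = flen A & erfree b (Dia A) + lin b (Dia A) = flen (Dia A)].
Proof. by apply: flen1; rewrite //= leq_addl. Qed.

Lemma flen_box b A : [/\ flen (Box A) = (flen A).+1, lin b A <= lin b (Box A),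
  erfree b A + lin b A = flen A & erfree b (Box A) + lin b (Box A) = flen (Box A)].
Proof. by apply: flen1; rewrite //= leq_addl. Qed.

Lemma flen_bang b A : [/\ flen (Bang A) = (flen A).+1, lin b A <= lin b (Bang A),
  erfree b A + lin b A = flen A & erfree b (Bang A) + lin b (Bang A) = flen (Bang A)].
Proof. exact: flen1. Qed.

(** Length lost by the linear part may reappear free of erasing connectives, so [k] is raised by
    exactly this loss and the sum bounded by [n] does not change. *)
Lemma seq_ok_fill n D X X' E : seq_ok n (fill D X) E ->
  (all ok_item X -> all ok_item X') ->
  mlin X' <= mlin X -> top X' + mlin X' <= top X + mlin X ->
  (forall k, top X <= k -> all (lv k) X -> all (lv (k + (mlin X - mlin X'))) X') ->
  seq_ok n (fill D X') E.
Proof.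
move=> [okG okE [k [lvG topG len]]] hok hlin htop hlv.
have topX : top X <= k by apply: top_sub lvG _; lia.
have [||lv' top'] := @lv_fill k (mlin X - mlin X') D X X' lvG.
- by lia.
- exact: hlv (lv_sub lvG).
split=> //.
  by move: okG; rewrite all_ok_fill => /andP[h /hok]; rewrite (all_ok_fill D X') h.
exists (k + (mlin X - mlin X')); split=> //; first by lia.
by move: len; rewrite /mlin (msum_fill _ _ D X) (msum_fill _ _ D X') -/(mlin X) -/(mlin X'); lia.
Qed.

(** A formula !A of the antecedent is negative, so the condition leaves no erasing connective in it
    ([er_inside]). *)
Lemma bangs_free As : all ok_item (bangs As) ->
  [/\ mer (bangs As) = 0, mlin (bangs As) = 0, nbr (bangs As) = 0 &
      mlen (bangs As) = top (bangs As)].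
Proof.
elim: As => //= A As IH /andP[ok /IH [e1 e2 e3 e4]].
have e : er false (Bang A) = 0 by apply: er_inside.
rewrite /mer /mlin /nbr /mlen top_fm !msum_fm -/(mer _) -/(mlin _) -/(nbr _) -/(mlen _) e1 e2 e3 e4.
by rewrite /lin /erfree e.
Qed.

Lemma lv_bangs n As : all (lv n) (bangs As).
Proof. by elim: As. Qed.

Ltac meas := rewrite /slen /ser /mlen /mer /nbr /mlin ?msum_cat ?msum_br ?msum_fm ?msum_nil
  ?top_cat ?top_fm ?top_br ?top_nil.

Lemma cf_solved n G B : cf G B -> seq_ok n G B -> solved n G B.
Proof.
elim=> {G B}
  [A|| G D B C E _ IB _ IE|G B C _ IH|G D A C E _ IA _ IE|G A C _ IH
  |D A B E _ IH|G1 G2 A B _ IA _ IB|D A _ IH|D A C _ IH|P A _ IH|D A C _ IH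
  |P A _ IH|D A B _ IH|As A _ IH|D As G B _ IH|D A G B _ IH|D A G B _ IH] ok.
- apply: (@solve n _ _ [::]) => // [r|]; first exact: can_ax.
  by apply: leq_trans (flen_gt0 A) _; rewrite /phi /slen addnAC leq_addl.
- apply: (@solve n _ _ [::]) => // r; exact: can_oneR.
- have [f1 f2 f3 f4 f5] := flen_rdiv false C B; rewrite /= in f2 f4.
  have [okG okE [k [lvG topG len]]] := ok.
  have okX : all ok_item (Fm (Rdiv C B) :: G) by move: okG; rewrite all_ok_fill => /andP[].
  have lvX := lv_sub lvG; have topX : top (Fm (Rdiv C B) :: G) <= k by apply: (top_sub lvG); lia.
  have sG : solved n G B.
    apply: IB; move: okX lvX topX => /= /andP[/andP[_ okB] okG0] lvX topX; split=> //.
    (* If the erasing connectives of C / B all lie in C, then B becomes erasing-free material; the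
       linear length of C / B pays for it. The other rules choose [k] in the same way. *)
    exists (k + (lin false (Rdiv C B) - lin true B)); split.
    + by apply: lv_mono lvX; apply: leq_addr.
    + by move: topX; rewrite top_fm; lia.
    + by move: len; rewrite /mlin (msum_fill _ _ D (_ :: _)) msum_fm; lia.
  have sE : solved n (fill D [:: Fm C]) E.
    apply/IE/(seq_ok_fill ok) => //=; first by move=> /andP[/andP[-> _] _].
    + by meas; lia.
    + by meas; lia.
  apply: (solve2 sG sE); last by move=> r; apply/can_left2/mstep_rdiv.
  + by rewrite !(ser_fill D (_ :: _)) !(nbr_fill D (_ :: _)); meas; rewrite /=; lia.
  + by rewrite !(slen_fill D (_ :: _)); meas; lia.
- have [f1 f2 f3 f4 f5] := flen_rdiv true C B; rewrite /= in f2 f4.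
  have [okG /andP[okC okB] [k [lvG topG len]]] := ok.
  have sG : solved n (G ++ [:: Fm B]) C.
    apply: IH; split=> //; first by rewrite all_cat okG /= andbT.
    exists (k + (lin true (Rdiv C B) - lin true C - lin false B)); split.
    + by rewrite all_cat /= andbT; apply: lv_mono lvG; apply: leq_addr.
    + by meas; lia.
    + by move: len; meas; lia.
  apply: (solve1 sG); last by move=> r; apply: can_rdivR.
  + by meas; rewrite /=; lia.
  + by left; meas; lia.
- have [f1 f2 f3 f4 f5] := flen_ldiv false A C; rewrite /= in f2 f3.
  have [okG okE [k [lvG topG len]]] := ok.
  have okX : all ok_item (G ++ [:: Fm (Ldiv A C)]) by move: okG; rewrite all_ok_fill => /andP[].
  have lvX := lv_sub lvG; have topX : top (G ++ [:: Fm (Ldiv A C)]) <= k by apply: (top_sub lvG); lia.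
  have sG : solved n G A.
    apply: IA; move: okX topX lvX; rewrite !all_cat /= !andbT => /and3P[okG0 okA _] topX lvG0.
    split=> //; exists (k + (lin false (Ldiv A C) - lin true A)); split.
    + by apply: lv_mono lvG0; apply: leq_addr.
    + by move: topX; meas; lia.
    + by move: len; rewrite /mlin (msum_fill _ _ D (_ ++ _)) msum_cat msum_fm msum_nil; lia.
  have sE : solved n (fill D [:: Fm C]) E.
    apply/IE/(seq_ok_fill ok); rewrite ?all_cat /= ?andbT //; first by move=> /and3P[].
    + by meas; lia.
    + by meas; lia.
  apply: (solve2 sG sE); last by move=> r; apply/can_left2/mstep_ldiv.
  + rewrite !(ser_fill D (_ :: _)) !(ser_fill D (_ ++ _)) !(nbr_fill D (_ :: _)) !(nbr_fill D (_ ++ _)).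
    by meas; rewrite /=; lia.
  + by rewrite !(slen_fill D (_ :: _)) !(slen_fill D (_ ++ _)); meas; lia.
- have [f1 f2 f3 f4 f5] := flen_ldiv true A C; rewrite /= in f2 f3.
  have [okG /andP[okA okC] [k [lvG topG len]]] := ok.
  have sG : solved n (Fm A :: G) C.
    apply: IH; split=> //=; first by apply/andP.
    exists (k + (lin true (Ldiv A C) - lin false A - lin true C)); split.
    + by apply: lv_mono lvG; apply: leq_addr.
    + by meas; lia.
    + by move: len; meas; lia.
  apply: (solve1 sG); last by move=> r; apply: can_ldivR.
  + by meas; rewrite /=; lia.
  + by left; meas; lia.
- have [f1 f2 f3 f4 f5] := flen_prod false A B.
  have s1 : solved n (fill D [:: Fm A; Fm B]) E.
    apply/IH/(seq_ok_fill ok) => //=; first by rewrite !andbT.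
    + by meas; lia.
    + by meas; lia.
  apply: (solve1 s1); last by move=> r; apply/can_left1/mstep_prod.
  + by rewrite !(ser_fill D (_ :: _)) !(nbr_fill D (_ :: _)); meas; rewrite /=; lia.
  + by left; rewrite !(slen_fill D (_ :: _)); meas; lia.
- have [f1 f2 f3 f4 f5] := flen_prod true A B.
  have [okG /andP[okA okB] [k [lvG topG len]]] := ok.
  move: okG lvG topG len; rewrite !all_cat top_cat /mlin msum_cat -!/(mlin _).
  move=> /andP[ok1 ok2] /andP[lv1 lv2] topG len.
  have s1 : solved n G1 A.
    apply: IA; split=> //; exists (k + (lin true (Prod A B) - lin true A)); split; last by lia.
      by apply: lv_mono lv1; apply: leq_addr.
    by lia.
  have s2 : solved n G2 B.
    apply: IB; split=> //; exists (k + (lin true (Prod A B) - lin true B)); split; last by lia.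
      by apply: lv_mono lv2; apply: leq_addr.
    by lia.
  apply: (solve2 s1 s2); last by move=> r; apply: can_prodR.
  + by meas; rewrite /=; lia.
  + by meas; lia.
- have s1 : solved n (fill D [::]) A by apply/IH/(seq_ok_fill ok).
  apply: (solve1 s1); last by move=> r; apply/can_left1/mstep_one.
  + by rewrite !(ser_fill D (_ :: _)) !(nbr_fill D (_ :: _)); meas; rewrite /=; lia.
  + by left; rewrite !(slen_fill D (_ :: _)); meas; rewrite /flen /=; lia.
- have [f1 f2 f3 f4] := flen_dia false A.
  have s1 : solved n (fill D [:: Br [:: Fm A]]) C.
    apply/IH/(seq_ok_fill ok) => /=; first by rewrite !andbT.
    + by meas; lia.
    + by meas; lia.
    + by move=> k; meas => h _; rewrite !andbT -/(top [:: Fm A]); meas; lia.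
  apply: (solve1 s1); last by move=> r; apply/can_left1/mstep_dia.
  + by rewrite !(ser_fill D (_ :: _)) !(nbr_fill D (_ :: _)); meas; rewrite /=; lia.
  + by left; rewrite !(slen_fill D (_ :: _)); meas; lia.
- have [f1 f2 f3 f4] := flen_dia true A.
  have [okP /andP[_ okA] [k [lvP topG len]]] := ok.
  have e : lin true (Dia A) = flen (Dia A) by rewrite /lin.
  have s1 : solved n P A.
    move: okP lvP; rewrite all_lv_br [all ok_item _]/= !andbT => okP0 /andP[topP lvP0].
    (* The opened level becomes the outermost one and must now be bounded together with the
       succedent. As <>A is linear here, its length covers both parts of the length of [A]. *)
    apply: IH; split=> //; exists (k + erfree true A); split.
    + by apply: lv_mono lvP0; apply: leq_addr.
    + by rewrite leq_add2r.
    + by move: len; meas; rewrite add0n addn0; lia.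
  apply: (solve1 s1); last by move=> r; apply: can_diaR.
  + by meas; rewrite /=; lia.
  + by left; meas; lia.
- have [f1 f2 f3 f4] := flen_box false A.
  (* Erasing the bracket releases [A] into the surrounding level; []^{-1}A being linear, its length
     pays for this. *)
  have e : lin false (Box A) = flen (Box A) by rewrite /lin.
  have s1 : solved n (fill D [:: Fm A]) C.
    apply/IH/(seq_ok_fill ok) => //=; first by rewrite !andbT.
    + by meas; lia.
    + by meas; lia.
  apply: (solve1 s1); last by move=> r; apply/can_left1/mstep_box.
  + by rewrite !(ser_fill D (_ :: _)) !(nbr_fill D (_ :: _)); meas; rewrite /=; lia.
  + by left; rewrite !(slen_fill D (_ :: _)); meas; lia.
- have [f1 f2 f3 f4] := flen_box true A.
  have [okP /andP[_ okA] [k [lvP topG len]]] := ok.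
  have s1 : solved n [:: Br P] A.
    apply: IH; split=> //; first by rewrite /= okP.
    exists (k + (lin true (Box A) - lin true A)); split.
    + rewrite all_lv_br /= andbT; apply/andP; split; first by lia.
      by apply: lv_mono lvP; apply: leq_addr.
    + by meas; lia.
    + by move: len; meas; lia.
  apply: (solve1 s1); last by move=> r; apply: can_boxR.
  + by meas; rewrite /=; lia.
  + by left; meas; lia.
- have [f1 f2 f3 f4] := flen_bang false A.
  have s1 : solved n (fill D [:: Fm A]) B.
    apply/IH/(seq_ok_fill ok) => //=; first by rewrite !andbT; apply: okm_inside_sub.
    + by meas; lia.
    + by meas; lia.
  apply: (solve1 s1); last by move=> r; apply/can_left1/mstep_bang.
  + by rewrite !(ser_fill D (_ :: _)) !(nbr_fill D (_ :: _)); meas; rewrite /=; lia.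
  + by left; rewrite !(slen_fill D (_ :: _)); meas; lia.
- have [f1 f2 f3 f4] := flen_bang true A.
  have [okP okA [k [lvP topG len]]] := ok.
  have s1 : solved n (bangs As) A.
    apply: IH; split=> //; exists (k + (lin true (Bang A) - lin true A)); split; try by lia.
    exact: lv_bangs.
  apply: (solve1 s1); last by move=> r; apply: can_bangR.
  + by rewrite /ser /=; lia.
  + by left; rewrite /slen; lia.
- have [okG okE [k [lvG topG len]]] := ok.
  have okX : all ok_item (bangs As ++ G) by move: okG; rewrite all_ok_fill => /andP[].
  have okAs : all ok_item (bangs As) by move: okX; rewrite all_cat => /andP[].
  have [e1 e2 e3 e4] := bangs_free okAs.
  have topX : top (bangs As ++ G) <= k by apply: (top_sub lvG); lia.
  (* The new level holds just what the old level held at this place, and the old one only loses [G],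
     so [k] remains valid. *)
  have s1 : solved n (fill D (bangs As ++ [:: Br (bangs As ++ G)])) B.
    apply/IH/(seq_ok_fill ok).
    + by move=> okX'; rewrite all_cat /= okX' okAs.
    + by rewrite /mlin !msum_cat msum_br msum_cat msum_nil -!/(mlin _) e2; lia.
    + rewrite /mlin !msum_cat msum_br msum_cat msum_nil -!/(mlin _) e2 !top_cat top_br.
      by rewrite top_nil; lia.
    + move=> k' topk lvk; rewrite all_cat lv_bangs all_lv_br /= andbT; apply/andP; split.
        by apply: leq_trans topk _; apply: leq_addr.
      by apply: lv_mono lvk; apply: leq_addr.
  apply: (solve1 s1); last by move=> r; apply/can_left1/mstep_contr.
  + rewrite !(ser_fill D (_ ++ _)) !(nbr_fill D (_ ++ _)) /mer /nbr !msum_cat !msum_br !msum_cat.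
    by rewrite !msum_nil -!/(mer _) -!/(nbr _) e1 e3; lia.
  (* The repeated formulae have total length at most [top] of the contracted part, hence at most [k]
     and [n]; being free of erasing connectives, they leave [ser] unchanged while the new bracket
     increases [nbr]. *)
  + right; split.
      rewrite !(slen_fill D (_ ++ _)) /mlen !msum_cat !msum_br !msum_cat.
      by rewrite msum_nil -!/(mlen _) e4; move: topX; rewrite top_cat; lia.
    rewrite !(ser_fill D (_ ++ _)) !(nbr_fill D (_ ++ _)) /mer /nbr !msum_cat !msum_br !msum_cat.
    by rewrite !msum_nil -!/(mer _) -!/(nbr _) e1 e3; lia.
- have s1 : solved n (fill D (Fm (Bang A) :: G)) B.
    apply/IH/(seq_ok_fill ok).
    + by rewrite all_cat /= andbT andbC.
    + by meas; lia.
    + by meas; lia.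
    + move=> k _; rewrite all_cat /= andbT; apply: lv_mono; apply: leq_addr.
  by apply: solved_perm s1; rewrite canon_perm.
- have s1 : solved n (fill D (G ++ [:: Fm (Bang A)])) B.
    apply/IH/(seq_ok_fill ok).
    + by rewrite all_cat /= andbT andbC.
    + by meas; lia.
    + by meas; lia.
    + move=> k _; rewrite all_cat /= andbT; apply: lv_mono; apply: leq_addr.
  by apply: solved_perm s1; rewrite canon_perm.
Qed.

(** * The polynomial bound and the conclusion *)

Lemma msum_erfree_lin G : msum (erfree false) 0 G + mlin G = mlen G.
Proof.
move: G; apply: (@meta_ind (fun x =>
  isum (erfree false) 0 x + isum (lin false) 0 x = isum flen 0 x)) => //=.
- by move=> A; apply: erfree_lin.
- by move=> x G; rewrite /mlin /mlen !msum_cons; lia.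
Qed.

Lemma seq_ok_init G B : bracket_nonneg G B -> seq_ok (size (enc_sequent G B)) G B.
Proof.
move=> /bracket_nonnegP /andP[okG okB]; split=> //.
exists (msum (erfree false) 0 G + erfree true B).
have /andP[lvG topG] := lv_total (leqnn (msum (erfree false) 0 G)).
split; first by apply: lv_mono lvG; apply: leq_addr.
  by rewrite leq_add2r.
rewrite /enc_sequent size_cat /= size_enc_mlen -/(flen B).
by have := msum_erfree_lin G; have := erfree_lin true B; lia.
Qed.

Definition phi_bound n := n + n * (n + 1).
(** The term [4 * n + 3] is the work of [PStart]: moving the input to [KL] and back takes [2 * n]
    operations each, and there are three emptiness tests. *)
Definition run_bound n := 4 * n + 3 + phi_bound n * round_cost (phi_bound n).

Lemma run_bound_poly : poly_fun run_bound.
Proof.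
have pC := poly_fun_const; have pI := poly_fun_id.
have p1 : poly_fun phi_bound by apply: poly_funD => //; apply: poly_funM => //; apply: poly_funD.
apply: poly_funD; first by apply: poly_funD => //; apply: poly_funM.
apply: poly_funM => //; rewrite /round_cost /step_cost.
have p2 : poly_fun (fun n => 3 * phi_bound n + 1) by apply: poly_funD => //; apply: poly_funM.
have p3 : poly_fun (fun n => 1 + 2 * (3 * phi_bound n + 1) ^ 2).
  by apply: poly_funD => //; apply: poly_funM => //; apply: poly_funX.
by apply: (poly_funM p3); apply: poly_funD => //; apply: poly_funM.
Qed.

Lemma gen_complete G B : bracket_nonneg G B -> derivable G B -> exists w n s',
  [/\ gen [:: Call PStart] w n, run w (init (enc_sequent G B)) = Some s' &
      size w <= run_bound (size (enc_sequent G B))].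
Proof.
move=> nn /derivable_cf c; set x := enc_sequent G B.
have [bE] := cf_solved c (seq_ok_init nn); move/(_ G [::] (phi_bound (size x)) erefl).
have le : phi (size x) G B <= phi_bound (size x).
  have szx : slen G B <= size x.
    by rewrite /x /enc_sequent size_cat /= size_enc_mlen -/(flen B) /slen; lia.
  rewrite /phi /phi_bound addn1 leq_add // leq_mul2r; apply/orP; right.
  by move: szx; rewrite /slen /ser; have := mer_mlen G; have := er_flen true B; lia.
move/(_ le) => [M leM]; rewrite cats0 => /steps_loop [w [gw rw szw]].
have [okG okB] : all ok_item G /\ okm (Some (true, false)) B.
  by apply/andP/bracket_nonnegP.
pose w0 := cpw KL false (enc_meta G) ++ cpw KL false [:: SArrow] ++
  cpw KL false (enc_formula B) ++ Emp KR :: bkw KL (rev x) ++ Emp KL :: w ++ [:: Emp KR].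
have [n gn] : gens [:: Call PStart] w0.
  apply: (@gens_alt _ 0) => //; cbv [body nth].
  apply: gens_call; first exact: gens_PI.
  apply/gens_cps/gens_call; first exact: gens_PF.
  apply/gens_do/gens_back/gens_call => //.
  exact/gens_do/gens_nil.
exists w0, n, (init [::]); split=> //.
- rewrite /w0 (_ : init x = St (enc_meta G ++ [:: SArrow] ++ enc_formula B ++ [::])
    [::] [::] [::] [::]); last by rewrite cats0.
  frun.
  have -> : rev (enc_formula B) ++ SArrow :: rev (enc_meta G) ++ [::] = rev x.
    by rewrite /x /enc_sequent rev_cat rev_cons cats0 -cats1 -catA.
  rewrite (_ : run (Emp KR :: _) (St [::] _ _ _ _) =
    run (bkw KL (rev x) ++ Emp KL :: w ++ [:: Emp KR]) (St [::] (rev x) [::] [::] [::])) //.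
  by rewrite run_bkL revK cats0 run_cat -/(init x) rw.
- have : phi (size x) G B * round_cost (phi_bound (size x)) <=
      phi_bound (size x) * round_cost (phi_bound (size x)) by rewrite leq_mul2r le orbT.
  move: (leq_trans szw leM); rewrite /run_bound /w0.
  move: (phi _ _ _ * _) (phi_bound _ * _) => p q.
  by do ?rewrite ?(size_cat, size_cpw, size_bkw, size_rev) /=; lia.
Qed.

Theorem theorem4 :
  in_NP (fun w : seq symbol =>
    exists (G : meta) (B : formula),
      w = enc_sequent G B /\ bracket_nonneg G B /\ derivable G B).
Proof.
apply: (in_NP_gen run_bound_poly) => [x w n s' g r|x [G [B [-> [nn d]]]]].
  by have [G [B [-> nn d]]] := gen_sound g r; exists G, B.
exact: gen_complete.
Qed.
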